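(* Let $2\le m\le n$ be integers. (1) If $\gcd(m,n)=1$, then for any integer $r\ge 1$, the plane curve $C\subset\mathbb{P}^2$ of degree $d=rmn$ given by $F^n+G^m=0$, where $F,G\in\mathbb{C}[x,y,z]$ are generic homogeneous polynomials of degree $rm$ and $rn$, respectively, is irreducible and has $r^2mn=\frac{d^2}{mn}$ singular points of type $x^m+y^n=0$ as its only singularities. (2) If $\gcd(m,n)>1$, then for any integer $r\ge 1$, the plane curve $C\subset\mathbb{P}^2$ of degree $d=rmn+1$ given by $L_1F^n+L_2G^m=0$, where $F,G\in\mathbb{C}[x,y,z]$ are generic homogeneous polynomials of degree $rm$ and $rn$, respectively, and $L_1,L_2$ are generic linear homogeneous polynomials, is irreducible and has $r^2mn=\frac{(d-1)^2}{mn}$ singular points of type $x^m+y^n=0$ as its only singularities. Moreover, in both cases the polynomials can be chosen so that the constructed curve is real and all its singular points are real.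
   Context: Curves are algebraic curves in the complex projective plane $\mathbb{P}^2$. A singular point $p$ of a reduced plane curve $C$ is of type $x^m+y^n=0$ if the germ $(C,p)$ is topologically equivalent to the germ at the origin of $\{x^m+y^n=0\}\subset\mathbb{C}^2$, i.e., there is a homeomorphism of neighborhoods of the points in the ambient surface mapping one germ to the other. ''Generic'' means that the tuple of polynomials lies in a suitable nonempty Zariski-open subset of the space of tuples of homogeneous polynomials of the given degrees. A curve is real if it is defined by a homogeneous polynomial with real coefficients; a point is real if it is invariant under complex conjugation. *)

(* Defs.v *)
(* Complex projective plane curves, over MathComp-Analysis and multinomials.
   The field K is instantiated at R[i], R : realType, in the theorem.
   The notations of multinomials clash with those of MathComp-Analysis, hence
   the import without notations. *)
From HB Require Import structures.
From mathcomp Require Export -(notations) mpoly.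
From mathcomp Require Import all_boot all_order all_algebra.
From mathcomp Require Import complex.
From mathcomp Require Import all_classical all_reals topology normedtype.

Set Implicit Arguments.
Unset Strict Implicit.
Unset Printing Implicit Defensive.

Import GRing.Theory Num.Theory numFieldNormedType.Exports.

Local Open Scope classical_set_scope.
Local Open Scope ring_scope.
Local Open Scope quotient_scope.
Local Open Scope card_scope.

Notation "{ 'mpoly' T [ n ] }" := (mpoly n T)
  (at level 0, T, n at level 2, format "{ 'mpoly'  T [ n ] }") : type_scope.
Notation "d .-homog" := (ishomog1 d mdeg)
  (at level 1, format "d .-homog") : form_scope.

(* The ascription selects the topology that MathComp-Analysis puts on any
   numFieldType, i.e. the one of the modulus. *)
Definition Cfield (R : realType) : numClosedFieldType := complex R.

Definition irreducible_elt (A : idomainType) (a : A) : Prop :=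
  [/\ a != 0, a \isn't a GRing.unit &
      forall b c : A, a = b * c -> b \is a GRing.unit \/ c \is a GRing.unit].

Definition germ_homeo (X Y : topologicalType) (p : X) (A : set X)
    (q : Y) (B : set Y) : Prop :=
  exists (U : set X) (V : set Y) (f : X -> Y) (g : Y -> X),
  [/\ [/\ open U, open V, U p & V q],
      {within U, continuous f} /\ {within V, continuous g},
      (forall x, U x -> V (f x) /\ g (f x) = x) /\
      (forall y, V y -> U (g y) /\ f (g y) = y),
      f p = q &
      forall x, U x -> (A x <-> B (f x))].

Section ProjectivePlane.
Variable K : numClosedFieldType.

Definition nzvec : Type := set_type [set v : 'rV[K]_3 | v != 0].
HB.instance Definition _ := Choice.on nzvec.
HB.instance Definition _ := Topological.on nzvec.

Definition proportional (u v : nzvec) : bool :=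
  `[< exists2 c : K, c != 0 & set_val u = c *: set_val v >].

Lemma proportional_refl : reflexive proportional.
Proof. by move=> u; apply/asboolP; exists 1; rewrite ?oner_eq0 ?scale1r. Qed.

Lemma proportional_sym : symmetric proportional.
Proof.
suff h u v : proportional u v -> proportional v u.
  by move=> u v; apply/idP/idP; exact: h.
move=> /asboolP[c c0 e]; apply/asboolP; exists c^-1; first by rewrite invr_eq0.
by rewrite e scalerA mulVf ?scale1r.
Qed.

Lemma proportional_trans : transitive proportional.
Proof.
move=> v u w /asboolP[c c0 e] /asboolP[d d0 e']; apply/asboolP.
by exists (c * d); rewrite ?mulf_neq0 // e e' scalerA.
Qed.

Canonical proportional_equiv :=
  EquivRel proportional
    proportional_refl proportional_sym proportional_trans.

Definition P2 : Type := quotient_topology {eq_quot proportional_equiv}.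
HB.instance Definition _ := Quotient.on P2.
HB.instance Definition _ := Choice.on P2.
HB.instance Definition _ := Topological.on P2.

Definition coords (p : P2) (i : 'I_3) : K := set_val (repr p) ord0 i.

Lemma conj_nzvec_subproof (u : nzvec) :
  map_mx Num.conj (set_val u) \in [set v : 'rV[K]_3 | v != 0].
Proof. by rewrite inE /= map_mx_eq0; have := set_valP u. Qed.

Definition conj_nzvec (u : nzvec) : nzvec :=
  exist _ (map_mx Num.conj (set_val u)) (conj_nzvec_subproof u).

Definition conj_point (p : P2) : P2 := \pi_P2 (conj_nzvec (repr p)).

Definition real_point (p : P2) : Prop := conj_point p = p.

(* For homogeneous H, vanishing does not depend on the representative of p
   used by coords. *)
Definition curve (H : {mpoly K[3]}) : set P2 :=
  [set p | meval (coords p) H = 0].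

(* Jacobian criterion; H must be a reduced equation of the curve. *)
Definition singular_points (H : {mpoly K[3]}) : set P2 :=
  [set p | curve H p /\ forall i, meval (coords p) (mderiv i H) = 0].

Definition singularity_type (m n : nat) (H : {mpoly K[3]}) (p : P2) : Prop :=
  singular_points H p /\
  germ_homeo p (curve H)
    ((0, 0) : K * K) [set w : K * K | w.1 ^+ m + w.2 ^+ n = 0].

Definition real_curve (H : {mpoly K[3]}) : Prop :=
  exists (c : K) (H0 : {mpoly K[3]}),
    [/\ c != 0, H = c *: H0 & forall mu, mcoeff mu H0 \is Num.real].

(* irreducible_elt also excludes H = 0 and powers, so that H = 0 is reduced of
   degree exactly d and singular_points H is meaningful. *)
Definition irreducible_curve_with (d N m n : nat) (H : {mpoly K[3]}) : Prop :=
  [/\ H \is d.-homog,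
      irreducible_elt H,
      singular_points H #= `I_N &
      forall p, singular_points H p -> singularity_type m n H p].

Definition real_with_real_singularities (H : {mpoly K[3]}) : Prop :=
  real_curve H /\ forall p, singular_points H p -> real_point p.

Section GenericTuples.
Variable k : nat.
Local Notation ptuple := (k.-tuple {mpoly K[3]}).

(* d.-homog contains 0, so this is an affine space. *)
Definition homog_tuples (ds : k.-tuple nat) : set ptuple :=
  [set t | forall i, tnth t i \is (tnth ds i).-homog].

Definition coef_polynomial (f : ptuple -> K) : Prop :=
  exists (N : nat) (x : 'I_N -> 'I_k * multinom 3) (Q : {mpoly K[N]}),
  forall t, f t = meval (fun j => mcoeff (x j).2 (tnth t (x j).1)) Q.

Definition zariski_open (ds : k.-tuple nat) (U : set ptuple) : Prop :=
  exists2 S : set (ptuple -> K), S `<=` coef_polynomial &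
  U = homog_tuples ds `&` [set t | exists2 f, S f & f t != 0].

End GenericTuples.
End ProjectivePlane.

Arguments zariski_open {K k} ds U.

(* Main.v *)
(* Write the curve as H = L1 F^n + L2 G^m, where L1, L2 are linear forms, or both
   equal to 1 in the coprime case.  Being generic means that finitely many
   polynomials fA, fB, fC in the coefficients do not vanish:
   - fA is the discriminant of the resultant of F and G in the last variable;
     F = G = 0 then consists of r^2 m n reduced points;
   - fB is an eliminant of H and of the 2-minors of the pair of forms
     n L1 dF + F dL1, m L2 dG + G dL2; then H is singular exactly at F = G = 0,
     where dF, dG are independent and L1 L2 <> 0, so that w2 = F and w1 = G times
     an m-th root of L2 / L1 are local coordinates with H = L1 (w1^m + w2^n);
   - fC is an eliminant expressing that H has no factor of any given degree.
   Each of the three is nonzero at an explicit real example: two grids of lines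
   for fA, two Fermat curves for fB, a curve with an irreducible affine equation
   for fC.  Along a real line starting at the grids, all but finitely many tuples
   are generic, and close to the grids the simple real roots of the resultant
   persist, so that all base points, hence all singular points, are real. *)
Require Import Defs.
From mathcomp Require Import all_boot all_order all_algebra.
From mathcomp Require Import perm separable complex.
From mathcomp Require Import all_classical all_reals topology normedtype.
From mathcomp Require Import zify ring lra.

Set Implicit Arguments.
Unset Strict Implicit.
Unset Printing Implicit Defensive.

Import Order.TTheory GRing.Theory Num.Theory numFieldNormedType.Exports.

Local Open Scope classical_set_scope.
Local Open Scope ring_scope.

(** * Sylvester determinants *)

(** Genericity is handled through a ring [A] of functions on a parameter space [T], later the
    polynomials in the coefficients of a tuple. A condition saying that forms in [x] with
    coefficients in [A] have no common nontrivial zero holds, once it holds at one parameter,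
    wherever some function in [A] does not vanish; so one example proves it generic. Each of the
    three conditions can therefore have an example that is easy for it alone. On a line, functions
    in [A] become polynomials in one variable, and lines joining the examples lead to a parameter
    where all three are nonzero. For gcd(m, n) > 1 the polynomial F^n + G^m splits into factors,
    whence [L1] and [L2]. Both cases are one pencil with [L1], [L2] of a common degree [e], which is
    0 or 1, and they differ in the examples. The norm of R[i] takes its values in R[i] itself, which
    is only partially ordered. This shapes the analytic part: Newton's iteration with geometric
    error bounds, and strict differentiability, whose estimates concern pairs of nearby points and
    pass directly through sums and products. *)

Section Sylvester.
Variable K : comNzRingType.
Implicit Types p q : {poly K}.

(** The Sylvester matrix for nominal degrees [d] of [p] and [e] of [q]. As the degrees are
    parameters, the determinant stays polynomial in the coefficients and commutes with
    specialization even where leading coefficients vanish. *)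
Definition syl (d e : nat) p q : 'M[K]_(e + d) :=
  \matrix_(i, j) (if (i < e)%N then 'X^i * p else 'X^(i - e) * q)`_j.

Lemma size_syl_row d e p q i : (i < e + d)%N ->
  (size p <= d.+1)%N -> (size q <= e.+1)%N ->
  (size ((if (i < e)%N then 'X^i * p else 'X^(i - e) * q)%R : {poly K}) <= e + d)%N.
Proof.
move=> i_lt sp sq; case: ltnP => ie.
  apply: leq_trans (size_polyMleq _ _) _; rewrite size_polyXn addSn /=.
  by apply: leq_trans (leq_add (leqnn _) sp) _; lia.
apply: leq_trans (size_polyMleq _ _) _; rewrite size_polyXn addSn /=.
by apply: leq_trans (leq_add (leqnn _) sq) _; lia.
Qed.

Lemma syl_root d e p q a :
  (size p <= d.+1)%N -> (size q <= e.+1)%N -> p.[a] = 0 -> q.[a] = 0 ->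
  syl d e p q *m \col_j a ^+ j = 0.
Proof.
move=> sp sq pa qa; apply/matrixP => i j; rewrite !mxE.
under eq_bigr do rewrite !mxE.
rewrite -horner_coef_wide ?size_syl_row //.
by case: ifP => _; rewrite hornerM ?pa ?qa mulr0.
Qed.
End Sylvester.

Lemma map_syl (K L : comNzRingType) (f : {rmorphism K -> L}) d e p q :
  map_mx f (syl d e p q) = syl d e (map_poly f p) (map_poly f q).
Proof.
apply/matrixP => i j; rewrite !mxE -coef_map.
by case: ifP => _; rewrite rmorphM /= map_polyXn.
Qed.

Lemma det_syl_root (K : fieldType) d e (p q : {poly K}) a : (0 < e + d)%N ->
  (size p <= d.+1)%N -> (size q <= e.+1)%N -> p.[a] = 0 -> q.[a] = 0 ->
  \det (syl d e p q) = 0.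
Proof.
move=> ed sp sq pa qa; apply/eqP; rewrite -det_tr; apply/det0P.
exists (\col_j a ^+ j)^T.
  apply/eqP => /matrixP/(_ 0 (Ordinal ed)); rewrite !mxE expr0 => /eqP.
  by rewrite oner_eq0.
by rewrite -trmx_mul syl_root // trmx0.
Qed.

(** If both top coefficients vanish, the last column of the matrix is zero. *)
Lemma det_syl_lead (K : fieldType) d e (p q : {poly K}) : (0 < d)%N -> (0 < e)%N ->
  (size p <= d.+1)%N -> (size q <= e.+1)%N -> \det (syl d e p q) != 0 ->
  p`_d != 0 \/ q`_e != 0.
Proof.
move=> d0 e0 sp sq; have [p0|] := eqVneq p`_d 0; last by left.
have [q0|] := eqVneq q`_e 0; last by right.
case/negP; rewrite -det_tr; apply/det0P.
have ed : ((e + d).-1 < e + d)%N by lia.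
exists (\row_j (j == Ordinal ed)%:R).
  apply/eqP => /matrixP/(_ 0 (Ordinal ed)); rewrite !mxE eqxx => /eqP.
  by rewrite oner_eq0.
apply/matrixP => i j; rewrite !mxE (bigD1 (Ordinal ed)) //= big1.
  rewrite !mxE eqxx mul1r addr0 /=; have j_lt := ltn_ord j; case: ltnP => je.
  - rewrite coefXnM; case: ltnP => // jl.
    have [/eqP ->|ne] := boolP ((e + d).-1 - j == d)%N; first exact: p0.
    by apply: nth_default; apply: leq_trans sp _; lia.
  - rewrite coefXnM; case: ltnP => // jl.
    have [/eqP ->|ne] := boolP ((e + d).-1 - (j - e) == e)%N; first exact: q0.
    by apply: nth_default; apply: leq_trans sq _; lia.
by move=> k /negPf ke; rewrite !mxE ke mul0r.
Qed.

(** A row vector in the kernel is a pair A, B with deg A < e, deg B < d and A p + B q = 0. Since p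
    is coprime to q it divides B, whose degree is below d = deg p; so B = 0, and then A = 0. The
    exact degree is asked of [p] alone. *)
Lemma det_syl_neq0 (K : closedFieldType) d e (p q : {poly K}) :
  size p = d.+1 -> (size q <= e.+1)%N ->
  (forall a, p.[a] = 0 -> q.[a] != 0) -> \det (syl d e p q) != 0.
Proof.
move=> sp sq noroot; apply/negP => /det0P [v v0 vM].
have cpq : coprimep p q.
  by apply/Pdiv.ClosedField.coprimepP => a /rootP /noroot; rewrite /root.
pose A := \sum_(i < e) v 0 (lshift d i) *: 'X^i : {poly K}.
pose B := \sum_(i < d) v 0 (rshift e i) *: 'X^i : {poly K}.
have sA : (size A <= e)%N.
  apply: leq_trans (size_sum _ _ _) _; apply/bigmax_leqP => i _.
  by apply: leq_trans (size_scale_leq _ _) _; rewrite size_polyXn.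
have sB : (size B <= d)%N.
  apply: leq_trans (size_sum _ _ _) _; apply/bigmax_leqP => i _.
  by apply: leq_trans (size_scale_leq _ _) _; rewrite size_polyXn.
have AB : A * p + B * q = 0.
  pose r i := if (i < e)%N then 'X^i * p else 'X^(i - e) * q.
  have -> : A * p + B * q = \sum_(i < e + d) v 0 i *: r i.
    rewrite big_split_ord /= !mulr_suml; congr (_ + _); apply: eq_bigr => i _.
      by rewrite -scalerAl /r /= ltn_ord.
    by rewrite -scalerAl /r /= ltnNge leq_addr /= addKn.
  apply/polyP => j; rewrite coef0 coef_sum.
  have [jl|jl] := ltnP j (e + d); last first.
    apply: big1 => i _; rewrite coefZ nth_default ?mulr0 //.
    by apply: leq_trans jl; apply: size_syl_row; rewrite ?sp.
  have /matrixP/(_ 0 (Ordinal jl)) := vM; rewrite !mxE => vM0.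
  by apply: etrans vM0; apply: eq_bigr => i _; rewrite coefZ !mxE.
have B0 : B = 0.
  have : p %| B * q.
    have -> : B * q = - (A * p) by apply/eqP; rewrite -addr_eq0 addrC AB.
    by rewrite -mulNr dvdp_mull.
  rewrite Gauss_dvdpl // => /dvdp_leq pB; apply/eqP; apply/negPn/negP => /pB.
  by rewrite sp => /leq_trans/(_ sB); rewrite ltnn.
have A0 : A = 0.
  move: AB; rewrite B0 mul0r addr0 => /eqP; rewrite mulf_eq0 => /orP[/eqP //|].
  by rewrite -size_poly_eq0 sp.
case/negP: v0; apply/eqP/rowP => i; rewrite mxE -(splitK i).
case: (fintype.split i) => j /=.
  have := congr1 (fun p : {poly K} => p`_j) A0; rewrite coef0 coef_sum => <-.
  rewrite (bigD1 j) //= coefZ coefXn eqxx mulr1 big1 ?addr0 // => k kj.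
  by rewrite coefZ coefXn (inj_eq val_inj) eq_sym (negPf kj) mulr0.
have := congr1 (fun p : {poly K} => p`_j) B0; rewrite coef0 coef_sum => <-.
rewrite (bigD1 j) //= coefZ coefXn eqxx mulr1 big1 ?addr0 // => k kj.
by rewrite coefZ coefXn (inj_eq val_inj) eq_sym (negPf kj) mulr0.
Qed.

(** A determinant vanishes at [a] at least to the order of the corank of M(a): constant row
    operations make the rows of M(a) beyond its rank zero, and each such row of the transformed M is
    divisible by X - a. *)
Lemma dvdp_det_rank (K : fieldType) n (M : 'M[{poly K}]_n) a :
  ('X - a%:P) ^+ (n - \rank (map_mx (horner_eval a) M)) %| \det M.
Proof.
set M0 := map_mx _ M; set r := \rank M0.
have hC (c : K) : horner_eval a c%:P = c by rewrite /horner_eval hornerC.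
pose L := map_mx polyC (invmx (col_ebase M0)).
have Lu : L \in unitmx by rewrite map_unitmx unitmx_inv col_ebase_unit.
have [N defN] : exists N, N = L *m M by eexists.
have N0 : map_mx (horner_eval a) N = pid_mx r *m row_ebase M0.
  rewrite defN map_mxM -map_mx_comp (_ : map_mx _ _ = invmx (col_ebase M0)).
    rewrite -[X in _ *m X = _](mulmx_ebase M0) !mulmxA mulVmx ?col_ebase_unit //.
    by rewrite mul1mx.
  by apply/matrixP => i j; rewrite mxE /= hC.
pose c i : {poly K} := if (i < r)%N then 1 else 'X - a%:P.
pose N' := \matrix_(i, j) (N i j %/ c i).
have NE : N = diag_mx (\row_i c i) *m N'.
  apply/matrixP => i j; rewrite mul_diag_mx !mxE mulrC divpK //.
  rewrite /c; case: ltnP => ir; first exact: dvd1p.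
  rewrite dvdp_XsubCl /root.
  have := congr1 (fun M : 'M__ => M i j) N0; rewrite mxE /horner_eval => ->.
  rewrite mxE big1 // => k _; rewrite mxE ltnNge ir andbF mul0r //.
have -> : \det M = (\det L)^-1 * \det N.
  by rewrite defN det_mulmx mulrA mulVr // mul1r.
rewrite dvdp_mull // NE det_mulmx dvdp_mulr // det_diag.
rewrite (eq_bigr (fun i : 'I_n => c i)); last by move=> i _; rewrite mxE.
rewrite -(big_mkord xpredT c) (big_cat_nat (n := r)) //= ?rank_leq_row // dvdp_mull //.
rewrite (eq_big_nat _ _ (F2 := fun=> 'X - a%:P)); last first.
  by move=> i /andP[ri _]; rewrite /c ltnNge ri.
by rewrite prodr_const_nat.
Qed.

(** Two common roots over the same [y] give two independent kernel vectors, the powers of [a] and of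
    [b]. Thus two base points on one fibre show up as a double root of the resultant. *)
Lemma dvdp_det_syl (K : fieldType) d e (p q : {poly {poly K}}) y a b :
  (1 < e + d)%N -> (size p <= d.+1)%N -> (size q <= e.+1)%N -> a != b ->
  (forall c, c = a \/ c = b -> (map_poly (horner_eval y) p).[c] = 0 /\
                     (map_poly (horner_eval y) q).[c] = 0) ->
  ('X - y%:P) ^+ 2 %| \det (syl d e p q).
Proof.
move=> ed sp sq ab com.
apply: dvdp_trans (dvdp_det_rank _ y); apply: dvdp_exp2l; rewrite map_syl.
set M := syl _ _ _ _.
pose W := col_mx (\row_(j < e + d) a ^+ j) (\row_j b ^+ j).
have WM : W *m M^T = 0.
  apply: trmx_inj; rewrite trmx_mul trmxK trmx0 tr_col_mx.
  rewrite mul_mx_row; apply/eqP; rewrite row_mx_eq0.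
  have rowE c : (\row_(j < e + d) c ^+ j)^T = \col_j c ^+ j.
    by apply/matrixP => i j; rewrite !mxE.
  have sz (f : {poly {poly K}}) k : (size f <= k)%N ->
      (size (map_poly (horner_eval y) f) <= k)%N.
    by apply: leq_trans; apply: size_poly.
  rewrite !rowE !syl_root ?eqxx ?sz //;
    by (have [] := com a (or_introl erefl)) + (have [] := com b (or_intror erefl)).
have fW : row_free W.
  rewrite -kermx_eq0; apply/rowV0P => v /sub_kermxP.
  rewrite -[v]hsubmxK mul_row_col; move: (lsubmx v) (rsubmx v) => u w /matrixP vW.
  have e0 := vW 0 (Ordinal (ltnW ed)); have e1 := vW 0 (Ordinal ed).
  move: e0 e1; rewrite !mxE !big_ord_recl !big_ord0 !mxE !expr0 !expr1 !mulr1 !addr0.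
  move=> /eqP; rewrite addr_eq0 => /eqP uw; rewrite uw mulNr addrC -mulrBr.
  move=> /eqP; rewrite mulf_eq0 subr_eq0 [b == a]eq_sym (negPf ab) orbF => /eqP w0.
  move: uw; rewrite w0 oppr0 => u0.
  have -> : u = 0 by apply/rowP => i; rewrite ord1 u0 mxE.
  have -> : w = 0 by apply/rowP => i; rewrite ord1 w0 mxE.
  exact: row_mx0.
have := mulmx0_rank_max WM; rewrite mxrank_tr (eqP fW); lia.
Qed.

(** * Elimination *)

Section Elimination.
Variables (K : numClosedFieldType) (T : Type) (A : (T -> K) -> Prop).
Hypothesis A_const : forall c, A (fun=> c).
Hypothesis A_add : forall a b, A a -> A b -> A (fun t => a t + b t).
Hypothesis A_mul : forall a b, A a -> A b -> A (fun t => a t * b t).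

(* Forms of degree e in x_0, ..., x_(k-1) with coefficients in A, as functions:
   the coefficients with respect to the last variable are forms in the others. *)
Fixpoint form (k e : nat) (p : T -> (nat -> K) -> K) : Prop :=
  if k is k'.+1 then
    exists c : nat -> T -> (nat -> K) -> K,
      (forall j, (j <= e)%N -> form k' (e - j) (c j)) /\
      forall t x, p t x = \sum_(j < e.+1) c j t x * x k' ^+ j
  else exists2 a, A a & forall t x, p t x = if e == 0%N then a t else 0.

Lemma eq_form k e p q : (forall t x, p t x = q t x) -> form k e p -> form k e q.
Proof. by move=> pq; rewrite (_ : p = q) //; apply/funext => t; apply/funext => x. Qed.

Lemma form0 k e : form k e (fun _ _ => 0).
Proof.
elim: k e => [|k IH] e /=; first by exists (fun=> 0) => // t x; case: ifP.
by exists (fun _ _ _ => 0); split=> // t x; rewrite big1 // => j _; rewrite mul0r.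
Qed.

Lemma formD k e p q : form k e p -> form k e q -> form k e (fun t x => p t x + q t x).
Proof.
elim: k e p q => [|k IH] e p q /=.
  move=> [a Aa pa] [b Ab qb]; exists (fun t => a t + b t); first exact: A_add.
  by move=> t x; rewrite pa qb; case: ifP; rewrite ?addr0.
move=> [c [hc pc]] [d [hd qd]]; exists (fun j t x => c j t x + d j t x); split.
  by move=> j je; apply: IH; auto.
by move=> t x; rewrite pc qd -big_split; apply: eq_bigr => j _; rewrite mulrDl.
Qed.

Lemma formZ k e a p : A a -> form k e p -> form k e (fun t x => a t * p t x).
Proof.
move=> Aa; elim: k e p => [|k IH] e p /=.
  move=> [b Ab pb]; exists (fun t => a t * b t); first exact: A_mul.
  by move=> t x; rewrite pb; case: ifP; rewrite ?mulr0.
move=> [c [hc pc]]; exists (fun j t x => a t * c j t x); split.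
  by move=> j je; apply: IH; auto.
by move=> t x; rewrite pc mulr_sumr; apply: eq_bigr => j _; rewrite mulrA.
Qed.

(** Repackages a form as one polynomial in its last variable, with coefficients zero beyond [e], so
    that Sylvester determinants apply to it. *)
Lemma form_coefs k e p : form k.+1 e p ->
  exists c : T -> (nat -> K) -> {poly K},
    [/\ forall j, (j <= e)%N -> form k (e - j) (fun t x => (c t x)`_j),
        forall t x, (size (c t x) <= e.+1)%N &
        forall t x, p t x = (c t x).[x k]].
Proof.
move=> [c [hc pc]]; exists (fun t x => \poly_(j < e.+1) c j t x); split.
- move=> j je; apply: eq_form (hc j je) => t x.
  by rewrite coef_poly ltnS je.
- by move=> t x; apply: size_poly.
- by move=> t x; rewrite horner_poly pc.
Qed.

Lemma coefs_form k e p (c : T -> (nat -> K) -> {poly K}) :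
    (forall j, (j <= e)%N -> form k (e - j) (fun t x => (c t x)`_j)) ->
    (forall t x, (size (c t x) <= e.+1)%N) ->
    (forall t x, p t x = (c t x).[x k]) ->
  form k.+1 e p.
Proof.
move=> hc sc pc; exists (fun j t x => (c t x)`_j); split=> // t x.
by rewrite pc (horner_coef_wide _ (sc t x)).
Qed.

Lemma form_sum k e (I : Type) (r : seq I) (P : pred I) F :
  (forall i, P i -> form k e (F i)) ->
  form k e (fun t x => \sum_(i <- r | P i) F i t x).
Proof.
move=> hF; elim: r => [|i r IH].
  by apply: eq_form (form0 k e) => t x; rewrite big_nil.
have [Pi|Pi] := boolP (P i).
  by apply: eq_form (formD (hF i Pi) IH) => t x; rewrite big_cons Pi.
by apply: eq_form IH => t x; rewrite big_cons (negPf Pi).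
Qed.

Lemma formM k d e p q : form k d p -> form k e q ->
  form k (d + e) (fun t x => p t x * q t x).
Proof.
elim: k d e p q => [|k IH] d e p q.
  move=> [a Aa pa] [b Ab qb]; exists (fun t => a t * b t); first exact: A_mul.
  move=> t x; rewrite pa qb addn_eq0.
  by case: (d == 0)%N; case: (e == 0)%N; rewrite ?mul0r ?mulr0.
move=> /form_coefs[c [hc sc pc]] /form_coefs[c' [hc' sc' qc']].
apply: (@coefs_form _ _ _ (fun t x => c t x * c' t x)).
- move=> j jde; apply: (@eq_form _ _
    (fun t x => \sum_(i < j.+1) (c t x)`_i * (c' t x)`_(j - i))).
    by move=> t x; rewrite coefM.
  apply: form_sum => i _; have ij : (i <= j)%N by rewrite -ltnS.
  have [id|id] := leqP i d; last first.
    apply: eq_form (form0 _ _) => t x; rewrite nth_default ?mul0r //.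
    exact: leq_trans (sc t x) id.
  have [ie|ie] := leqP (j - i) e; last first.
    apply: eq_form (form0 _ _) => t x; rewrite mulrC nth_default ?mul0r //.
    exact: leq_trans (sc' t x) ie.
  have -> : (d + e - j = (d - i) + (e - (j - i)))%N by lia.
  by apply: IH; auto.
- move=> t x; apply: leq_trans (size_polyMleq _ _) _.
  by have := leq_add (sc t x) (sc' t x); set u := (size _ + _)%N; lia.
- by move=> t x; rewrite pc qc' hornerM.
Qed.

Lemma form_lift k e p : form k e p -> form k.+1 e p.
Proof.
move=> hp; exists (fun j => if j == 0%N then p else fun _ _ => 0); split.
  by move=> [|j] _ /=; [rewrite subn0|apply: form0].
move=> t x; rewrite big_ord_recl /= mulr1 big1 ?addr0 // => j _.
by rewrite mul0r.
Qed.

Lemma form_const k a : A a -> form k 0 (fun t _ => a t).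
Proof.
by move=> Aa; elim: k => [|k IH]; [exists a|apply: form_lift].
Qed.

Lemma form_var k j : (j < k)%N -> form k 1 (fun _ x => x j).
Proof.
elim: k => // k IH; rewrite ltnS leq_eqVlt => /predU1P[->|/IH]; last exact: form_lift.
exists (fun j => if j == 1%N then fun _ _ => 1 else fun _ _ => 0); split.
  case=> [|[|j']] //= _; first exact: form0.
  by rewrite subnn; apply: (form_const k (A_const 1)).
by move=> t x; rewrite !big_ord_recl big_ord0 /= mul0r add0r mul1r addr0.
Qed.

Lemma formX k d p e : form k d p -> form k (d * e) (fun t x => p t x ^+ e).
Proof.
move=> hp; elim: e => [|e IH].
  by rewrite muln0; apply: form_const.
by rewrite mulnS; apply: eq_form (formM hp IH) => t x; rewrite exprS.
Qed.

Lemma form_prod k (I : Type) (r : seq I) (d : I -> nat) F :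
  (forall i, form k (d i) (F i)) ->
  form k (\sum_(i <- r) d i) (fun t x => \prod_(i <- r) F i t x).
Proof.
move=> hF; elim: r => [|i r IH].
  by rewrite big_nil; apply: eq_form (form_const _ (A_const 1)) => t x; rewrite big_nil.
by rewrite big_cons; apply: eq_form (formM (hF i) IH) => t x; rewrite big_cons.
Qed.

Lemma form_eval_deg0 k p : form k 0 p -> exists2 a, A a & forall t x, p t x = a t.
Proof.
elim: k p => [|k IH] p; first by move=> [a Aa pa]; exists a.
case=> c [hc pc]; have [a Aa ca] := IH (c 0%N) (hc 0%N (leqnn _)).
exists a => // t x.
by rewrite pc big_ord_recl big_ord0 ca mulr1 addr0.
Qed.

Lemma form_origin k e p t x : form k e p -> (0 < e)%N ->
  (forall j, (j < k)%N -> x j = 0) -> p t x = 0.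
Proof.
elim: k e p => [|k IH] e p; first by case=> a _ -> /=; case: e.
case=> c [hc ->] e0 x0; rewrite big1 // => j _.
have [j0|j0] := posnP j; last by rewrite x0 // expr0n eqn0Ngt j0 mulr0.
rewrite (IH _ _ (hc j (ltn_ord j))) ?mul0r ?j0 ?subn0 // => i ik.
exact/x0/ltnW.
Qed.

Lemma form_supp k e p t x y : form k e p ->
  (forall j, (j < k)%N -> x j = y j) -> p t x = p t y.
Proof.
elim: k e p => [|k IH] e p; first by case=> a _ pa _; rewrite !pa.
case=> c [hc pc] xy; rewrite !pc; apply: eq_bigr => j _; rewrite xy //.
by rewrite (IH _ _ (hc j (ltn_ord j))) // => i ik; apply/xy/ltnW.
Qed.

(* The degree condition on the entries makes every term of the Leibniz formula
   a form of degree sum_i r i - sum_j c j, or zero. *)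
Lemma form_det k n e (r c : 'I_n -> nat) (M : 'I_n -> 'I_n -> T -> (nat -> K) -> K) :
  (forall i j, if (c j <= r i)%N then form k (r i - c j) (M i j)
               else forall t x, M i j t x = 0) ->
  (\sum_i r i = e + \sum_i c i)%N ->
  form k e (fun t x => \det (\matrix_(i, j) M i j t x)).
Proof.
move=> hM sumr.
apply: (@eq_form _ _ (fun t x => \sum_(s : 'S_n) (-1) ^+ s * \prod_i M i (s i) t x)).
  move=> t x; apply: eq_bigr => s _; congr (_ * _); apply: eq_bigr => i _.
  by rewrite mxE.
apply: form_sum => s _; apply: (formZ (a := fun=> (-1) ^+ s)) => //.
have [/forallP le_cr|/forallPn[i /negPf ci]] := boolP [forall i, c (s i) <= r i]%N; last first.
  apply: eq_form (form0 _ _) => t x; rewrite (bigD1 i) //=.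
  by have := hM i (s i); rewrite ci => ->; rewrite mul0r.
have -> : e = (\sum_i (r i - c (s i)))%N.
  rewrite sumnB // sumr [X in (_ - X)%N](_ : _ = (\sum_i c i)%N) ?addnK //.
  by rewrite [RHS](reindex_inj (@perm_inj _ s)).
apply: form_prod => i.
by have := hM i (s i); rewrite le_cr.
Qed.

(** The resultant is isobaric. With weight d + i for row i < e, weight i for the other rows, and
    weight j for column j, every entry has degree row weight minus column weight; the total weights
    differ by d e. *)
Lemma form_det_syl k d e (p q : T -> (nat -> K) -> {poly K}) :
  (forall j, (j <= d)%N -> form k (d - j) (fun t x => (p t x)`_j)) ->
  (forall t x, (size (p t x) <= d.+1)%N) ->
  (forall j, (j <= e)%N -> form k (e - j) (fun t x => (q t x)`_j)) ->
  (forall t x, (size (q t x) <= e.+1)%N) ->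
  form k (d * e) (fun t x => \det (syl d e (p t x) (q t x))).
Proof.
move=> hp sp hq sq.
apply: (@form_det _ _ _ (fun i => if (i < e)%N then d + i else i)%N (fun j => j)
  (fun i j t x => (if (i < e)%N then 'X^i * p t x else 'X^(i - e) * q t x)`_j)).
  move=> i j; case: (ltnP i e) => ie /=.
    case: leqP => ji; last first.
      move=> t x; rewrite nth_default // (leq_trans (size_polyMleq _ _)) //.
      by rewrite size_polyXn addSn /= (leq_trans (leq_add (leqnn _) (sp t x))) //; lia.
    have [ij|ij] := ltnP j i.
      by apply: eq_form (form0 _ _) => t x; rewrite coefXnM ij.
    have -> : (d + i - j = d - (j - i))%N by lia.
    have jd : (j - i <= d)%N by lia.
    by apply: eq_form (hp _ jd) => t x; rewrite coefXnM ltnNge ij.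
  case: leqP => ji; last first.
    move=> t x; rewrite nth_default // (leq_trans (size_polyMleq _ _)) //.
    by rewrite size_polyXn addSn /= (leq_trans (leq_add (leqnn _) (sq t x))) //; lia.
  have [ij|ij] := ltnP j (i - e).
    by apply: eq_form (form0 _ _) => t x; rewrite coefXnM ij.
  have -> : (i - j = e - (j - (i - e)))%N by lia.
  have jd : (j - (i - e) <= e)%N by lia.
  by apply: eq_form (hq _ jd) => t x; rewrite coefXnM ltnNge ij.
rewrite !big_split_ord /= (eq_bigr (fun i : 'I_e => d + i)%N); last by move=> i _; rewrite ltn_ord.
rewrite big_split /= sum_nat_const card_ord.
rewrite (eq_bigr (fun i : 'I_d => e + i)%N); last by move=> i _; rewrite ltnNge leq_addr.
lia.
Qed.

(** The scalars are constants, independent of [t]: a combination chosen for its behaviour at one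
    parameter is again a form and can be used at all the others. *)
Inductive span (P : (T -> (nat -> K) -> K) -> Prop) : (T -> (nat -> K) -> K) -> Prop :=
| span_in p of P p : span P p
| span_add p c q of span P p & span P q : span P (fun t x => p t x + c * q t x).

Lemma span_form P k e p : (forall p, P p -> form k e p) -> span P p -> form k e p.
Proof.
move=> hP; elim=> [|{}p c q _ hp _ hq]; first exact: hP.
by apply: formD => //; apply: (formZ (a := fun=> c)).
Qed.

Lemma fresh_scalar (s : seq K) : exists c : K, c \notin s.
Proof.
apply/not_existsP => hs; pose r := [seq i%:R : K | i <- iota 0 (size s).+1].
suff : (size r <= size s)%N by rewrite size_map size_iota ltnn.
apply: uniq_leq_size => [|x _]; last by have := hs x; case: (x \in s).
by rewrite map_inj_uniq ?iota_uniq // => i j /eqP; rewrite eqr_nat => /eqP.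
Qed.

(** By induction on the points: adding a nonzero multiple of a [p] that is nonzero at the new point
    repairs that point, and each old point forbids at most one value of the scalar. *)
Lemma span_nonvanishing P t (X : K -> nat -> K) (s : seq K) :
  (exists p, P p) ->
  (forall a, a \in s -> exists2 p, P p & p t (X a) != 0) ->
  exists2 p, span P p & forall a, a \in s -> p t (X a) != 0.
Proof.
move=> [p0 Pp0]; elim: s => [|a s IH] hs; first by exists p0 => //; apply: span_in.
have [|q sq hq] := IH; first by move=> b bs; apply: hs; rewrite inE bs orbT.
have [p Pp pa] := hs a (mem_head _ _).
have [c hc] := fresh_scalar [seq - q t (X b) / p t (X b) | b <- a :: s].
have [qa|qa] := eqVneq (q t (X a)) 0; last first.
  by exists q => // b; rewrite inE => /predU1P[->|/hq].
have [d hd] := fresh_scalar (0 :: [seq - q t (X b) / p t (X b) | b <- s]).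
exists (fun t x => q t x + d * p t x); first by apply: span_add => //; apply: span_in.
move=> b; rewrite inE => /predU1P[->|bs].
  by rewrite qa add0r mulf_neq0 //; move: hd; rewrite inE negb_or => /andP[].
have [pb|pb] := eqVneq (p t (X b)) 0; first by rewrite pb mulr0 addr0 hq.
apply: contra hd => /eqP qdp; rewrite inE; apply/orP; right.
apply/mapP; exists b => //; apply: (mulIf pb); rewrite divfK //.
by apply/eqP; rewrite -addr_eq0 addrC qdp.
Qed.

Definition put (k : nat) (x : nat -> K) (a : K) : nat -> K :=
  fun j => if j == k then a else x j.

Definition nonzero (k : nat) (x : nat -> K) := exists2 j, (j < k)%N & x j != 0.

Lemma form_put k e p t x a : form k e p -> p t (put k x a) = p t x.
Proof.
by move=> hp; apply: form_supp hp _ => j jk; rewrite /put ltn_eqF.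
Qed.

(* The main theorem of elimination theory.  A common zero of P lies over a
   common zero of the resultants of one p1 in P, of nonvanishing leading
   coefficient, with the linear combinations of P: if no root of p1 is a common
   zero of P, some combination vanishes at none of them. *)
Theorem elimination k e P t0 : (0 < e)%N -> (exists p, P p) ->
  (forall p, P p -> form k e p) ->
  (forall x, nonzero k x -> exists2 p, P p & p t0 x != 0) ->
  exists2 f, A f & f t0 != 0 /\
    forall t x, f t != 0 -> nonzero k x -> exists2 p, P p & p t x != 0.
Proof.
elim: k e P => [|k IH] e P e0 [p0 Pp0] hP nz0.
  by exists (fun=> 1); [apply: A_const|split=> [|t x _ []//]; rewrite oner_eq0].
(* Not vanishing at (0 : ... : 0 : 1) means that the coefficient of [x k ^+ e] in [p1], a function
   [l] of the parameter alone, is nonzero at [t0]. *)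
have [|p1 Pp1 p1t0] := nz0 (put k (fun=> 0) 1).
  by exists k; rewrite // /put eqxx oner_eq0.
have coef_of q : form k.+1 e q -> exists c : T -> (nat -> K) -> {poly K},
    [/\ forall j, (j <= e)%N -> form k (e - j) (fun t x => (c t x)`_j),
        forall t x, (size (c t x) <= e.+1)%N,
        forall t x, q t x = (c t x).[x k] &
        forall t x a, q t (put k x a) = (c t x).[a]].
  move=> /form_coefs[c [hc sc qc]]; exists c; split=> // t x a.
  rewrite qc {2}/put eqxx; congr _.[_]; apply/polyP => j.
  have [je|je] := leqP j e; first exact: form_put (hc j je).
  by rewrite !nth_default //; apply: leq_trans (sc _ _) je.
have [c1 [hc1 sc1 p1c p1p]] := coef_of p1 (hP p1 Pp1).
have [l Al hl] : exists2 l, A l & forall t x, (c1 t x)`_e = l t.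
  by have := hc1 e (leqnn e); rewrite subnn => /form_eval_deg0.
have p1origin t a : p1 t (put k (fun=> 0) a) = l t * a ^+ e.
  rewrite p1p (horner_coef_wide _ (sc1 _ _)) big_ord_recr /= hl big1 ?add0r // => j _.
  by rewrite (form_origin t (hc1 j (ltnW (ltn_ord j)))) ?mul0r // subn_gt0.
have lt0 : l t0 != 0 by move: p1t0; rewrite p1origin expr1n mulr1.
pose coefs q (c : T -> (nat -> K) -> {poly K}) :=
  [/\ forall j, (j <= e)%N -> form k (e - j) (fun t x => (c t x)`_j),
      forall t x, (size (c t x) <= e.+1)%N,
      forall t x, q t x = (c t x).[x k] &
      forall t x a, q t (put k x a) = (c t x).[a]].
pose res c t x := \det (syl e e (c1 t x) (c t x)).
pose Q r := exists2 q, span P q & exists2 c, coefs q c & r = res c.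
have spanQ q : span P q -> exists c, coefs q c.
  by move=> sq; apply: coef_of; apply: span_form sq.
have [||||f Af [ft0 hf]] := IH (e * e)%N Q.
- by rewrite muln_gt0 e0.
- have s0 := span_in Pp0; have [c qc] := spanQ p0 s0.
  by exists (res c); exists p0 => //; exists c.
- by move=> r [q sq [c [hc sc _ _] ->]]; apply: form_det_syl.
- move=> x [j jk xj]; have c1x : size (c1 t0 x) = e.+1.
    apply/eqP; rewrite eqn_leq sc1 ltnNge; apply: contra lt0 => sz.
    by rewrite -(hl t0 x) nth_default.
  have [rs c1E] := closed_field_poly_normal (c1 t0 x).
  have rs_root a : (c1 t0 x).[a] = 0 -> a \in rs.
    move=> ca; have : root (c1 t0 x) a by apply/eqP.
    rewrite c1E rootZ ?root_prod_XsubC //.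
    by rewrite lead_coef_eq0 -size_poly_eq0 c1x.
  have [||q sq hq] := @span_nonvanishing P t0 (put k x) rs; first by exists p0.
    move=> a _; apply: nz0; exists j; first exact: ltnW.
    by rewrite /put ltn_eqF.
  have [c qc] := spanQ q sq; exists (res c); first by exists q => //; exists c.
  case: qc => _ sc _ cq; apply: det_syl_neq0 => // a /rs_root /hq.
  by rewrite cq.
(* The factor [l] takes care of the point (0 : ... : 0 : 1), which has no projection to the first
   [k] coordinates: there [p1] is [l t] times a power of [x k]. *)
exists (fun t => f t * l t); first exact: A_mul.
split=> [|t x]; first by rewrite mulf_neq0.
rewrite mulf_eq0 negb_or => /andP[ft lt] [j jk xj].
apply/not_exists2P => Px0.
have Pz p : P p -> p t x = 0.
  by move=> Pp; have [//|] := Px0 p; move/negP/negPn/eqP.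
have xk : nonzero k x.
  move: jk; rewrite ltnS leq_eqVlt => /predU1P[jk|jk]; last by exists j.
  apply: contrapT => x0; have xk0 i : (i < k)%N -> x i = 0.
    by move=> ik; apply/eqP/negPn/negP => xi; apply: x0; exists i.
  have : p1 t (put k (fun=> 0) (x k)) = 0.
    rewrite -[RHS](Pz _ Pp1); apply: form_supp (hP _ Pp1) _ => i; rewrite ltnS /put.
    case: eqP => [-> //|ik] ik'; rewrite xk0 // ltn_neqAle ik' andbT; exact/eqP.
  move/eqP; rewrite p1origin mulf_eq0 (negPf lt) /= expf_eq0 => /andP[_].
  by rewrite -jk (negPf xj).
have [_ [q sq [c [_ sc qc _] ->]]] := hf t x ft xk.
rewrite /res (@det_syl_root _ _ _ _ _ (x k)) ?eqxx ?sc1 //; first by rewrite addn_gt0 e0.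
  by rewrite -p1c Pz.
rewrite -qc; elim: sq {qc} => [p /Pz //|p b p' _ p0' _ p0''].
by rewrite p0' p0'' mulr0 addr0.
Qed.
End Elimination.

(** * Families of homogeneous polynomials *)

Section Families.
Variables (K : numClosedFieldType) (T : Type) (A : (T -> K) -> Prop).
Hypothesis A_const : forall c, A (fun=> c).
Hypothesis A_add : forall a b, A a -> A b -> A (fun t => a t + b t).
Hypothesis A_mul : forall a b, A a -> A b -> A (fun t => a t * b t).

Lemma A_ext a b : (forall t, a t = b t) -> A a -> A b.
Proof. by move=> ab; rewrite (_ : a = b) //; apply/funext. Qed.

Lemma A_sum (I : Type) (r : seq I) (P : pred I) (F : I -> T -> K) :
  (forall i, P i -> A (F i)) -> A (fun t => \sum_(i <- r | P i) F i t).
Proof.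
move=> AF; elim: r => [|i r IH].
  by apply: A_ext (A_const 0) => t; rewrite big_nil.
have [Pi|Pi] := boolP (P i).
  by apply: A_ext (A_add (AF i Pi) IH) => t; rewrite big_cons Pi.
by apply: A_ext IH => t; rewrite big_cons (negPf Pi).
Qed.

Variable n : nat.

Definition hfam (d : nat) (p : T -> {mpoly K[n]}) :=
  (forall t, p t \is d.-homog) /\ (forall m, A (fun t => mcoeff m (p t))).

Lemma hfamD d p q : hfam d p -> hfam d q -> hfam d (fun t => p t + q t).
Proof.
move=> [hp Ap] [hq Aq]; split=> [t|m]; first exact: dhomogD.
by apply: A_ext (A_add (Ap m) (Aq m)) => t; rewrite mcoeffD.
Qed.

Lemma hfamM d e p q : hfam d p -> hfam e q -> hfam (d + e) (fun t => p t * q t).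
Proof.
move=> [hp Ap] [hq Aq]; split=> [t|m]; first exact: dhomogM.
apply: A_ext (_ : A (fun t => \sum_(k : bmultinom n (mdeg m).+1 * bmultinom n (mdeg m).+1
  | m == mnm_add k.1 k.2) (mcoeff k.1 (p t) * mcoeff k.2 (q t)))).
  by move=> t; rewrite mcoeffM.
by apply: A_sum => k _; apply: A_mul.
Qed.

Lemma hfam_const d p : p \is d.-homog -> hfam d (fun=> p).
Proof. by move=> hp; split. Qed.

Lemma hfamX d p e : hfam d p -> hfam (d * e) (fun t => p t ^+ e).
Proof.
move=> hp; elim: e => [|e IH].
  by rewrite muln0; apply: hfam_const; apply: dhomog1.
rewrite mulnS (_ : (fun t => p t ^+ e.+1) = fun t => p t * p t ^+ e); first exact: hfamM.
by apply/funext => t; rewrite exprS.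
Qed.

Lemma hfamZ d c p : hfam d p -> hfam d (fun t => c *: p t).
Proof.
move=> hp; rewrite (_ : (fun t => _) = fun t => mpolyC n c * p t).
  rewrite -[d]add0n; apply: hfamM => //; apply: hfam_const.
  by rewrite -alg_mpolyC dhomogZ // dhomog1.
by apply/funext => t; rewrite mul_mpolyC.
Qed.

Lemma dhomog_mderiv d i (p : {mpoly K[n]}) : p \is d.-homog -> mderiv i p \is (d.-1).-homog.
Proof.
move=> /dhomogP hp; apply/dhomogP => m; rewrite mcoeff_msupp mcoeff_deriv.
have [pm _|pm] := boolP (mnm_add m (mnm1 i) \in msupp p).
  by have := hp _ pm; rewrite /= mdegD mdeg1 addn1 => <-.
by rewrite (memN_msupp_eq0 pm) mul0rn eqxx.
Qed.

Lemma hfam_mderiv d p i : hfam d p -> hfam d.-1 (fun t => mderiv i (p t)).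
Proof.
move=> [hp Ap]; split=> [t|m]; first exact: dhomog_mderiv.
apply: A_ext (A_mul (A_const (m i).+1%:R) (Ap (mnm_add m (mnm1 i)))) => t.
by rewrite mcoeff_deriv mulr_natl.
Qed.

Lemma mderiv_homog0 i (p : {mpoly K[n]}) : p \is 0.-homog -> mderiv i p = 0.
Proof.
move=> hp; apply/mpolyP => m; rewrite mcoeff_deriv mcoeff0.
rewrite (dhomog_nemf_coeff hp) ?mul0rn //=.
by rewrite mdegD mdeg1 addn1.
Qed.

(** For e = 0 the truncated degree (d + e).-1 would be off by one, but then the derivative is zero,
    which is homogeneous of every degree. This lets the case L1 = L2 = 1 run along. *)
Lemma hfamM_mderiv d e p q i : (0 < d)%N -> hfam d p -> hfam e q ->
  hfam (d + e).-1 (fun t => p t * mderiv i (q t)).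
Proof.
case: e => [|e] d0 hp hq; last by rewrite addnS; apply: hfamM => //; apply: (hfam_mderiv i hq).
rewrite (_ : (fun t => _) = fun=> 0); first by apply/hfam_const/dhomog0.
by apply/funext => t; rewrite mderiv_homog0 ?mulr0 //; case: hq.
Qed.

Lemma hfam_form d p : hfam d p -> form A n d (fun t x => meval (fun i : 'I_n => x i) (p t)).
Proof.
move=> [hp Ap].
apply: eq_form (_ : form A n d (fun t x => \sum_(m : bmultinom n d.+1 | mdeg m == d)
    mcoeff m (p t) * \prod_(i < n) x i ^+ m i)).
  move=> t x.
  have sp : (msize (p t) <= d.+1)%N.
    rewrite msizeE; apply/bigmax_leqP_seq => m mp _.
    by rewrite (dhomog_mf (hp t) mp).
  rewrite {2}(mpolywE sp) raddf_sum /= big_mkcond; apply: eq_bigr => m _.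
  rewrite mevalZ mevalX; case: eqP => // /eqP md.
  by rewrite (dhomog_nemf_coeff (hp t) md) mul0r.
apply: form_sum => // m /eqP md.
apply: (formZ A_mul (Ap m)).
have dE : (\sum_(i < n) 1 * m i)%N = d.
  by rewrite -[RHS]md mdegE; apply: eq_bigr => i _; rewrite mul1n.
rewrite -[d in form _ _ d _]dE.
apply: (@form_prod _ _ _ A_const A_add A_mul n _ _ (fun i => 1 * m i)%N
  (fun (i : 'I_n) t x => x i ^+ m i)) => i.
apply: (formX A_const A_add A_mul (p := fun t x => x i)).
exact: form_var.
Qed.

End Families.

(** * Singularities of a pencil *)

Lemma mderivXn (R : comNzRingType) k (i : 'I_k) (p : {mpoly R[k]}) n :
  mderiv i (p ^+ n) = n%:R *: (p ^+ n.-1 * mderiv i p).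
Proof.
elim: n => [|n IH]; first by rewrite expr0 -mpolyC1 mderivC scale0r.
rewrite exprS mderivM IH /=; case: n {IH} => [|n].
  by rewrite !expr0 mulr1 mul1r scale0r mulr0 addr0 scale1r.
by rewrite -scalerAr mulrA -exprS [mderiv i p * _]mulrC
  -[n.+2]addn1 natrD scalerDl scale1r addrC.
Qed.

Section PencilCurve.
Variables (K : numClosedFieldType) (m n : nat).
Hypotheses (m_gt1 : (1 < m)%N) (n_gt1 : (1 < n)%N).
Implicit Types F G L : {mpoly K[3]}.

Definition pencil F G (L1 L2 : {mpoly K[3]}) := L1 * F ^+ n + L2 * G ^+ m.

(** The cofactor of [F ^+ k.-1] in the derivative of [L * F ^+ k]; divided by L F it would be the
    logarithmic derivative of L F^k. *)
Definition dlog k F L (i : 'I_3) : {mpoly K[3]} :=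
  k%:R *: (L * mderiv i F) + F * mderiv i L.

Definition dlog_minor F G (L1 L2 : {mpoly K[3]}) i j :=
  dlog n F L1 i * dlog m G L2 j - dlog n F L1 j * dlog m G L2 i.

Lemma mderiv_pencil F G (L1 L2 : {mpoly K[3]}) i : mderiv i (pencil F G L1 L2) =
  F ^+ n.-1 * dlog n F L1 i + G ^+ m.-1 * dlog m G L2 i.
Proof.
have h k (P L : {mpoly K[3]}) : (0 < k)%N -> mderiv i (L * P ^+ k) = P ^+ k.-1 * dlog k P L i.
  move=> k0; rewrite mderivM mderivXn /dlog -{1}(prednK k0) exprS.
  by rewrite -!mul_mpolyC; ring.
by rewrite /pencil mderivD !h // ltnW.
Qed.

(** Phrased as the nonvanishing of one among finitely many forms, the shape to which [elimination]
    applies. *)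
Definition regular_at F G (L1 L2 : {mpoly K[3]}) v :=
  meval v (pencil F G L1 L2) != 0 \/
  exists i j, meval v (dlog_minor F G L1 L2 i j) != 0.

Definition jacobian F G v i j :=
  meval v (mderiv i F) * meval v (mderiv j G) -
  meval v (mderiv j F) * meval v (mderiv i G).

(** At a singular point the vector (F^(n-1), G^(m-1)) is killed by a 2 by 2 matrix of nonzero
    determinant, so it is zero by Cramer's rule. Conversely n - 1 and m - 1 are positive, so F = G =
    0 kills all derivatives. *)
Lemma pencil_singularP F G (L1 L2 : {mpoly K[3]}) v : regular_at F G L1 L2 v ->
  (meval v (pencil F G L1 L2) = 0 /\
   forall i, meval v (mderiv i (pencil F G L1 L2)) = 0) <->
  (meval v F = 0 /\ meval v G = 0).
Proof.
move=> reg; split=> [[H0 dH0]|[F0 G0]]; last first.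
  split=> [|i].
    rewrite /pencil mevalD !mevalM !rmorphXn /= F0 G0 !expr0n.
    by case: m n m_gt1 n_gt1 => [|[|?]] [|[|?]] //=; rewrite !mulr0 addr0.
  rewrite mderiv_pencil mevalD !mevalM !rmorphXn /= F0 G0 !expr0n.
  by case: m n m_gt1 n_gt1 => [|[|?]] [|[|?]] //=; rewrite !mul0r addr0.
case: reg => [/eqP //|[i [j]]]; rewrite /dlog_minor mevalB !mevalM => /eqP ij.
have eqn i' : meval v F ^+ n.-1 * meval v (dlog n F L1 i') +
    meval v G ^+ m.-1 * meval v (dlog m G L2 i') = 0.
  by have := dH0 i'; rewrite mderiv_pencil mevalD !mevalM !rmorphXn.
move: (eqn i) (eqn j) ij.
set f := _ ^+ _; set g := _ ^+ _; set a := meval v _; set b := meval v _.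
set c := meval v _; set d := meval v _ => e1 e2 ij.
have f0 : f = 0.
  apply/eqP/negPn/negP => f0; apply: ij; apply: (mulfI f0); rewrite mulr0.
  have -> : f * (a * d - c * b) = (f * a + g * b) * d - (f * c + g * d) * b by ring.
  by rewrite e1 e2; ring.
have g0 : g = 0.
  apply/eqP/negPn/negP => g0; apply: ij; apply: (mulfI g0); rewrite mulr0.
  have -> : g * (a * d - c * b) = a * (f * c + g * d) - c * (f * a + g * b) by ring.
  by rewrite e1 e2; ring.
by split; apply/eqP; [move/eqP: f0|move/eqP: g0]; rewrite expf_eq0 => /andP[].
Qed.

(** Where F = G = 0 the pencil vanishes, so regularity comes from a minor, and there the minor
    equals n m L1 L2 times the Jacobian of F and G. *)
Lemma pencil_transversal F G (L1 L2 : {mpoly K[3]}) v : regular_at F G L1 L2 v ->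
  meval v F = 0 -> meval v G = 0 ->
  [/\ meval v L1 != 0, meval v L2 != 0 & exists i j, jacobian F G v i j != 0].
Proof.
move=> reg F0 G0; case: reg => [|[i [j]]].
  rewrite /pencil mevalD !mevalM !rmorphXn /= F0 G0 !expr0n.
  by case: m n m_gt1 n_gt1 => [|?] [|?] //=; rewrite !mulr0 addr0 eqxx.
rewrite /dlog_minor mevalB !mevalM /dlog !mevalD !mevalZ !mevalM F0 G0 !mul0r !addr0.
set l1 := meval v L1; set l2 := meval v L2 => h.
have : l1 * l2 * jacobian F G v i j != 0.
  apply: contra h => /eqP h; apply/eqP.
  transitivity (n%:R * m%:R * (l1 * l2 * jacobian F G v i j)); last by rewrite h mulr0.
  by rewrite /jacobian; ring.
by rewrite !mulf_eq0 !negb_or => /andP[/andP[-> ->] ?]; split=> //; exists i, j.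
Qed.

Section Family.
Variables (T : Type) (A : (T -> K) -> Prop).
Hypothesis A_const : forall c, A (fun=> c).
Hypothesis A_add : forall a b, A a -> A b -> A (fun t => a t + b t).
Hypothesis A_mul : forall a b, A a -> A b -> A (fun t => a t * b t).
Variables (r e : nat) (F G L1 L2 : T -> {mpoly K[3]}).
Hypothesis r_gt0 : (0 < r)%N.
Hypotheses (hF : hfam A (r * m) F) (hG : hfam A (r * n) G).
Hypotheses (hL1 : hfam A e L1) (hL2 : hfam A e L2).

Lemma hfam_pencil : hfam A (r * m * n + e) (fun t => pencil (F t) (G t) (L1 t) (L2 t)).
Proof.
apply: hfamD => //.
  by rewrite addnC; apply: hfamM => //; apply: hfamX.
by rewrite addnC mulnAC; apply: hfamM => //; apply: hfamX.
Qed.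

Lemma hfam_dlog k d P Q i : (0 < d)%N -> hfam A d P -> hfam A e Q ->
  hfam A (d + e).-1 (fun t => dlog k (P t) (Q t) i).
Proof.
move=> d0 hP hQ; apply: hfamD => //; last exact: hfamM_mderiv.
apply: hfamZ => //; rewrite -(prednK d0) addnC addnS /= .
by apply: hfamM => //; apply: hfam_mderiv.
Qed.

Lemma regular_open t0 :
  (forall v : 'I_3 -> K, (exists i, v i != 0) -> regular_at (F t0) (G t0) (L1 t0) (L2 t0) v) ->
  exists2 f, A f & f t0 != 0 /\ forall t (v : 'I_3 -> K), f t != 0 -> (exists i, v i != 0) ->
    regular_at (F t) (G t) (L1 t) (L2 t) v.
Proof.
move=> reg.
have rm : (0 < r * m)%N by rewrite muln_gt0 r_gt0 ltnW.
have rn : (0 < r * n)%N by rewrite muln_gt0 r_gt0 ltnW.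
(* [elimination] takes forms of a single degree: the pencil, of degree [d2], is raised to the power
   [d1], and the minors, of degree [d1], to the power [d2]. *)
pose d1 := ((r * m + e).-1 + (r * n + e).-1)%N; pose d2 := (r * m * n + e)%N.
have d1_gt0 : (0 < d1)%N by rewrite /d1; lia.
have d2_gt0 : (0 < d2)%N by rewrite /d2 addn_gt0 muln_gt0 rm ltnW.
pose ev (p : T -> {mpoly K[3]}) k t (x : nat -> K) := meval (fun i : 'I_3 => x i) (p t) ^+ k.
pose HH t := pencil (F t) (G t) (L1 t) (L2 t).
pose MM i j t := dlog_minor (F t) (G t) (L1 t) (L2 t) i j.
pose P p := p = ev HH d1 \/ exists i j, p = ev (MM i j) d2.
have regP t (x : nat -> K) : regular_at (F t) (G t) (L1 t) (L2 t) (fun i : 'I_3 => x i) <->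
    exists2 p, P p & p t x != 0.
  split=> [[h|[i [j h]]]|[p [->|[i [j ->]]]]].
  - by exists (ev HH d1); [left|rewrite /ev expf_neq0].
  - by exists (ev (MM i j) d2); [right; exists i, j|rewrite /ev expf_neq0].
  - by rewrite /ev expf_eq0 d1_gt0 => h; left.
  - by rewrite /ev expf_eq0 d2_gt0 => h; right; exists i, j.
have [||||f Af [ft0 hf]] := @elimination K T A A_const A_add A_mul 3 (d1 * d2)%N P t0.
- by rewrite muln_gt0 d1_gt0.
- by exists (ev HH d1); left.
- move=> p [->|[i [j ->]]].
    rewrite mulnC; apply: formX => //.
    by apply: (hfam_form A_const A_add A_mul); apply: hfam_pencil.
  apply: formX => //.
  apply: (hfam_form A_const A_add A_mul).
  rewrite /MM /dlog_minor /d1; apply: hfamD => //; first by apply: hfamM => //; apply: hfam_dlog.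
  rewrite (_ : (fun t => _) = fun t => -1 *: (dlog n (F t) (L1 t) j * dlog m (G t) (L2 t) i)).
    by apply: hfamZ => //; apply: hfamM => //; apply: hfam_dlog.
  by apply/funext => t; rewrite scaleN1r.
- by move=> x [j j3 xj]; apply/regP; apply: reg; exists (Ordinal j3).
exists f => //; split=> // t v ft [i vi].
pose x j := if insub j is Some i then v i else 0 : K.
have xv (j : 'I_3) : x j = v j by rewrite /x insubT //= => ?; congr v; apply/val_inj.
have -> : v = fun i : 'I_3 => x i by apply/funext => j; rewrite xv.
by apply/regP; apply: hf => //; exists i => //; rewrite xv.
Qed.
End Family.
End PencilCurve.

(** * Irreducibility *)

(** Dependence of the rows, turned into polynomial equations. Letting [g] be any map merely adds
    minors with a repeated column, which are zero. *)
Lemma minors_eq0P (K : fieldType) s q (M : 'M[K]_(s, q)) :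
  (forall g : 'I_s -> 'I_q, \det (\matrix_(i, j) M i (g j)) = 0) <->
  (exists2 v : 'rV_s, v != 0 & v *m M = 0).
Proof.
split=> [dM|[v v0 vM] g]; last first.
  apply/eqP/det0P; exists v => //; apply/rowP => j.
  have /rowP/(_ (g j)) := vM; rewrite !mxE => vM0; apply: etrans vM0.
  by apply: eq_bigr => i _; rewrite mxE.
have [fM|] := boolP (row_free M); last first.
  rewrite -kermx_eq0 => /rowV0Pn[v /sub_kermxP vM v0]; by exists v.
have fMT : row_full M^T by rewrite /row_full mxrank_tr.
have := fullrowsub_unit fMT; rewrite unitmxE unitfE -det_tr.
rewrite (_ : _^T = \matrix_(i, j) M i (fullrankfun fMT j)) ?dM ?eqxx //.
by apply/matrixP => i j; rewrite !mxE.
Qed.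

Section Factorization.
Variables (K : numClosedFieldType) (k : nat).
Implicit Types P Q H : {mpoly K[k]}.

(** Degree bounds, without homogeneity, let P and Q range over linear spaces. P is to be the nonzero
    vector of an elimination, while Q = 0 is allowed, so that H = 0 is ruled out as well. *)
Definition no_factor (a b : nat) H := forall P Q, P != 0 ->
  (msize P <= a.+1)%N -> (msize Q <= b.+1)%N -> H <> P * Q.

Lemma msizeM_leq a b P Q : (msize P <= a.+1)%N -> (msize Q <= b.+1)%N ->
  (msize (P * Q) <= (a + b).+1)%N.
Proof.
move=> sP sQ; have [->|P0] := eqVneq P 0; first by rewrite mul0r msize0.
have [->|Q0] := eqVneq Q 0; first by rewrite mulr0 msize0.
by rewrite msizeM //; move: sP sQ; set u := msize P; set w := msize Q; lia.
Qed.

Variables (T : Type) (A : (T -> K) -> Prop).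
Hypothesis A_const : forall c, A (fun=> c).
Hypothesis A_add : forall a b, A a -> A b -> A (fun t => a t + b t).
Hypothesis A_mul : forall a b, A a -> A b -> A (fun t => a t * b t).

(** For a fixed P, the equation H = P Q is linear in Q: it is solvable exactly when H and the
    products of P with the monomials of degree at most [b] are dependent. The maximal minors
    expressing this are forms in the coefficients [x] of P, which are then eliminated. *)
Lemma no_factor_open a b (H : T -> {mpoly K[k]}) t0 :
  hfam A (a + b) H -> no_factor a b (H t0) ->
  exists2 f, A f & f t0 != 0 /\ forall t, f t != 0 -> no_factor a b (H t).
Proof.
move=> hH nf0.
pose I c := bmultinom k c.+1.
pose X (m : multinom k) : {mpoly K[k]} := @mpolyX k K m.
pose s := #|{: I b}|; pose q := #|{: I (a + b)%N}|; pose l := #|{: I a}|.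
pose PX (x : nat -> K) : {mpoly K[k]} := \sum_(i < l) x i *: X (enum_val i : I a).
pose QX (v : 'rV[K]_s) : {mpoly K[k]} := \sum_(i < s) v 0 i *: X (enum_val i : I b).
pose row t x (i : 'I_(1 + s)) : {mpoly K[k]} :=
  match fintype.split i with inl _ => H t | inr j => PX x * X (enum_val j : I b) end.
pose M t x := \matrix_(i < 1 + s, j < q) mcoeff (enum_val j : I (a + b)%N) (row t x i).
have msX c (i : I c) : (msize (X i) <= c.+1)%N by rewrite /X msizeX bmdeg.
have msPX x : (msize (PX x) <= a.+1)%N.
  apply: leq_trans (msize_sum _ _ _) _; apply/bigmax_leqP => i _.
  by apply: leq_trans (msizeZ_le _ _) (msX _ _).
have msQX v : (msize (QX v) <= b.+1)%N.
  apply: leq_trans (msize_sum _ _ _) _; apply/bigmax_leqP => i _.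
  by apply: leq_trans (msizeZ_le _ _) (msX _ _).
have PXE P : (msize P <= a.+1)%N -> exists x, P = PX x.
  move=> sP; exists (fun j => if (insub j : option (ordinal l)) is Some i
    then mcoeff (enum_val i : I a) P else 0).
  rewrite {1}(mpolywE sP) (reindex (@enum_val _ {: I a})) /=; last exact/onW_bij/enum_val_bij.
  by apply: eq_bigr => i _; rewrite valK.
have QXE P : (msize P <= b.+1)%N -> exists v, P = QX v.
  move=> sP; exists (\row_i mcoeff (enum_val i : I b) P).
  rewrite {1}(mpolywE sP) (reindex (@enum_val _ {: I b})) /=; last exact/onW_bij/enum_val_bij.
  by apply: eq_bigr => i _; rewrite mxE.
have PX_neq0 x : nonzero l x -> PX x != 0.
  move=> [j jl xj]; apply: contraNneq xj => PX0.
  have := congr1 (mcoeff (enum_val (Ordinal jl) : I a)) PX0.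
  rewrite mcoeff0 raddf_sum (bigD1 (Ordinal jl)) //= mcoeffZ mcoeffX eqxx mulr1.
  rewrite big1 ?addr0 => [->//|i /negPf ij].
  by rewrite mcoeffZ mcoeffX (inj_eq val_inj) (inj_eq enum_val_inj) ij mulr0.
have QX_eq0 v : QX v = 0 -> v = 0.
  move=> QX0; apply/rowP => j.
  have := congr1 (mcoeff (enum_val j : I b)) QX0.
  rewrite mcoeff0 raddf_sum (bigD1 j) //= mcoeffZ mcoeffX eqxx mulr1.
  rewrite big1 ?addr0 => [->|i /negPf ij]; first by rewrite mxE.
  by rewrite mcoeffZ mcoeffX (inj_eq val_inj) (inj_eq enum_val_inj) ij mulr0.
have sH t : (msize (H t) <= (a + b).+1)%N.
  rewrite msizeE; apply/bigmax_leqP_seq => m mp _.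
  by case: hH => /(_ t)/dhomog_mf/(_ _ mp) -> _.
have vME t x (u : 'rV_1) v : row_mx u v *m M t x = 0 <-> u 0 0 *: H t + PX x * QX v = 0.
  have E : u 0 0 *: H t + PX x * QX v = \sum_i (row_mx u v) 0 i *: row t x i.
    rewrite big_split_ord /= big_ord1 row_mxEl /row; congr (_ + _).
      by rewrite (unsplitK (inl _)).
    rewrite mulr_sumr; apply: eq_bigr => i _.
    by rewrite row_mxEr (unsplitK (inr _)) scalerAr.
  rewrite E; split=> [vM|E0]; last first.
    apply/rowP => j; have := congr1 (mcoeff (enum_val j : I (a + b)%N)) E0.
    rewrite raddf_sum mcoeff0 !mxE => vM0; apply: etrans vM0.
    by apply: eq_bigr => i _; rewrite /= mcoeffZ [M _ _ _ _]mxE.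
  apply/mpolyP => m; rewrite mcoeff0.
  have [md|md] := ltnP (mdeg m) (a + b).+1; last first.
    apply: memN_msupp_eq0; apply: msize_mdeg_ge; rewrite -E; apply: leq_trans md.
    apply: leq_trans (msizeD_le _ _) _; rewrite geq_max msizeM_leq // andbT.
    exact: leq_trans (msizeZ_le _ _) _.
  have /rowP/(_ (enum_rank (BMultinom md))) := vM.
  rewrite raddf_sum !mxE => vM0; apply: etrans vM0; apply: eq_bigr => i _.
  by rewrite /= mcoeffZ [M _ _ _ _]mxE enum_rankK.
have singP t x : nonzero l x ->
    (exists2 v : 'rV_(1 + s), v != 0 & v *m M t x = 0) <-> (exists v, H t = PX x * QX v).
  move=> /PX_neq0 Px0; split=> [[w w0 wM]|[v HE]]; last first.
    exists (row_mx (- 1) v); last first.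
      by apply/vME; rewrite !mxE eqxx scaleN1r -HE addNr.
    by rewrite row_mx_eq0 oppr_eq0 oner_eq0.
  move: wM w0; rewrite -[w]hsubmxK; move: (lsubmx w) (rsubmx w) => u v /vME uv.
  rewrite row_mx_eq0 negb_and => w0.
  (* A dependency without H would read P Q = 0, and P is nonzero. *)
  have u0 : u 0 0 != 0.
    apply: contraTneq w0 => u0; move: uv; rewrite u0 scale0r add0r => /eqP.
    rewrite mulf_eq0 (negPf Px0) /= => /eqP/QX_eq0 ->.
    rewrite eqxx orbF negbK; apply/eqP/rowP => i; by rewrite ord1 u0 mxE.
  exists (- (u 0 0)^-1 *: v); apply: (scalerI u0).
  move/eqP: uv; rewrite addr_eq0 => /eqP ->.
  have -> : QX (- (u 0 0)^-1 *: v) = - (u 0 0)^-1 *: QX v.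
    by rewrite /QX scaler_sumr; apply: eq_bigr => i _; rewrite mxE scalerA.
  by rewrite -scalerAr scalerA mulrN divff // scaleN1r.
pose F := fun p => exists g : 'I_(1 + s) -> 'I_q,
  p = fun t x => \det (\matrix_(i, j) M t x i (g j)).
have q0 : (0 < q)%N.
  apply/card_gt0P; suff md : (mdeg (@mnm0 k) < (a + b).+1)%N by exists (BMultinom md).
  by rewrite mdeg0.
have s0 : (0 < s)%N.
  apply/card_gt0P; suff md : (mdeg (@mnm0 k) < b.+1)%N by exists (BMultinom md).
  by rewrite mdeg0.
have [||||f Af [ft0 hf]] := @elimination K T A A_const A_add A_mul l s F t0.
- exact: s0.
- by eexists; exists (fun=> Ordinal q0); reflexivity.
- move=> _ [g ->].
  (* Row 0 holds the coefficients of H, of degree 0 in [x]; the other [s] rows are linear in [x]. *)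
  apply: (@form_det _ _ _ A_const A_add A_mul l (1 + s) s (fun i => (0 < i)%N : nat) (fun=> 0%N)
    (fun i j t x => M t x i (g j))); last first.
    rewrite big_ord_recl /= sum_nat_const card_ord [X in (_ = _ + X)%N]big1 //.
    by lia.
  move=> i j /=; rewrite subn0; case: (splitP i) => [i0 i0E|i1 i1E].
    have -> : (0 < i)%N = false by rewrite i0E; case: i0 {i0E} => -[].
    have iE : i = lshift s i0 by apply/val_inj.
    case: hH => _ /(_ (enum_val (g j) : I (a + b)%N)) AH.
    apply: eq_form (form_const A_const l AH) => t x.
    by rewrite mxE iE /row (unsplitK (inl _)).
  have -> : (0 < i)%N by rewrite i1E.
  have iE : i = rshift 1 i1 by apply/val_inj.
  apply: (@eq_form _ _ _ _ _ (fun t x => \sum_(i < l)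
    mcoeff (enum_val (g j) : I (a + b)%N) (X (enum_val i : I a) * X (enum_val i1 : I b)) * x i)).
    move=> t x; rewrite mxE iE /row (unsplitK (inr _)) mulr_suml raddf_sum.
    by apply: eq_bigr => c _; rewrite /= -scalerAl mcoeffZ mulrC.
  apply: form_sum => // c _; apply: (formZ A_mul (a := fun=> _)); first exact: A_const.
  exact: form_var.
- move=> x x0; apply: contrapT => nP.
  have [v HE] : exists v, H t0 = PX x * QX v.
    apply/singP => //; apply/minors_eq0P => g; apply: contrapT => /eqP dg.
    by apply: nP; eexists; [exists g; reflexivity|exact: dg].
  by have := nf0 _ _ (PX_neq0 _ x0) (msPX x) (msQX v).
exists f => //; split=> // t ft P Q P0 sP sQ HPQ.
have [x PE] := PXE P sP; have [v QE] := QXE Q sQ.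
have x0 : nonzero l x.
  apply: contrapT => nx; case/negP: P0; rewrite PE /PX big1 // => i _.
  have [->|xi] := eqVneq (x i) 0; first by rewrite scale0r.
  by case: nx; exists i.
have [_ [g ->]] := hf t x ft x0.
have : exists2 v : 'rV[K]_(1 + s), v != 0 & v *m M t x = 0.
  by apply/singP => //; exists v; rewrite HPQ PE QE.
by move/minors_eq0P => ->; rewrite eqxx.
Qed.

End Factorization.

(** * Homogeneous polynomials and their factors *)

Section Homogeneous.
Variables (K : numClosedFieldType) (k : nat).
Implicit Types P Q H : {mpoly K[k]}.

Lemma msize_homog d P : P \is d.-homog -> (msize P <= d.+1)%N.
Proof.
move=> hP; rewrite msizeE; apply/bigmax_leqP_seq => m mP _.
by rewrite (dhomog_mf hP mP).
Qed.

Lemma homog_msize d P : P != 0 -> P \is d.-homog -> msize P = d.+1.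
Proof.
move=> P0 hP; have := dhomog_uniq P0 hP (dhomog_msize hP) => ->.
by rewrite prednK // lt0n msize_poly_eq0.
Qed.

Lemma no_factor_irreducible d H : H \is d.-homog -> (1 < d)%N ->
  (forall a, (0 < a < d)%N -> no_factor a (d - a) H) -> irreducible_elt H.
Proof.
move=> hH d1 nf.
have unitE P : msize P = 1%N -> P \is a GRing.unit.
  move=> /eqP/msize_poly1P[c c0 ->].
  by apply: (@rmorph_unit _ _ (@mpolyC k K)); rewrite unitfE.
have H0 : H != 0.
  apply/eqP => H0; apply: (nf 1%N _ 1 0); rewrite ?mulr0 ?msize1 ?msize0 ?oner_eq0 //.
have sH := homog_msize H0 hH.
split=> //.
  apply/negP => /unitrP[Q [QH _]].
  have Q0 : Q != 0 by apply: contra_eq_neq QH => ->; rewrite mul0r eq_sym oner_eq0.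
  have : msize (Q * H) = msize (1 : {mpoly K[k]}) by rewrite QH.
  rewrite msizeM // msize1 sH (mpolySpred _ Q0).
  by lia.
move=> P Q HPQ.
have [P0 Q0] : P != 0 /\ Q != 0 by move: H0; rewrite HPQ mulf_eq0 negb_or => /andP[].
have := sH; rewrite HPQ msizeM // => sPQ.
have sP := mpolySpred _ P0; have sQ := mpolySpred _ Q0.
have [sP1|sP1] := eqVneq (msize P).-1 0%N; first by left; apply: unitE; rewrite sP sP1.
have [sQ1|sQ1] := eqVneq (msize Q).-1 0%N; first by right; apply: unitE; rewrite sQ sQ1.
move: sPQ sP sQ sP1 sQ1 => sPQ sP sQ sP1 sQ1.
have [] := nf (msize P).-1 _ P Q => //;
  move: sPQ sP sQ sP1 sQ1; set u := msize P; set w := msize Q; lia.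
Qed.

Lemma irreducible_no_factor d H : H \is d.-homog -> H != 0 ->
    (forall P Q, H = P * Q -> (msize P <= 1)%N \/ (msize Q <= 1)%N) ->
  forall a, (0 < a < d)%N -> no_factor a (d - a) H.
Proof.
move=> hH H0 irr a /andP[a0 ad] P Q P0 sP sQ HPQ.
have Q0 : Q != 0 by move: H0; rewrite HPQ mulf_eq0 negb_or => /andP[].
have := homog_msize H0 hH; rewrite HPQ msizeM // => sPQ.
by have [] := irr P Q HPQ; move: sP sQ sPQ; set u := msize P; set w := msize Q; lia.
Qed.

(** One of the factors has the root 0; an X is removed from it and the induction on [d] goes on.
    Over a mere domain, [u] need not be invertible. *)
Lemma poly_monomial_factor (D : idomainType) (p q : {poly D}) c d : c != 0 ->
  p * q = c *: 'X^d -> exists e u, p = u *: 'X^e.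
Proof.
move=> c0; elim: d p q => [|d IH] p q pq.
  exists 0%N, (p`_0); rewrite expr0 alg_polyC; apply: size1_polyC.
  move: pq => /= pq; have : p * q != 0 by rewrite pq expr0 alg_polyC polyC_eq0.
  move=> pq0; have [p0 q0] : p != 0 /\ q != 0.
    by move: pq0; rewrite mulf_eq0 negb_or => /andP[].
  have := congr1 (fun p : {poly D} => size p) pq; rewrite size_mul // expr0 alg_polyC size_polyC c0.
  have := lt0n (size q); rewrite size_poly_eq0 q0; move: (size p) (size q) => u w; lia.
have : root (p * q) 0 by rewrite pq rootE hornerZ hornerXn expr0n mulr0.
rewrite rootM => /orP[] /factor_theorem[s sE]; move: pq; rewrite sE subr0 exprSr scalerAl.
  rewrite mulrAC => /(mulIf (negbT (polyX_eq0 _))) /IH[e [u ->]].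
  by exists e.+1, u; rewrite exprSr scalerAl.
by rewrite mulrA => /(mulIf (negbT (polyX_eq0 _))) /IH[e [u ->]]; exists e, u.
Qed.

(** Replacing each variable X_i by X_i T turns the grading into powers of T: a polynomial is
    homogeneous exactly when its image is a monomial in T, and factors of monomials are
    monomials. *)
Lemma dhomog_factor d P Q : P * Q != 0 -> P * Q \is d.-homog -> exists e, P \is e.-homog.
Proof.
move=> PQ0 hPQ.
pose s (p : {mpoly K[k]}) : {poly {mpoly K[k]}} :=
  mmap (polyC \o @mpolyC k K) (fun i => (@mpolyX k K (mnm1 i)) *: 'X) p.
have sX m : mmap1 (fun i => (@mpolyX k K (mnm1 i)) *: 'X) m = @mpolyX k K m *: 'X^(mdeg m).
  rewrite /mmap1 (mpolyXE_id K m) mdegE.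
  rewrite (eq_bigr (fun i => (@mpolyX k K (mnm1 i)) ^+ m i *: 'X^(m i))); last first.
    by move=> i _; rewrite exprZn.
  by rewrite scaler_prod prodrXr.
have sE p : s p = \sum_(m <- msupp p) (mcoeff m p *: @mpolyX k K m) *: 'X^(mdeg m).
  apply: eq_bigr => m _; rewrite sX /= -!mul_polyC mulrA -rmorphM /=.
  by rewrite mul_mpolyC.
have s_coef p j : (s p)`_j = pihomog mdeg j p.
  rewrite sE coef_sum pihomogE [RHS]big_mkcond; apply: eq_bigr => m _.
  by rewrite coefZ coefXn eq_sym; case: eqP; rewrite ?mulr1 ?mulr0.
have sM p q : s (p * q) = s p * s q.
  exact: (rmorphM (mmap (polyC \o @mpolyC k K) (fun i => (@mpolyX k K (mnm1 i)) *: 'X))).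
have sPQ : s P * s Q = (P * Q) *: 'X^d.
  rewrite -sM; apply/polyP => j; rewrite s_coef coefZ coefXn.
  case: eqP => [->|/eqP jd]; first by rewrite mulr1 pihomog_dE.
  by rewrite mulr0 (@pihomog_ne0 _ _ _ d) // eq_sym.
have [e [u sPE]] := poly_monomial_factor PQ0 sPQ.
exists e; rewrite homog_piE; apply/eqP.
rewrite {2}(@pihomog_partitionE _ _ mdeg (maxn (msize P) e.+1) P) ?leq_maxl //.
have e_lt : (e < maxn (msize P) e.+1)%N by rewrite leq_maxr.
rewrite (bigD1 (Ordinal e_lt)) //= big1 ?addr0 // => i ie.
rewrite -s_coef sPE coefZ coefXn; case: eqP => [iE|]; last by rewrite mulr0.
by case/eqP: ie; apply/val_inj.
Qed.

Lemma meval_homog d P (v : 'I_k -> K) c : P \is d.-homog ->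
  meval (fun i => c * v i) P = c ^+ d * meval v P.
Proof.
move=> hP; rewrite !mevalE mulr_sumr; apply: eq_big_seq => m mP.
rewrite mulrCA; congr (_ * _).
rewrite (eq_bigr (fun i => c ^+ m i * v i ^+ m i)); last by move=> i _; rewrite exprMn.
by rewrite big_split /= prodrXr -mdegE (dhomog_mf hP mP).
Qed.
End Homogeneous.

Lemma poly_eq0_off0 (K : numClosedFieldType) (p : {poly K}) :
  (forall z, z != 0 -> p.[z] = 0) -> p = 0.
Proof.
move=> p0; apply/eqP/negPn/negP => pn0.
have [s pE] := closed_field_poly_normal p.
have [z] := fresh_scalar (0 :: s); rewrite inE negb_or => /andP[/p0 pz] /negP[].
move/eqP: pz; rewrite pE hornerZ mulf_eq0 lead_coef_eq0 (negPf pn0) /=.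
by rewrite -rootE root_prod_XsubC.
Qed.

Lemma horner_mmap (R : comNzRingType) k (D : comNzRingType) (f : {rmorphism R -> {poly D}})
    (h : 'I_k -> {poly D}) (P : {mpoly R[k]}) z :
  (mmap f h P).[z] = mmap (horner_eval z \o f) (fun i => (h i).[z]) P.
Proof.
rewrite /mmap horner_sum; apply: eq_bigr => m _; rewrite hornerM; congr (_ * _).
by rewrite /mmap1 horner_prod; apply: eq_bigr => i _; rewrite horner_exp.
Qed.

(** * Two irreducible pencils *)

Section IrreducibleExamples.
Variable K : numClosedFieldType.
Local Notation XX i := (@mpolyX 3 K (mnm1 i)).

Definition vec (D : nzRingType) (x y z : D) (i : 'I_3) : D := nth 0 [:: x; y; z] i.

Lemma vec_eta (v : 'I_3 -> K) : v =1 vec (v 0) (v 1) (v (inord 2)).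
Proof.
move=> i; rewrite /vec; case: i => -[|[|[|//]]] i3 /=; congr v; apply/val_inj => //=.
by rewrite inordK.
Qed.

(** Such a form is c z^e, here along the line of the points (x0, y0, z); a nonzero value at z = 0
    leaves only e = 0. *)
Lemma homog_dehomog_const e (P : {mpoly K[3]}) c x0 y0 : P \is e.-homog ->
  (forall x y, meval (vec x y 1) P = c) -> meval (vec x0 y0 0) P != 0 -> e = 0%N.
Proof.
move=> hP Pc P0; pose q := mmap (@polyC K) (vec x0%:P y0%:P 'X) P.
have qE z : q.[z] = meval (vec x0 y0 z) P.
  rewrite /q horner_mmap /meval /mmap; apply: eq_bigr => m _.
  rewrite /= /horner_eval hornerC; congr (_ * _); apply: eq_bigr => i _; congr (_ ^+ _).
  by rewrite /vec; case: i => -[|[|[|//]]] i3 /=; rewrite ?hornerC ?hornerX.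
have qX : q = c *: 'X^e.
  apply/eqP; rewrite -subr_eq0; apply/eqP/poly_eq0_off0 => z z0.
  rewrite hornerD hornerN hornerZ hornerXn qE -(Pc (x0 / z) (y0 / z)).
  rewrite mulrC -meval_homog // (@meval_eq _ _ _ (vec x0 y0 z)) ?subrr //.
  move=> i; rewrite /vec; case: i => -[|[|[|//]]] i3 /=; rewrite ?mulr1 //.
    by rewrite mulrC divfK.
  by rewrite mulrC divfK.
move: P0; rewrite -qE qX hornerZ hornerXn expr0n.
by have [//|_] := eqVneq e 0%N; rewrite mulr0 eqxx.
Qed.

Lemma poly_linear_factor (D : idomainType) (p q : {poly D}) u :
  p * q = u *: 'X + 1 -> (size p <= 1)%N \/ (size q <= 1)%N.
Proof.
move=> pq; have pq0 : p * q != 0.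
  apply/eqP => pq0; have := congr1 (fun p : {poly D} => p.[0]) pq.
  by rewrite pq0 !hornerE => /eqP; rewrite eq_sym oner_eq0.
have [p0 q0] : p != 0 /\ q != 0 by move: pq0; rewrite mulf_eq0 negb_or => /andP[].
have : (size (p * q)%R <= 2)%N.
  rewrite pq; apply: leq_trans (size_polyD _ _) _; rewrite size_poly1 geq_max andbT.
  by apply: leq_trans (size_scale_leq _ _) _; rewrite size_polyX.
rewrite size_mul //; move: (size p) (size q) => [|[|a]] [|[|b]] //=; try by [left|right].
by rewrite !addnS.
Qed.

Lemma unit_polyP (c : {poly K}) d : c * d = 1 -> exists u, c = u%:P.
Proof.
move=> cd; exists c`_0; apply: size1_polyC.
have : c * d != 0 by rewrite cd oner_eq0.
rewrite mulf_eq0 negb_or => /andP[c0 d0].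
have := congr1 (fun p : {poly K} => size p) cd; rewrite size_mul // size_poly1.
have := lt0n (size d); rewrite size_poly_eq0 d0; move: (size c) (size d) => u w; lia.
Qed.

(** For a factor p of degree a in X, with constant leading coefficient c and p(0, Y) = u Y^l, the
    absolute value of p(0, s^n) is computed in two ways. Taking s = 1 gives |u| = |c|, and s = 2
    gives n l = m a; so n divides a, and a is 0 or n. *)
Lemma poly_binomial_factor m n (p q : {poly {poly K}}) :
  (0 < n)%N -> coprime n m -> p * q = 'X^n + ('X^m)%:P ->
  ((size p <= 1)%N \/ (size q <= 1)%N).
Proof.
move=> n0 cnm pq.
have s_pq : size (p * q) = n.+1.
  by rewrite pq size_polyDl size_polyXn // size_polyC; case: eqP.
have l_pq : lead_coef (p * q) = 1.
  by rewrite pq lead_coefDl ?lead_coefXn // size_polyXn size_polyC; case: eqP.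
have /andP[p0 q0] : (p != 0) && (q != 0).
  by rewrite -negb_or -mulf_eq0 -size_poly_eq0 s_pq.
have [c lp] : exists c, lead_coef p = c%:P.
  by apply: (@unit_polyP _ (lead_coef q)); rewrite -lead_coefM.
have c0 : c != 0 by rewrite -polyC_eq0 -lp lead_coef_eq0.
have [l [u p0E]] : exists l u, p.[0] = u *: 'X^l.
  apply: (@poly_monomial_factor _ _ q.[0] 1 m); first exact: oner_neq0.
  by rewrite -hornerM pq !hornerE expr0n eqn0Ngt n0 add0r scale1r.
pose a := (size p).-1.
(* At y = s^n all the roots X have modulus s^m, so |p(0, s^n)| = |c| s^(m a). *)
have p0_norm (s : nat) : `|u| * s%:R ^+ (n * l) = `|c| * s%:R ^+ (m * a) :> K.
  pose ps := map_poly (horner_eval (s%:R ^+ n)) p.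
  have lps : horner_eval (s%:R ^+ n) (lead_coef p) = c by rewrite lp /horner_eval hornerC.
  have sps : size ps = size p by rewrite size_map_poly_id0 // lps.
  have lcps : lead_coef ps = c by rewrite lead_coefE sps coef_map -lead_coefE.
  have ps0 : ps.[0] = u * s%:R ^+ (n * l).
    have -> : (0 : K) = horner_eval (s%:R ^+ n) 0 by rewrite /horner_eval horner0.
    by rewrite horner_map p0E /= /horner_eval hornerZ hornerXn exprM.
  have ps_root x : root ps x -> `|x| = s%:R ^+ m.
    move=> /rootP psx; apply/eqP; rewrite -(eqrXn2 n0) ?normr_ge0 ?exprn_ge0 ?ler0n //.
    rewrite -normrX; have : (map_poly (horner_eval (s%:R ^+ n)) (p * q)).[x] = 0.
      by rewrite rmorphM hornerM [X in X * _]psx mul0r.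
    rewrite pq rmorphD /= map_polyXn map_polyC /= hornerD hornerC hornerXn /horner_eval hornerXn.
    move/eqP; rewrite addr_eq0 => /eqP ->; rewrite normrN normrX normrX normr_nat.
    by rewrite -!exprM mulnC.
  have [rs psE] := closed_field_poly_normal ps.
  have srs : size rs = a.
    have := sps; rewrite psE size_scale ?lcps // size_prod_XsubC /a => <-; lia.
  have -> : `|u| * s%:R ^+ (n * l) = `|ps.[0]| by rewrite ps0 normrM normrX normr_nat.
  rewrite psE hornerZ normrM lcps; congr (_ * _).
  rewrite horner_prod normr_prod (eq_big_seq (fun=> s%:R ^+ m)); last first.
    move=> x xrs; rewrite !hornerE normrN; apply: ps_root.
    by rewrite psE rootZ ?lcps // root_prod_XsubC.
  by rewrite big_const_seq count_predT srs iter_mulr_1 exprM.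
have uc : `|u| = `|c| by have := p0_norm 1%N; rewrite !expr1n !mulr1.
have nl : (n * l = m * a)%N.
  have nc0 : `|c| != 0 by rewrite normr_eq0.
  have := p0_norm 2%N; rewrite uc => /(mulfI nc0).
  by move/eqP; rewrite -!natrX eqr_nat eqn_exp2l // => /eqP.
have na : (n %| a)%N by rewrite -(Gauss_dvdr _ cnm) -nl dvdn_mulr.
have := s_pq; rewrite size_mul // => spq.
have := lt0n (size p); have := lt0n (size q); rewrite !size_poly_eq0 p0 q0.
move=> q1 p1; have [a0|a0] := posnP a; first by left; rewrite -ltnS -(prednK p1) ltnS -/a a0.
have := dvdn_leq a0 na; rewrite /a => na'; right.
by move: (size p) (size q) spq q1 p1 na' => u1 u2; lia.
Qed.

(* h sets z = 1 after the shear x |-> x + s(y). *)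
Lemma dehomog_irreducible d (H : {mpoly K[3]}) (h : {mpoly K[3]} -> {poly {poly K}})
    (s : K -> {poly K}) x0 y0 :
    H \is d.-homog -> meval (vec x0 y0 0) H != 0 ->
    (forall P Q, h (P * Q) = h P * h Q) ->
    (forall P x y, (h P).[s y + x%:P].[y] = meval (vec x y 1) P) ->
    (forall p q, p * q = h H -> (size p <= 1)%N \/ (size q <= 1)%N) ->
    (lead_coef (h H) = 1 \/ (h H)`_0 = 1) ->
  forall a, (0 < a < d)%N -> no_factor a (d - a) H.
Proof.
move=> hH H0 hM hE hf h1; apply: (irreducible_no_factor hH).
  by apply: contraNneq H0 => ->; rewrite meval0.
(* A factor of degree 0 in X divides the leading or the constant coefficient of [h H], whichever is
   1, so P is constant on the chart z = 1. Being homogeneous and nonzero at (x0 : y0 : 0), it has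
   degree 0. *)
have key P Q : H = P * Q -> (size (h P) <= 1)%N -> (msize P <= 1)%N.
  move=> HPQ /size1_polyC hP.
  have [c cE] : exists c, (h P)`_0 = c%:P.
    have [hl|h0] := h1.
      apply: (@unit_polyP _ (lead_coef (h Q))).
      by rewrite -[(h P)`_0](lead_coefC) -hP -lead_coefM -hM -HPQ.
    apply: (@unit_polyP _ (h Q)`_0).
    by rewrite -!horner_coef0 -hornerM -hM -HPQ horner_coef0.
  have PQ0 : P * Q != 0 by apply: contraNneq H0; rewrite HPQ => ->; rewrite meval0.
  have [|e eP] := @dhomog_factor _ _ d P Q PQ0; first by rewrite -HPQ; exact: hH.
  have e0 : e = 0%N.
    apply: (@homog_dehomog_const e P c x0 y0) => //.
      by move=> x y; rewrite -hE hP cE !hornerC.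
    by apply: contraNneq H0 => P0; rewrite HPQ mevalM P0 mul0r.
  by rewrite e0 in eP; apply: msize_homog eP.
move=> P Q HPQ; have [|sP|sQ] := hf (h P) (h Q); first by rewrite -hM HPQ.
  by left; apply: key HPQ sP.
by right; apply: (key Q P) sQ; rewrite mulrC.
Qed.

(** The inner variable is y; the outer one is x after a change of coordinate, x itself being
    replaced by [p]. *)
Definition dehomog (p : {poly {poly K}}) (P : {mpoly K[3]}) : {poly {poly K}} :=
  mmap (polyC \o polyC) (vec p ('X)%:P 1) P.

Lemma dehomogM p P Q : dehomog p (P * Q) = dehomog p P * dehomog p Q.
Proof. exact: (rmorphM (mmap (polyC \o polyC) (vec p ('X)%:P 1))). Qed.

Lemma dehomogD p P Q : dehomog p (P + Q) = dehomog p P + dehomog p Q.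
Proof. exact: (rmorphD (mmap (polyC \o polyC) (vec p ('X)%:P 1))). Qed.

Lemma dehomogXn p P e : dehomog p (P ^+ e) = dehomog p P ^+ e.
Proof. exact: (rmorphXn (mmap (polyC \o polyC) (vec p ('X)%:P 1))). Qed.

Lemma dehomogX p i : dehomog p (XX i) = vec p ('X)%:P 1 i.
Proof. by rewrite /dehomog mmapX mmap1U. Qed.

Lemma dehomogE p P s y : (dehomog p P).[s].[y] = meval (vec p.[s].[y] y 1) P.
Proof.
rewrite /dehomog horner_mmap /mmap horner_sum /meval /mmap.
apply: eq_bigr => m _; rewrite hornerM /= /horner_eval !hornerC; congr (_ * _).
rewrite /mmap1 horner_prod; apply: eq_bigr => i _; rewrite horner_exp; congr (_ ^+ _).
by rewrite /vec; case: i => -[|[|[|//]]] i3 /=; rewrite ?hornerC ?hornerX.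
Qed.

Lemma homogXX i : XX i \is 1.-homog.
Proof. by rewrite dhomogX /= mdeg1. Qed.

Lemma homogXXn i e : XX i ^+ e \is e.-homog.
Proof. by have := dhomogMn e (homogXX i); rewrite mul1n. Qed.

Lemma homogXXM i j e : (0 < e)%N -> XX i * XX j ^+ e.-1 \is e.-homog.
Proof. by move=> e0; have := dhomogM (homogXX i) (homogXXn j e.-1); rewrite add1n prednK. Qed.

(** On z = 1 these are F = x + y^(rm) and G = y, coordinates of the affine plane again, in which the
    curve is X^n + Y^m = 0. The term y^(rm) keeps the curve from containing the line z = 0. *)
Definition rationalF r m : {mpoly K[3]} := XX 0 * XX ord_max ^+ (r * m).-1 + XX 1 ^+ (r * m).
Definition rationalG r n : {mpoly K[3]} := XX 1 * XX ord_max ^+ (r * n).-1.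

Lemma homog_rationalF r m : (0 < r * m)%N -> rationalF r m \is (r * m).-homog.
Proof. by move=> rm; rewrite dhomogD ?homogXXM ?homogXXn. Qed.

Lemma homog_rationalG r n : (0 < r * n)%N -> rationalG r n \is (r * n).-homog.
Proof. by move=> rn; rewrite homogXXM. Qed.

Lemma no_factor_rational_pencil r m n a : (0 < r)%N -> (1 < m)%N -> (1 < n)%N -> coprime m n ->
  (0 < a < r * m * n)%N ->
  no_factor a (r * m * n - a) (pencil m n (rationalF r m) (rationalG r n) 1 1).
Proof.
move=> r0 m1 n1 cmn.
have rm : (1 < r * m)%N by rewrite (leq_trans m1) // leq_pmull.
have rn : (1 < r * n)%N by rewrite (leq_trans n1) // leq_pmull.
pose h := dehomog ('X - ('X ^+ (r * m))%:P).
have hH : h (pencil m n (rationalF r m) (rationalG r n) 1 1) = 'X^n + ('X^m)%:P.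
  rewrite /h /pencil /rationalF /rationalG !mul1r dehomogD !dehomogXn
    dehomogD !dehomogM !dehomogXn !dehomogX.
  rewrite /vec /= !expr1n !mulr1 -!rmorphXn /= .
  by rewrite subrK.
apply: (@dehomog_irreducible _ _ h (fun y => 'X^(r * m)) 0 1).
- rewrite /pencil !mul1r; apply: dhomogD.
    by apply: dhomogMn; apply: homog_rationalF; apply: ltnW.
  by rewrite mulnAC; apply: dhomogMn; apply: homog_rationalG; apply: ltnW.
- rewrite /pencil /rationalF /rationalG !mul1r mevalD !rmorphXn /= mevalD
    !mevalM !rmorphXn /= !mevalXU.
  have z0 e : (0 < e)%N -> (0 : K) ^+ e = 0 by move=> e0; rewrite expr0n eqn0Ngt e0.
  by rewrite /vec /= mul0r add0r !expr1n mul1r !z0 ?addr0 ?oner_eq0 //; lia.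
- exact: dehomogM.
- move=> P x y; rewrite dehomogE !hornerE /=; congr (meval _ P).
  by rewrite addrAC subrr add0r.
- move=> p q; rewrite hH; apply: poly_binomial_factor; first exact: ltnW.
  by rewrite coprime_sym.
- left; rewrite hH lead_coefDl ?lead_coefXn // size_polyXn size_polyC.
  by case: eqP => //= _; rewrite ltnS ltnW.
Qed.

(** On z = 1 the pencil is x y^(rmn) + 1, of degree 1 in x and with constant term 1. *)
Lemma no_factor_monomial_pencil r m n a : (0 < r)%N -> (1 < m)%N -> (1 < n)%N ->
  (0 < a < r * m * n + 1)%N ->
  no_factor a (r * m * n + 1 - a)
    (pencil m n (XX 1 ^+ (r * m)) (XX ord_max ^+ (r * n)) (XX 0) (XX ord_max)).
Proof.
move=> r0 m1 n1.
pose h := dehomog 'X.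
have hH : h (pencil m n (XX 1 ^+ (r * m)) (XX ord_max ^+ (r * n)) (XX 0) (XX ord_max)) =
   'X^(r * m * n) *: 'X + 1.
  rewrite /h /pencil dehomogD !dehomogM !dehomogXn !dehomogX.
  rewrite /vec /= !expr1n !mulr1 -!exprM -!rmorphXn /= .
  by rewrite mulrC mul_polyC.
apply: (@dehomog_irreducible _ _ h (fun y => 0) 1 1).
- rewrite /pencil addnC; apply: dhomogD.
    by apply: dhomogM (homogXX _) _; rewrite -exprM homogXXn.
  by apply: dhomogM (homogXX _) _; rewrite -exprM mulnAC homogXXn.
- rewrite /pencil mevalD !mevalM !rmorphXn /= !mevalXU.
  by rewrite /vec /= !expr1n mul0r addr0 mulr1 oner_eq0.
- exact: dehomogM.
- by move=> P x y; rewrite dehomogE !hornerE; congr (meval _ P).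
- by move=> p q; rewrite hH; apply: poly_linear_factor.
- by right; rewrite hH -horner_coef0 !hornerE.
Qed.
End IrreducibleExamples.

(** * A pencil without further singularities *)

Section RegularExamples.
Variable K : numClosedFieldType.
Local Notation XX i := (@mpolyX 3 K (mnm1 i)).

Lemma meval_mderivXX (v : 'I_3 -> K) i j : meval v (mderiv i (XX j)) = (j == i)%:R.
Proof.
rewrite mderivX mevalZ mnm1E; case: eqP => [->|_]; last by rewrite mul0r.
rewrite (_ : mnm_sub _ _ = @mnm0 3); last by apply/mnmP => k; rewrite !mnmE subnn.
by rewrite mpolyX0 meval1 mul1r.
Qed.

Lemma meval_mderivXXn (v : 'I_3 -> K) i j e :
  meval v (mderiv i (XX j ^+ e)) = e%:R * v j ^+ e.-1 * (j == i)%:R.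
Proof. by rewrite mderivXn mevalZ mevalM rmorphXn /= mevalXU meval_mderivXX mulrA. Qed.

Definition fermat (i j : 'I_3) e : {mpoly K[3]} := XX i ^+ e + XX j ^+ e.

Lemma homog_fermat i j e : fermat i j e \is e.-homog.
Proof. by rewrite dhomogD ?homogXXn. Qed.

(** Up to nonzero constants the minors are products of powers of two distinct coordinates, one for
    each pair. At a common zero at most one coordinate is nonzero, and there the pencil is a power
    of it, possibly times 2. *)
Lemma regular_at_fermat r m n (v : 'I_3 -> K) : (0 < r)%N -> (1 < m)%N -> (1 < n)%N ->
  (exists i, v i != 0) ->
  regular_at m n (fermat 0 ord_max (r * m)) (fermat 1 ord_max (r * n)) 1 1 v.
Proof.
move=> r0 m1 n1 [i vi].
have rm : (1 < r * m)%N by rewrite (leq_trans m1) // leq_pmull.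
have rn : (1 < r * n)%N by rewrite (leq_trans n1) // leq_pmull.
have z0 e : (0 < e)%N -> (0 : K) ^+ e = 0 by move=> e0; rewrite expr0n eqn0Ngt e0.
apply: contrapT => /not_orP[/negP/negPn/eqP H0 nex].
have minor0 j k : meval v (dlog_minor m n
    (fermat 0 ord_max (r * m)) (fermat 1 ord_max (r * n)) 1 1 j k) = 0.
  by apply/eqP/negPn/negP => jk; apply: nex; exists j, k.
have dE k p q e i' : meval v (dlog k (fermat p q e) 1 i') =
    k%:R * (e%:R * v p ^+ e.-1 * (p == i')%:R + e%:R * v q ^+ e.-1 * (q == i')%:R).
  rewrite /dlog -mpolyC1 mderivC mulr0 addr0 mpolyC1 mul1r mevalZ mderivD mevalD.
  by rewrite !meval_mderivXXn.
have prod0 (c d s t : K) p q : (0 < p)%N -> (0 < q)%N -> c != 0 -> d != 0 ->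
    (c * s ^+ p) * (d * t ^+ q) = 0 -> s = 0 \/ t = 0.
  move=> p0 q0 c0 d0 /eqP; rewrite !mulf_eq0 !expf_eq0 (negPf c0) (negPf d0) p0 q0 /=.
  by case/orP => /eqP; [left|right].
have nz k l : (0 < k)%N -> (0 < l)%N -> k%:R * l%:R != 0 :> K.
  by move=> k0 l0; rewrite -natrM pnatr_eq0 -lt0n muln_gt0 k0.
have pos : [/\ (0 < m)%N, (0 < n)%N, (0 < (r * m).-1)%N & (0 < (r * n).-1)%N] by split; lia.
case: pos => m0 n0 rm0 rn0; have rm1 := ltnW rm; have rn1 := ltnW rn.
set x := v 0; set y := v 1; set z := v ord_max.
have dF := dE n 0 ord_max (r * m)%N; have dG := dE m 1 ord_max (r * n)%N.
have xy : x = 0 \/ y = 0.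
  apply: (prod0 (n%:R * (r * m)%:R) (m%:R * (r * n)%:R) x y _ _ rm0 rn0); try exact: nz.
  have := minor0 0 1; rewrite /dlog_minor mevalB !mevalM !dF !dG /= -/x -/y -/z => <-.
  ring.
have xz : x = 0 \/ z = 0.
  apply: (prod0 (n%:R * (r * m)%:R) (m%:R * (r * n)%:R) x z _ _ rm0 rn0); try exact: nz.
  have := minor0 0 ord_max; rewrite /dlog_minor mevalB !mevalM !dF !dG /= -/x -/y -/z => <-.
  ring.
have yz : z = 0 \/ y = 0.
  apply: (prod0 (n%:R * (r * m)%:R) (m%:R * (r * n)%:R) z y _ _ rm0 rn0); try exact: nz.
  have := minor0 ord_max 1; rewrite /dlog_minor mevalB !mevalM !dF !dG /= -/x -/y -/z => <-.
  ring.
have He : (x ^+ (r * m) + z ^+ (r * m)) ^+ n + (y ^+ (r * n) + z ^+ (r * n)) ^+ m = 0.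
  rewrite -[RHS]H0 /pencil /fermat !mul1r mevalD !rmorphXn /= !mevalD !rmorphXn /= !mevalXU.
  by [].
have allz : [/\ x = 0, y = 0 & z = 0].
  have ez (u : K) e : (0 < e)%N -> u ^+ e = 0 -> u = 0.
    by move=> e0 /eqP; rewrite expf_eq0 e0 => /eqP.
  have rmn : (0 < r * m * n)%N by rewrite !muln_gt0 r0 m0.
  have rnm : (0 < r * n * m)%N by rewrite !muln_gt0 r0 m0 n0.
  move: He; have [x0|x0] := eqVneq x 0; last first.
    case: xy => [x1|->]; first by rewrite x1 eqxx in x0.
    case: xz => [x1|->]; first by rewrite x1 eqxx in x0.
    by rewrite !z0 // !addr0 -exprM z0 // addr0 => /(ez _ _ rmn).
  rewrite x0; case: yz => ->.
    by rewrite !z0 // !addr0 !z0 // add0r -exprM => /(ez _ _ rnm).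
  rewrite !z0 // !add0r -!exprM mulnAC -mulr2n => /eqP.
  by rewrite mulrn_eq0 /= expf_eq0 => /andP[_ /eqP ->].
case: allz => x0 y0 z0'; case/eqP: vi; rewrite vec_eta /vec.
by case: i => -[|[|[|//]]] i3 //=; rewrite -[RHS]z0'; congr v; apply/val_inj; rewrite /= inordK.
Qed.

(* For L1 = x and L2 = c y the bad values of c satisfy c^(MN) = q for a fixed q,
   so one of 1 and 2 works. *)
Lemma regular_at_fermat_linear r m n : (0 < r)%N -> (1 < m)%N -> (1 < n)%N ->
  exists2 c : nat, (0 < c)%N & forall v : 'I_3 -> K, (exists i, v i != 0) ->
  regular_at m n (fermat 0 ord_max (r * m)) (fermat 1 ord_max (r * n))
    (XX 0) (c%:R *: XX 1) v.
Proof.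
move=> r0 m1 n1.
have rm : (1 < r * m)%N by rewrite (leq_trans m1) // leq_pmull.
have rn : (1 < r * n)%N by rewrite (leq_trans n1) // leq_pmull.
have z0 e : (0 < e)%N -> (0 : K) ^+ e = 0 by move=> e0; rewrite expr0n eqn0Ngt e0.
have [m0 n0 rm0 rn0] : [/\ (0 < m)%N, (0 < n)%N, (0 < (r * m).-1)%N & (0 < (r * n).-1)%N].
  by split; lia.
set M := (r * m)%N; set N := (r * n)%N; set E := (r * m * n)%N.
have E0 : (0 < E)%N by rewrite !muln_gt0 r0 m0.
have ME : (n * M = E)%N by rewrite mulnC.
have NE : (m * N = E)%N by rewrite mulnC /N mulnAC.
(* For z != 0 the minors will force x^M = - z^M / (E + 1) and the same for y^N, hence F = k z^M and
   G = k z^N. The pencil then vanishes only if x k^n = - c y k^m, and the power M N of this equation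
   is a z^(MN) = c^(MN) b z^(MN). *)
pose k : K := E%:R / E.+1%:R.
have E1 : E.+1%:R != 0 :> K by rewrite pnatr_eq0.
have k0 : k != 0 by rewrite mulf_neq0 ?invr_eq0 // pnatr_eq0 -lt0n.
pose a := k ^+ n ^+ (M * N) * (- E.+1%:R^-1) ^+ N.
pose b := (-1) ^+ (M * N) * (k ^+ m ^+ (M * N) * (- E.+1%:R^-1) ^+ M).
have b0 : b != 0.
  by rewrite !mulf_neq0 ?expf_neq0 // ?oppr_eq0 ?oner_eq0 ?invr_eq0.
pose q := a / b.
have [c c0 cq] : exists2 c : nat, (0 < c)%N & c%:R ^+ (M * N) != q.
  have [q1|q1] := eqVneq q 1; last by exists 1%N => //; rewrite expr1n eq_sym.
  exists 2%N => //; rewrite q1 -natrX pnatr_eq1 -[1%N](expn0 2) eqn_exp2l //.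
  by rewrite -lt0n muln_gt0 /M /N !muln_gt0 r0 m0 n0.
exists c => // v [i vi].
apply: contrapT => /not_orP[/negP/negPn/eqP H0 nex].
set x := v 0; set y := v 1; set z := v ord_max.
pose ax := E.+1%:R * x ^+ M + z ^+ M; pose az := E%:R * x * z ^+ M.-1.
pose cy := c%:R * (E.+1%:R * y ^+ N + z ^+ N); pose cz := c%:R * (E%:R * y * z ^+ N.-1).
have minor0 j l : meval v (dlog_minor m n
    (fermat 0 ord_max M) (fermat 1 ord_max N) (XX 0) (c%:R *: XX 1) j l) = 0.
  by apply/eqP/negPn/negP => jl; apply: nex; exists j, l.
have cn0 : c%:R != 0 :> K by rewrite pnatr_eq0 -lt0n.
have nM : n%:R * M%:R = E%:R :> K by rewrite -natrM ME.
have mN : m%:R * N%:R = E%:R :> K by rewrite -natrM NE.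
have xM : x * x ^+ M.-1 = x ^+ M by rewrite -exprS prednK // ltnW.
have yN : y * y ^+ N.-1 = y ^+ N by rewrite -exprS prednK // ltnW.
have dF j : meval v (dlog n (fermat 0 ord_max M) (XX 0) j) =
    if j == 0 then ax else if j == ord_max then az else 0.
  rewrite /dlog mevalD mevalZ !mevalM mderivD mevalD
    !meval_mderivXXn meval_mderivXX.
  rewrite /fermat mevalD !rmorphXn /= !mevalXU -/x -/z /ax /az -natr1 -nM -xM.
  by case: j => -[|[|[|//]]] j3 /=; ring.
have dG j : meval v (dlog m (fermat 1 ord_max N) (c%:R *: XX 1) j) =
    if j == 1 then cy else if j == ord_max then cz else 0.
  rewrite /dlog mderivZ mevalD mevalZ !mevalM mderivD mevalD
    !meval_mderivXXn !mevalZ meval_mderivXX.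
  rewrite /fermat mevalD !rmorphXn /= !mevalXU -/y -/z /cy /cz -natr1 -mN -yN.
  by case: j => -[|[|[|//]]] j3 /=; ring.
have He : x * (x ^+ M + z ^+ M) ^+ n + c%:R * y * (y ^+ N + z ^+ N) ^+ m = 0.
  rewrite -[RHS]H0 /pencil /fermat mevalD !mevalM mevalZ !rmorphXn /= !mevalD !rmorphXn /= !mevalXU.
  by [].
have axcy : ax * cy = 0.
  by have := minor0 0 1; rewrite /dlog_minor mevalB !mevalM !dF !dG /= mul0r subr0.
have axcz : ax * cz = 0.
  by have := minor0 0 ord_max; rewrite /dlog_minor mevalB !mevalM !dF !dG /= mulr0 subr0.
have azcy : az * cy = 0.
  by have := minor0 ord_max 1; rewrite /dlog_minor mevalB !mevalM !dF !dG /= mul0r subr0.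
have ez (u : K) e : u ^+ e = 0 -> u = 0 by move=> /eqP; rewrite expf_eq0 => /andP[_ /eqP].
have M0 := ltnW rm; have N0 := ltnW rn.
have [zz|zn] := eqVneq z 0.
  have allz : x = 0 /\ y = 0.
    move: axcy He; rewrite /ax /cy zz !z0 // !addr0 => /eqP.
    rewrite !mulf_eq0 (negPf cn0) (negPf E1) !expf_eq0 M0 N0 /= => /orP[]/eqP ->.
      rewrite !z0 // mul0r add0r => /eqP; rewrite -exprM -mulrA mulf_eq0 (negPf cn0) /= -exprS.
      by move=> /eqP/ez.
    by rewrite mulr0 mul0r addr0 -exprM -exprS => /ez.
  case/eqP: vi; rewrite vec_eta /vec; case: allz => x0 y0.
  by case: i => -[|[|[|//]]] i3 //=; rewrite -[RHS]zz; congr v; apply/val_inj; rewrite /= inordK.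
(* Otherwise [cy] and [cz] both vanish: [cz] gives y = 0, and then [cy] gives z = 0. The next step
   is symmetric. *)
have ax0 : ax = 0.
  apply/eqP/negPn/negP => ax0; have cz0 : cz = 0 by apply: (mulfI ax0); rewrite mulr0.
  have cy0 : cy = 0 by apply: (mulfI ax0); rewrite mulr0.
  have y0 : y = 0.
    apply/eqP; move/eqP: cz0; rewrite /cz !mulf_eq0 (negPf cn0) pnatr_eq0 (gtn_eqF E0) /=.
    by rewrite expf_eq0 (negPf zn) andbF orbF.
  by move/eqP: cy0; rewrite /cy y0 z0 // mulr0 add0r mulf_eq0 (negPf cn0) expf_eq0 (negPf zn) andbF.
have cy0 : cy = 0.
  apply/eqP/negPn/negP => cy0; have az0 : az = 0 by apply: (mulIf cy0); rewrite mul0r.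
  have x0 : x = 0.
    apply/eqP; move/eqP: az0; rewrite /az !mulf_eq0 pnatr_eq0 (gtn_eqF E0) /=.
    by rewrite expf_eq0 (negPf zn) andbF orbF.
  by move/eqP: ax0; rewrite /ax x0 z0 // mulr0 add0r expf_eq0 (negPf zn) andbF.
have xME : x ^+ M = - E.+1%:R^-1 * z ^+ M.
  apply: (mulfI E1); rewrite mulrA mulrN divff // mulN1r; apply/eqP; rewrite -addr_eq0.
  exact/eqP.
have yNE : y ^+ N = - E.+1%:R^-1 * z ^+ N.
  apply: (mulfI E1); rewrite mulrA mulrN divff // mulN1r; apply/eqP; rewrite -addr_eq0.
  by apply/eqP/(mulfI cn0); rewrite mulr0.
have kE : 1 - E.+1%:R^-1 = k.
  by apply: (mulIf E1); rewrite mulrBl mulVf // divfK // mul1r -natr1 addrK.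
have xzM : x ^+ M + z ^+ M = k * z ^+ M by rewrite xME -kE; ring.
have yzN : y ^+ N + z ^+ N = k * z ^+ N by rewrite yNE -kE; ring.
have xk : x * k ^+ n = - (c%:R * y * k ^+ m).
  apply/eqP; rewrite -addr_eq0; apply/eqP.
  have zE : z ^+ E != 0 by rewrite expf_neq0.
  apply: (mulIf zE); rewrite mul0r -[RHS]He xzM yzN !exprMn -!exprM.
  by rewrite [(M * n)%N]mulnC ME [(N * m)%N]mulnC NE; ring.
case/eqP: cq; apply: (mulIf b0); rewrite divfK //.
have zMN : z ^+ (M * N) != 0 by rewrite expf_neq0.
apply: (mulIf zMN).
have xMN : x ^+ (M * N) = (- E.+1%:R^-1) ^+ N * z ^+ (M * N).
  by rewrite exprM xME exprMn -exprM.
have yMN : y ^+ (M * N) = (- E.+1%:R^-1) ^+ M * z ^+ (M * N).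
  by rewrite mulnC exprM yNE exprMn -exprM.
clearbody k.
have : (x * k ^+ n) ^+ (M * N) = (- (c%:R * y * k ^+ m)) ^+ (M * N) by rewrite xk.
rewrite exprNn !exprMn xMN yMN.
rewrite /a /b => h; have -> : k ^+ n ^+ (M * N) * (- E.+1%:R^-1) ^+ N * z ^+ (M * N) =
  (- E.+1%:R^-1) ^+ N * z ^+ (M * N) * k ^+ n ^+ (M * N) by ring.
by rewrite h; ring.
Qed.
End RegularExamples.

(** * A local inverse theorem *)

(** The intervals of radius 2c / 2^k, the tail of the geometric series, around [u k] are nested; the
    limit is the supremum of their left ends. *)
Lemma real_geometric_cvg (R : realType) (u : nat -> R) (c : R) :
  (forall k, `|u k.+1 - u k| <= c / 2 ^+ k) ->
  exists l, forall k, `|u k - l| <= 2 * c / 2 ^+ k.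
Proof.
move=> hu; pose e k : R := 2 * c / 2 ^+ k.
have eS k : e k = e k.+1 + c / 2 ^+ k.
  by rewrite /e exprS invfM; move: ((2 ^+ k)^-1) => w; field.
have step k := le_trans (ler_norm _) (hu k).
have step' k : u k - u k.+1 <= c / 2 ^+ k by rewrite (le_trans (ler_norm _)) // distrC.
have e_ge0 k : 0 <= e k.
  by rewrite /e -mulrA mulr_ge0 // (le_trans (normr_ge0 _) (hu k)).
have inc i j : (i <= j)%N -> u i - e i <= u j - e j.
  move=> /subnK <-; elim: (j - i)%N => [|k IH]; first by rewrite add0n.
  by rewrite addSn (le_trans IH) //; have := step' (k + i)%N; have := eS (k + i)%N; lra.
have dec i j : (i <= j)%N -> u j + e j <= u i + e i.
  move=> /subnK <-; elim: (j - i)%N => [|k IH]; first by rewrite add0n.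
  by rewrite addSn (le_trans _ IH) //; have := step (k + i)%N; have := eS (k + i)%N; lra.
have ab i j : u i - e i <= u j + e j.
  have [ij|/ltnW ij] := leqP i j.
    by rewrite (le_trans (inc _ _ ij)) //; have := e_ge0 j; lra.
  by rewrite (le_trans _ (dec _ _ ij)) //; have := e_ge0 i; lra.
pose S := range (fun k => u k - e k).
have supS : has_sup S.
  split; first by exists (u 0%N - e 0%N); exists 0%N.
  by exists (u 0%N + e 0%N) => _ [k _ <-].
exists (sup S) => k; rewrite -/(e k) ler_distl; apply/andP; split.
  by rewrite lerBlDr; apply: ge_sup; [case: supS|move=> _ [j _ <-]].
by rewrite -lerBlDr; apply: ub_le_sup; [case: supS|exists k].
Qed.

(** Completeness at the rate of Newton's iteration below. The constant 4 leaves room for adding the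
    errors 2c of the real and imaginary parts. *)
Definition geometric_complete (K : numFieldType) (V : normedModType K) :=
  forall (u : nat -> V) (c : K), (forall k, `|u k.+1 - u k| <= c / 2 ^+ k) ->
  exists l, forall k, `|u k - l| <= 4 * c / 2 ^+ k.

Definition geometric_archimedean (K : numFieldType) :=
  forall x b : K, 0 <= x -> (forall k, x <= b / 2 ^+ k) -> x = 0.

(** * Completeness of the complex numbers *)

Section Complex.
Local Open Scope complex_scope.

Lemma normc_ge_Im (R : rcfType) (z : R[i]) : `|complex.Im z|%:C <= `|z|.
Proof.
by case: z => x y /=; rewrite normc_def /= lecR -sqrtr_sqr ler_wsqrtr // lerDr sqr_ge0.
Qed.

Lemma normc_le_ReIm (R : rcfType) (z : R[i]) : `|z| <= (`|complex.Re z| + `|complex.Im z|)%:C.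
Proof.
rewrite {1}[z]complexE (le_trans (ler_normD _ _)) // rmorphD /= normrM.
rewrite !normc_def /= !expr0n /= !addr0 add0r expr1n sqrtr1 mul1r !sqrtr_sqr.
by [].
Qed.

Lemma complex_complete (R : realType) : geometric_complete (Cfield R).
Proof.
move=> u c hu.
have c0 : 0 <= c by have := le_trans (normr_ge0 _) (hu 0%N); rewrite expr0 divr1.
have cE : c = (complex.Re c)%:C by rewrite RRe_real // ger0_real.
have bound k : c / 2 ^+ k = (complex.Re c / 2 ^+ k)%:C.
  by rewrite rmorphM fmorphV rmorphXn /= rmorph_nat -cE.
have [|x hx] := @real_geometric_cvg R (fun k => complex.Re (u k)) (complex.Re c).
  move=> k; rewrite -lecR -bound (le_trans _ (hu k)) // (le_trans _ (normc_ge_Re _)) //.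
  by rewrite raddfB.
have [|y hy] := @real_geometric_cvg R (fun k => complex.Im (u k)) (complex.Re c).
  move=> k; rewrite -lecR -bound (le_trans _ (hu k)) // (le_trans _ (normc_ge_Im _)) //.
  by rewrite raddfB.
exists (x +i* y) => k; rewrite -mulrA bound (le_trans (normc_le_ReIm _)) //.
rewrite -[4]/(4%:R) -(rmorph_nat (real_complex R)) -rmorphM /= lecR.
have := hx k; have := hy k; rewrite !raddfB /= -!mulrA; lra.
Qed.

Lemma complex_archimedean (R : realType) : geometric_archimedean (Cfield R).
Proof.
move=> x b x0 hx; have b0 : 0 <= b by have := le_trans x0 (hx 0%N); rewrite expr0 divr1.
have xE : x = (complex.Re x)%:C by rewrite RRe_real // ger0_real.
have bE : b = (complex.Re b)%:C by rewrite RRe_real // ger0_real.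
move: xE bE x0 hx b0; move: (complex.Re x) (complex.Re b) => y e -> ->.
rewrite !lecR => y0 hy e0.
have {}hy k : y <= e / 2 ^+ k.
  by have := hy k; rewrite -lecR rmorphM fmorphV rmorphXn /= rmorph_nat.
congr _%:C; apply/eqP/negPn/negP => yn0.
have y_gt0 : 0 < y by rewrite lt_neqAle eq_sym yn0.
have ey : 0 <= e / y by rewrite divr_ge0.
have := archi_boundP ey; set k := Num.bound _ => hk.
have : e / y < 2 ^+ k by rewrite (lt_le_trans hk) // -natrX ler_nat ltnW // ltn_expl.
rewrite ltr_pdivrMr // -ltr_pdivrMl ?exprn_gt0 // mulrC => /lt_le_trans/(_ (hy k)).
by rewrite ltxx.
Qed.

End Complex.

Lemma prod_norm_le (K : numFieldType) (V W : normedModType K) (u : V * W) (c : K) :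
  (`|u| <= c) = (`|u.1| <= c) && (`|u.2| <= c).
Proof. by rewrite prod_normE /= comparable_ge_max // real_comparable // normr_real. Qed.

Lemma prod_complete (K : numFieldType) (V W : normedModType K) :
  geometric_complete V -> geometric_complete W -> geometric_complete (V * W)%type.
Proof.
move=> hV hW u c hu.
have [k|x hx] := hV (fun k => (u k).1) c.
  by have := hu k; rewrite prod_norm_le => /andP[].
have [k|y hy] := hW (fun k => (u k).2) c.
  by have := hu k; rewrite prod_norm_le => /andP[].
by exists (x, y) => k; rewrite prod_norm_le hx hy.
Qed.

Lemma lip_near (K : numFieldType) (V W : normedModType K) (f : V -> W) x (L e : K) :
  0 <= L -> (\forall y \near x, `|f x - f y| <= L * `|x - y|) -> 0 < e ->
  \forall y \near x, `|f x - f y| < e.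
Proof.
move=> L0 fl e0; have L1 : 0 < L + 1 by rewrite ltr_wpDl.
near=> y.
apply: (@le_lt_trans _ _ (L * `|x - y|)); first by near: y.
have xy : `|x - y| < e / (L + 1).
  by near: y; apply/nbhs_normP; exists (e / (L + 1)); [exact: divr_gt0|by move=> z].
apply: (@le_lt_trans _ _ ((L + 1) * `|x - y|)).
  by rewrite ler_wpM2r ?normr_ge0 ?lerDl ?ler01.
by rewrite mulrC -ltr_pdivlMr.
Unshelve. all: by end_near. Qed.

(* Newton's iteration with the constant approximate inverse S of the
   differential of f at a. *)
Section LocalInverse.
Variables (K : numFieldType) (V W : normedModType K) (f : V -> W).
Variables (a : V) (S : W -> V) (rho L c : K).
Hypotheses (archiK : geometric_archimedean K) (completeV : geometric_complete V).
Hypotheses (rho_gt0 : 0 < rho) (L_ge0 : 0 <= L) (c_ge0 : 0 <= c).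
Hypotheses (SB : forall u v, S (u - v) = S u - S v).
Hypotheses (Sc : forall u, `|S u| <= c * `|u|) (S0 : forall u, S u = 0 -> u = 0).
Hypothesis f_lip : forall x y, `|x - a| < rho -> `|y - a| < rho ->
  `|f x - f y| <= L * `|x - y|.
Hypothesis f_contr : forall x y, `|x - a| < rho -> `|y - a| < rho ->
  `|x - y - S (f x - f y)| <= `|x - y| / 2.

(** The contraction estimate lets half of the distance be absorbed. Injectivity of [f] and the
    Lipschitz bound of its inverse both come from here. *)
Lemma local_expansion x y : `|x - a| < rho -> `|y - a| < rho ->
  `|x - y| <= 2 * `|S (f x - f y)|.
Proof.
move=> xa ya; have := f_contr xa ya => h.
have : `|x - y| <= `|x - y| / 2 + `|S (f x - f y)|.
  rewrite (le_trans _ (lerD h (lexx _))) //.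
  by rewrite (le_trans _ (ler_normD _ _)) // subrK.
rewrite -lerBlDl {1}[`|x - y|]splitr addrK => h'.
by rewrite mulrC -ler_pdivrMr.
Qed.

Lemma local_surjection w : `|S (w - f a)| < rho / 8 -> exists2 x, `|x - a| < rho & f x = w.
Proof.
(* The first step has length [d] and each later bound is halved, so the iterates stay within 2d of
   [a] and the limit within 4d; both are below [rho] because d < rho / 8. *)
move=> hw; pose u k := iter k (fun x => x - S (f x - w)) a.
set d := `|S (w - f a)| in hw.
have SN x : S (- x) = - S x.
  have S00 : S 0 = 0 by rewrite -(subrr (0 : W)) SB subrr.
  by rewrite -[- x]sub0r SB S00 sub0r.
have d0 : 0 <= d by apply: normr_ge0.
have d2 : 2 * d < rho.
  rewrite (@lt_trans _ _ (2 * (rho / 8))) ?ltr_pM2l //.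
  by rewrite mulrCA gtr_pMr // ltr_pdivrMr // mul1r ltr_nat.
have d4 : 4 * d < rho.
  rewrite (@lt_trans _ _ (4 * (rho / 8))) ?ltr_pM2l //.
  by rewrite mulrCA gtr_pMr // ltr_pdivrMr // mul1r ltr_nat.
have p2 k : 0 < 2 ^+ k :> K by rewrite exprn_gt0.
have uS k : u k.+1 = u k - S (f (u k) - w) by [].
have ball_u k : `|u k - a| <= 2 * d - 2 * d / 2 ^+ k -> `|u k - a| < rho.
  move=> h; apply: le_lt_trans d2; apply: le_trans h _.
  by rewrite gerBl divr_ge0 ?mulr_ge0 // ltW.
have uk k : `|u k - a| <= 2 * d - 2 * d / 2 ^+ k /\ `|u k.+1 - u k| <= d / 2 ^+ k.
  elim: k => [|k [IH1 IH2]].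
    rewrite expr0 !divr1 subrr /= subrr normr0 lexx; split=> //.
    by rewrite addrAC subrr add0r -SN opprB.
  have IH3 : `|u k.+1 - a| <= 2 * d - 2 * d / 2 ^+ k.+1.
    have -> : 2 * d - 2 * d / 2 ^+ k.+1 = d / 2 ^+ k + (2 * d - 2 * d / 2 ^+ k).
      by rewrite exprS invfM; move: ((2 ^+ k)^-1) => z; field.
    by apply: le_trans (lerD IH2 IH1); rewrite -{1}(subrK (u k) (u k.+1)) -addrA ler_normD.
  split=> //; rewrite [u k.+2]uS.
  have -> : u k.+1 - S (f (u k.+1) - w) - u k.+1 =
      u k.+1 - u k - S (f (u k.+1) - f (u k)).
    have -> : S (f (u k.+1) - f (u k)) = S (f (u k.+1) - w) - S (f (u k) - w).
      by rewrite -SB; congr S; rewrite opprB addrA subrK.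
    have -> : u k.+1 - u k = - S (f (u k) - w) by rewrite uS addrAC subrr add0r.
    by rewrite [LHS]addrAC subrr add0r opprB addrA addNr add0r.
  apply: le_trans (f_contr (ball_u _ IH3) (ball_u _ IH1)) _.
  by rewrite exprS invfM mulrCA [X in _ <= X]mulrC ler_pM2r ?invr_gt0.
have [x hx] := completeV (fun k => (uk k).2).
have xa : `|x - a| < rho.
  by have := hx 0%N; rewrite /= expr0 divr1 distrC => /le_lt_trans; apply.
exists x => //; apply/eqP; rewrite -subr_eq0; apply/eqP/S0/eqP; rewrite -normr_eq0; apply/eqP.
(* S (f x - w) is compared with the k-th Newton step: S (f x - f (u k)) is at most c L 4d / 2^k, and
   the step itself at most d / 2^k. *)
apply: (@archiK _ (c * (L * (4 * d)) + d)) => // k.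
have -> : f x - w = f x - f (u k) - (w - f (u k)) by rewrite opprB addrA subrK.
rewrite SB mulrDl (le_trans (ler_normB _ _)) // lerD //.
  rewrite (le_trans (Sc _)) // -mulrA ler_wpM2l // .
  rewrite (le_trans (f_lip xa (ball_u _ (uk k).1))) // -mulrA ler_wpM2l //.
  by rewrite distrC.
have -> : S (w - f (u k)) = u k.+1 - u k by rewrite uS addrAC subrr add0r -SN opprB.
by case: (uk k).
Qed.

(** [U'] consists of the values reached by [local_surjection], and [U] is the part of the ball
    mapped into [U']. Choosing preimages in the ball then gives an inverse on exactly these sets. *)
Lemma local_homeo : exists (U : set V) (U' : set W) (g : W -> V),
  [/\ open U /\ open U', U a /\ U' (f a),
      (forall x, U x -> `|x - a| < rho /\ (U' (f x) /\ g (f x) = x)) /\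
      (forall y, U' y -> U (g y) /\ f (g y) = y),
      {in U, continuous f} & forall y z, U' y -> U' z -> `|g y - g z| <= 2 * c * `|y - z|].
Proof.
pose U' := [set w | `|S (w - f a)| < rho / 8].
pose U := [set x | `|x - a| < rho /\ U' (f x)].
pose g w := xget a [set x | `|x - a| < rho /\ f x = w].
have gP w : U' w -> `|g w - a| < rho /\ f (g w) = w.
  by move=> /local_surjection[x xa fx];
    exact: (@xgetI _ a [set x | `|x - a| < rho /\ f x = w] x (conj xa fx)).
have inj x y : `|x - a| < rho -> `|y - a| < rho -> f x = f y -> x = y.
  move=> xa ya fxy; have := local_expansion xa ya.
  have S00 : S 0 = 0 by rewrite -(subrr (0 : W)) SB subrr.
  by rewrite fxy subrr S00 normr0 mulr0 normr_le0 subr_eq0 => /eqP.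
have ballo x : `|x - a| < rho -> \forall y \near x, `|y - a| < rho.
  move=> xa; apply/nbhs_normP; exists (rho - `|x - a|); first by rewrite /= subr_gt0.
  move=> y /= xy; rewrite -(subrK x y) -addrA (le_lt_trans (ler_normD _ _)) //.
  by rewrite -ltrBrDr distrC.
have cU' w : U' w -> \forall z \near w, U' z.
  rewrite /U' /= => Uw; pose e := rho / 8 - `|S (w - f a)|.
  have : \forall z \near w, `|S (w - f a) - S (z - f a)| < e.
    apply: (@lip_near _ _ _ (fun z => S (z - f a)) w c) => //; last by rewrite subr_gt0.
    by apply: nearW => z; rewrite -SB opprB addrA subrK (le_trans (Sc _)).
  apply: filterS => z; rewrite distrC => h.
  rewrite /= -(subrK (S (w - f a)) (S (z - f a))) (le_lt_trans (ler_normD _ _)) //.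
  by rewrite -ltrBrDr.
have lipf x : `|x - a| < rho -> \forall y \near x, `|f x - f y| <= L * `|x - y|.
  by move=> xa; apply: filterS (ballo x xa) => y; apply: f_lip.
have cf x : `|x - a| < rho -> {for x, continuous f}.
  move=> xa; apply/cvgrPdist_lt => e e0.
  exact: (@lip_near _ _ _ f x L _ L_ge0 (lipf x xa) e0).
have cU x : U x -> \forall y \near x, U y.
  by move=> [xa fx]; apply: filterI; [apply: ballo|apply: cf => //; apply: cU'].
exists U, U', g; split.
- by split; rewrite openE => x /=; [apply: cU|apply: cU'].
- have fa : U' (f a).
    rewrite /U' /= subrr (_ : S 0 = 0) ?normr0 ?divr_gt0 //.
    by rewrite -(subrr (0 : W)) SB subrr.
  by split=> //; split; rewrite // subrr normr0.
- split=> [x [xa fx]|y Uy]; last by have [gy fgy] := gP y Uy; split=> //; split=> //; rewrite fgy.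
  by split=> //; split=> //; have [gx fgx] := gP _ fx; apply: inj.
- by move=> x /set_mem[xa _]; apply: cf.
- move=> y z Uy Uz; have [gy fy] := gP y Uy; have [gz fz] := gP z Uz.
  have := local_expansion gy gz; rewrite fy fz -mulrA => /le_trans; apply.
  by rewrite ler_pM2l ?Sc.
Qed.
End LocalInverse.

(** * Strict differentiability *)

Section StrictDifferentiability.
Variables (K : numFieldType) (V : normedModType K).

(** The estimate concerns all pairs near [a], as the contraction hypothesis of the local inverse
    theorem does; it is obtained for polynomials without a mean value inequality. *)
Definition strict_diff (W : normedModType K) (f : V -> W) (a : V) (T : V -> W) :=
  (exists2 c, 0 <= c & forall u, `|T u| <= c * `|u|) /\
  forall e, 0 < e -> exists2 rho, 0 < rho &
    forall x y, `|x - a| < rho -> `|y - a| < rho ->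
    `|f x - f y - T (x - y)| <= e * `|x - y|.

Definition lip_at (W : normedModType K) (f : V -> W) (a : V) :=
  exists2 c, 0 <= c & exists2 rho, 0 < rho &
    forall x y, `|x - a| < rho -> `|y - a| < rho -> `|f x - f y| <= c * `|x - y|.

(** The order of [K] is partial, but positive elements are real, hence comparable. *)
Lemma radius2 (r s : K) : 0 < r -> 0 < s -> exists2 t, 0 < t & t <= r /\ t <= s.
Proof.
move=> r0 s0; have [rs|sr] := orP (real_leVge (gtr0_real r0) (gtr0_real s0)).
  by exists r.
by exists s.
Qed.

Lemma strict_diff_lip (W : normedModType K) (f : V -> W) a T : strict_diff f a T -> lip_at f a.
Proof.
move=> [[c c0 Tc] /(_ 1 ltr01)[rho rho0 h]].
exists (c + 1); first by rewrite addr_ge0.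
exists rho => // x y xa ya; rewrite -(subrK (T (x - y)) (f x - f y)).
rewrite (le_trans (ler_normD _ _)) // addrC mulrDl lerD //; first exact: h.
Qed.

Lemma lip_at_small (W : normedModType K) (f : V -> W) a e : lip_at f a -> 0 < e ->
  exists2 rho, 0 < rho & forall x, `|x - a| < rho -> `|f x - f a| < e.
Proof.
move=> [c c0 [rho rho0 h]] e0; have c1 : 0 < c + 1 by rewrite ltr_wpDl.
have [t t0 [tr te]] := radius2 rho0 (divr_gt0 e0 c1).
exists t => // x xa; apply: le_lt_trans (h x a (lt_le_trans xa tr) _) _.
  by rewrite subrr normr0.
apply: (@le_lt_trans _ _ ((c + 1) * `|x - a|)).
  by rewrite ler_wpM2r ?normr_ge0 ?lerDl ?ler01.
by rewrite mulrC -ltr_pdivlMr // (lt_le_trans xa).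
Qed.

Lemma lip_at_bounded (W : normedModType K) (f : V -> W) a : lip_at f a ->
  exists2 b, 0 < b & exists2 rho, 0 < rho & forall x, `|x - a| < rho -> `|f x| <= b.
Proof.
move=> lf; have [rho rho0 h] := lip_at_small lf ltr01.
exists (1 + `|f a|); first by rewrite ltr_pwDl.
exists rho => // x xa; rewrite -(subrK (f a) (f x)) (le_trans (ler_normD _ _)) //.
by rewrite lerD2r ltW // h.
Qed.

Lemma strict_diff_const (W : normedModType K) (b : W) a : strict_diff (fun=> b) a (fun=> 0).
Proof.
split; first by exists 0 => // u; rewrite normr0 mul0r.
move=> e e0; exists 1 => // x y _ _; rewrite !subrr normr0.
by rewrite mulr_ge0 // ltW.
Qed.

Lemma strict_diffD (f g : V -> K) a T U :
  strict_diff f a T -> strict_diff g a U ->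
  strict_diff (fun x => f x + g x) a (fun u => T u + U u).
Proof.
move=> [[c c0 Tc] hf] [[d d0 Ud] hg]; split.
  exists (c + d) => [|u]; first exact: addr_ge0.
  by rewrite mulrDl (le_trans (ler_normD _ _)) // lerD.
move=> e e0; have e2 : 0 < e / 2 by rewrite divr_gt0.
have [r r0 {}hf] := hf _ e2; have [s s0 {}hg] := hg _ e2.
have [t t0 [tr ts]] := radius2 r0 s0; exists t => // x y xa ya.
have -> : f x + g x - (f y + g y) - (T (x - y) + U (x - y)) =
   (f x - f y - T (x - y)) + (g x - g y - U (x - y)).
  by ring.
rewrite (le_trans (ler_normD _ _)) // [e]splitr mulrDl.
by rewrite lerD ?hf ?hg // ?(lt_le_trans xa) ?(lt_le_trans ya).
Qed.

(** Because [f] vanishes at [a], a Lipschitz cofactor is enough. This serves for the branches of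
    roots of [L1] and [L2] that multiply F and G. *)
Lemma strict_diff_mul0 (f b : V -> K) a T : strict_diff f a T -> f a = 0 -> lip_at b a ->
  strict_diff (fun x => f x * b x) a (fun u => b a * T u).
Proof.
move=> sf fa0 lb; have lf := strict_diff_lip sf.
case: sf => -[c c0 Tc] hf; split.
  exists (`|b a| * c) => [|u]; first exact: mulr_ge0.
  by rewrite normrM -mulrA ler_wpM2l.
move=> e e0.
have [B B0 [r1 r10 hB]] := lip_at_bounded lb.
have e3 : 0 < e / 3 by rewrite divr_gt0.
have [r2 r20 h2] := hf _ (divr_gt0 e3 B0).
have c1 : 0 < c + 1 by rewrite ltr_wpDl.
have [r3 r30 h3] := lip_at_small lb (divr_gt0 e3 c1).
case: lb => d d0 [r4 r40 h4]; have d1 : 0 < d + 1 by rewrite ltr_wpDl.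
have [r5 r50 h5] := lip_at_small lf (divr_gt0 e3 d1).
have [s1 s10 [sr1 sr2]] := radius2 r10 r20; have [s2 s20 [sr3 sr4]] := radius2 r30 r40.
have [s3 s30 [ss1 ss2]] := radius2 s10 s20; have [s s0 [sr ss3]] := radius2 r50 s30.
exists s => // x y xs ys.
have lts z u : `|z - a| < s -> s3 <= u -> `|z - a| < u.
  by move=> zs su; rewrite (lt_le_trans zs) // (le_trans ss3).
have -> : f x * b x - f y * b y - b a * T (x - y) =
    (f x - f y - T (x - y)) * b x + f y * (b x - b y) + (b x - b a) * T (x - y) by ring.
have -> : e * `|x - y| = e / 3 * `|x - y| + e / 3 * `|x - y| + e / 3 * `|x - y| by field.
have r1s : s3 <= r1 by apply: le_trans sr1.
have r2s : s3 <= r2 by apply: le_trans sr2.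
have r3s : s3 <= r3 by apply: le_trans sr3.
have r4s : s3 <= r4 by apply: le_trans sr4.
have bx : `|b x| <= B by apply: hB; apply: lts.
have fxy : `|f x - f y - T (x - y)| <= e / 3 / B * `|x - y| by apply: h2; apply: lts.
have bxa : `|b x - b a| <= e / 3 / (c + 1) by apply/ltW/h3; apply: lts.
have bxy : `|b x - b y| <= d * `|x - y| by apply: h4; apply: lts.
have fy : `|f y| <= e / 3 / (d + 1).
  by rewrite -[f y]subr0 -fa0; apply/ltW/h5; apply: lt_le_trans sr.
have aux k : 0 <= k -> e / 3 / (k + 1) * (k * `|x - y|) <= e / 3 * `|x - y|.
  move=> k0; have k1 : 0 < k + 1 by rewrite ltr_wpDl.
  rewrite mulrA ler_wpM2r // mulrAC ler_pdivrMr // mulrDr lerDl mulr_ge0 // ltW //.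
rewrite (le_trans (ler_normD _ _)) // lerD //.
  rewrite (le_trans (ler_normD _ _)) // lerD //.
    rewrite normrM (le_trans (ler_pM _ _ fxy bx)) //.
    by rewrite mulrAC divfK // gt_eqF.
  by rewrite normrM (le_trans (ler_pM _ _ fy bxy)) // aux.
by rewrite normrM (le_trans (ler_pM _ _ bxa (Tc _))) // aux.
Qed.

(** Reduced to a vanishing factor by f g = (f - f a) g + (g - g a) f a + f a g a. *)
Lemma strict_diffM (f g : V -> K) a T U : strict_diff f a T -> strict_diff g a U ->
  strict_diff (fun x => f x * g x) a (fun u => g a * T u + f a * U u).
Proof.
move=> sf sg.
have sf' : strict_diff (fun x => f x - f a) a (fun u => T u + 0).
  exact: strict_diffD (strict_diff_const (- f a) a).
have sg' : strict_diff (fun x => g x - g a) a (fun u => U u + 0).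
  exact: strict_diffD (strict_diff_const (- g a) a).
have lc : lip_at (fun _ : V => f a) a := strict_diff_lip (strict_diff_const (f a) a).
have s1 := strict_diff_mul0 sf' (subrr _) (strict_diff_lip sg).
have s2 := strict_diff_mul0 sg' (subrr _) lc.
have := strict_diffD (strict_diffD s1 s2) (strict_diff_const (f a * g a) a).
congr (strict_diff _ a _); apply/funext => x; ring.
Qed.

Lemma strict_diffX (f : V -> K) a T n : strict_diff f a T ->
  strict_diff (fun x => f x ^+ n) a (fun u => n%:R * f a ^+ n.-1 * T u).
Proof.
move=> sf; elim: n => [|n IH].
  have := strict_diff_const (1 : K) a; congr (strict_diff _ a _).
  by apply/funext => u; rewrite !mul0r.
have := strict_diffM sf IH; congr (strict_diff _ a _); apply/funext => x.
  by rewrite exprS.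
case: n {IH} => [|n] /=; first by rewrite !expr0; ring.
by rewrite exprS -[n.+2%:R]natr1; ring.
Qed.
End StrictDifferentiability.

(** * The local model *)

Section LocalModel.
Variable K : numClosedFieldType.
Hypotheses (archiK : geometric_archimedean K) (completeK : geometric_complete K).
Local Notation V := (K * K)%type.
Local Notation XX i := (@mpolyX 3 K (mnm1 i)).

Definition aeval (P : {mpoly K[3]}) (x : V) : K := meval (vec 1 x.1 x.2) P.

Definition adiff (P : {mpoly K[3]}) (a u : V) : K :=
  aeval (mderiv 1 P) a * u.1 + aeval (mderiv ord_max P) a * u.2.

Lemma norm_fst_le (u : V) : `|u.1| <= `|u|.
Proof. by have := lexx `|u|; rewrite {1}prod_norm_le => /andP[]. Qed.

Lemma norm_snd_le (u : V) : `|u.2| <= `|u|.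
Proof. by have := lexx `|u|; rewrite {1}prod_norm_le => /andP[]. Qed.

Lemma strict_diff_fst (a : V) : strict_diff (fun x : V => x.1 : K) a (fun u => u.1).
Proof.
split; first by exists 1 => // u; rewrite mul1r norm_fst_le.
move=> e e0; exists 1 => // x y _ _ /=; rewrite subrr normr0 mulr_ge0 //; exact: ltW.
Qed.

Lemma strict_diff_snd (a : V) : strict_diff (fun x : V => x.2 : K) a (fun u => u.2).
Proof.
split; first by exists 1 => // u; rewrite mul1r norm_snd_le.
move=> e e0; exists 1 => // x y _ _ /=; rewrite subrr normr0 mulr_ge0 //; exact: ltW.
Qed.

Lemma strict_diff_aeval (P : {mpoly K[3]}) (a : V) : strict_diff (aeval P) a (adiff P a).
Proof.
pose Q (P : {mpoly K[3]}) := strict_diff (aeval P) a (adiff P a).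
have QC c : Q (@mpolyC 3 K c).
  rewrite /Q; have := strict_diff_const c a; congr (strict_diff _ a _).
    by apply/funext => x; rewrite /aeval mevalC.
  by apply/funext => u; rewrite /adiff /aeval !mderivC !meval0 !mul0r addr0.
have QD P1 P2 : Q P1 -> Q P2 -> Q (P1 + P2).
  rewrite /Q => q1 q2; have := strict_diffD q1 q2; congr (strict_diff _ a _).
    by apply/funext => x; rewrite /aeval mevalD.
  by apply/funext => u; rewrite /adiff /aeval !mderivD !mevalD; ring.
have QM P1 P2 : Q P1 -> Q P2 -> Q (P1 * P2).
  rewrite /Q => q1 q2; have := strict_diffM q1 q2; congr (strict_diff _ a _).
    by apply/funext => x; rewrite /aeval mevalM.
  by apply/funext => u; rewrite /adiff /aeval !mderivM !mevalD !mevalM; ring.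
have QX i : Q (XX i).
  rewrite /Q; case: i => -[|[|[|//]]] i3.
  - have := strict_diff_const (1 : K) a; congr (strict_diff _ a _).
      by apply/funext => x; rewrite /aeval mevalXU.
    by apply/funext => u; rewrite /adiff /aeval !meval_mderivXX /= !mul0r addr0.
  - have := strict_diff_fst a; congr (strict_diff _ a _).
      by apply/funext => x; rewrite /aeval mevalXU.
    by apply/funext => u; rewrite /adiff /aeval !meval_mderivXX /= mul0r mul1r addr0.
  - have := strict_diff_snd a; congr (strict_diff _ a _).
      by apply/funext => x; rewrite /aeval mevalXU.
    by apply/funext => u; rewrite /adiff /aeval !meval_mderivXX /= mul0r mul1r add0r.
rewrite -/(Q P) (mpolyE P); apply: (big_ind Q) => [||m _]; first exact: (QC 0).
  exact: QD.
rewrite -mul_mpolyC; apply: (QM); first exact: QC.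
rewrite (mpolyXE_id K m); apply: (big_ind Q) => [||i _]; first exact: (QC 1).
  exact: QM.
by elim: (m i) => [|k IH]; [apply: (QC 1)|rewrite exprS; apply: (QM)].
Qed.

Lemma lip_at_comp (U W X : normedModType K) (f : U -> W) (g : W -> X) a :
  lip_at f a -> lip_at g (f a) -> lip_at (fun x => g (f x)) a.
Proof.
move=> lf [d d0 [s s0 hg]]; have [r r0 hs] := lip_at_small lf s0.
case: lf => c c0 [t t0 hf]; have [p p0 [pr pt]] := radius2 r0 t0.
exists (d * c); first exact: mulr_ge0.
exists p => // x y xa ya.
rewrite (le_trans (hg _ _ _ _)) ?hs ?(lt_le_trans xa) ?(lt_le_trans ya) //.
by rewrite -mulrA ler_wpM2l // hf ?(lt_le_trans xa) ?(lt_le_trans ya).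
Qed.

(** A branch of the root is the local inverse of x^m at a root [a] of [c], where the derivative D =
    m a^(m-1) is nonzero; division by D is the constant approximate inverse. *)
Lemma local_root m (c : K) : (0 < m)%N -> c != 0 ->
  exists b : K -> K, [/\ lip_at b c, b c != 0 &
    exists2 rho, 0 < rho & forall w, `|w - c| < rho -> b w ^+ m = w].
Proof.
move=> m0 c0; pose a : K := m.-root c.
have am : a ^+ m = c by rewrite rootCK.
have a0 : a != 0 by apply: contra_neq c0 => a0; rewrite -am a0 expr0n eqn0Ngt m0.
pose D := m%:R * a ^+ m.-1.
have D0 : D != 0 by rewrite mulf_neq0 ?expf_neq0 // pnatr_eq0 -lt0n.
have sid : strict_diff (fun x : K => x) a (fun u => u).
  split; first by exists 1 => // u; rewrite mul1r.
  by move=> e e0; exists 1 => // x y _ _; rewrite subrr normr0 mulr_ge0 // ltW.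
have sf := strict_diffX m sid.
have [L L0 [r1 r10 hL]] := strict_diff_lip sf.
have D_gt0 : 0 < `|D| by rewrite normr_gt0.
have [r2 r20 h2] := sf.2 _ (divr_gt0 D_gt0 (ltr0n _ 2)).
have [r r0 [rr1 rr2]] := radius2 r10 r20.
have [||||||U [U' [g [[oU oU'] [Ua U'c] [hU hg] _ lg]]]] :=
  @local_homeo K K K (fun x => x ^+ m) a (fun w => w / D) r L `|D|^-1 archiK completeK r0 L0.
- by rewrite invr_ge0.
- by move=> u v; rewrite mulrBl.
- by move=> u; rewrite normrM normfV mulrC.
- by move=> u /eqP; rewrite mulf_eq0 invr_eq0 (negPf D0) orbF => /eqP.
- by move=> x y xa ya; apply: hL; [apply: lt_le_trans xa _|apply: lt_le_trans ya _].
- move=> x y xa ya.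
  have h := h2 x y (lt_le_trans xa rr2) (lt_le_trans ya rr2).
  rewrite -(ler_pM2l D_gt0) -normrM.
  have -> : D * (x - y - (x ^+ m - y ^+ m) / D) = - (x ^+ m - y ^+ m - D * (x - y)) by field.
  by rewrite normrN (le_trans h) // mulrAC mulrA.
have [r3 r30 h3] : exists2 r3, 0 < r3 & forall w, `|w - c| < r3 -> U' w.
  have /nbhs_normP[e e0 he] : nbhs c U' by apply: open_nbhs_nbhs; split; rewrite // -am.
  by exists e => // w wc; apply: he; rewrite /= distrC.
exists g; split.
- exists (2 * `|D|^-1); first by rewrite mulr_ge0 // invr_ge0.
  by exists r3 => // x y xc yc; apply: lg; apply: h3.
- by rewrite -am; have [_ [_ ->]] := hU a Ua.
- by exists r3 => // w /h3 /hg[].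
Qed.

Lemma pair_local_homeo (f1 f2 : V -> K) (a : V) (A B C D : K) r0 :
    strict_diff f1 a (fun u => A * u.1 + B * u.2) ->
    strict_diff f2 a (fun u => C * u.1 + D * u.2) ->
    A * D - B * C != 0 -> 0 < r0 ->
  let f x := (f1 x, f2 x) in
  exists (U U' : set V) (g : V -> V),
  [/\ open U /\ open U', U a /\ U' (f a),
      (forall x, U x -> `|x - a| < r0 /\ (U' (f x) /\ g (f x) = x)) /\
      (forall y, U' y -> U (g y) /\ f (g y) = y),
      {in U, continuous f} & {in U', continuous g}].
Proof.
move=> s1 s2 det0 r00 f.
set E := A * D - B * C in det0.
(* The inverse of the differential by Cramer's rule; c = M / |E| is a crude bound for its norm. *)
pose S (w : V) : V := ((D * w.1 - B * w.2) / E, (A * w.2 - C * w.1) / E).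
pose M := (`|A| + `|B| + `|C| + `|D|).
have M0 : 0 <= M by rewrite !addr_ge0.
have leM : [/\ `|D| + `|B| <= M & `|A| + `|C| <= M].
  by split; rewrite /M -subr_ge0; [rewrite (_ : _ - _ = `|A| + `|C|)|
    rewrite (_ : _ - _ = `|B| + `|D|)];
    rewrite ?addr_ge0 //; ring.
pose c := M / `|E|.
have E_gt0 : 0 < `|E| by rewrite normr_gt0.
have c0 : 0 <= c by rewrite divr_ge0.
have lin_le (p q : K) (w : V) : `|p| + `|q| <= M -> `|(p * w.1 - q * w.2) / E| <= c * `|w|.
  move=> pqM; rewrite normrM normfV /c mulrAC ler_pM2r ?invr_gt0 //.
  apply: le_trans (ler_wpM2r (normr_ge0 w) pqM).
  rewrite (le_trans (ler_normB _ _)) // !normrM mulrDl lerD // ler_wpM2l //.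
    exact: norm_fst_le.
  exact: norm_snd_le.
have Sc w : `|S w| <= c * `|w|.
  rewrite prod_norm_le /S /= lin_le /=; last by case: leM.
  rewrite -normrN -mulNr opprB lin_le //; rewrite addrC; by case: leM.
have SB u v : S (u - v) = S u - S v by congr pair; rewrite /=; ring.
have ST u : S (A * u.1 + B * u.2, C * u.1 + D * u.2) = u.
  by case: u => u v; congr pair; rewrite /= /E; field.
have TS w : (A * (S w).1 + B * (S w).2, C * (S w).1 + D * (S w).2) = w.
  by case: w => u v; congr pair; rewrite /= /E; field.
have S0 w : S w = 0 -> w = 0.
  by move=> Sw; rewrite -(TS w) Sw /= !mulr0 addr0.
have [L1 L10 [r1 r10 h1]] := strict_diff_lip s1.
have [L2 L20 [r2 r20 h2]] := strict_diff_lip s2.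
have c1 : 0 < c + 1 by rewrite ltr_wpDl.
(* This precision multiplied by the bound [c] of [S] is at most 1/2, the required contraction
   factor. *)
have e0 : 0 < 2^-1 / (c + 1) :> K by rewrite divr_gt0 // invr_gt0.
have [r3 r30 h3] := s1.2 _ e0; have [r4 r40 h4] := s2.2 _ e0.
have [r5 r50 [r51 r52]] := radius2 r10 r20; have [r6 r60 [r63 r64]] := radius2 r30 r40.
have [r7 r70 [r75 r76]] := radius2 r50 r60; have [r r_gt0 [rr0 rr7]] := radius2 r00 r70.
have L0 : 0 <= L1 + L2 by rewrite addr_ge0.
have lts (x : V) s : `|x - a| < r -> r7 <= s -> `|x - a| < s.
  by move=> xa rs; rewrite (lt_le_trans xa) // (le_trans rr7).
have r71 := le_trans r75 r51; have r72 := le_trans r75 r52.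
have r73 := le_trans r76 r63; have r74 := le_trans r76 r64.
have [||U [U' [g [oU Ua [hU hg] cf lg]]]] :=
  @local_homeo K V V f a S r (L1 + L2) c archiK
    (prod_complete completeK completeK) r_gt0 L0 c0 SB Sc S0.
- move=> x y xa ya; rewrite prod_norm_le /=.
  rewrite (le_trans (h1 x y (lts _ _ xa r71) (lts _ _ ya r71))) ?ler_wpM2r ?lerDl //.
  by rewrite (le_trans (h2 x y (lts _ _ xa r72) (lts _ _ ya r72))) ?ler_wpM2r ?lerDr.
- move=> x y xa ya.
  set T : V := (A * (x - y).1 + B * (x - y).2, C * (x - y).1 + D * (x - y).2).
  have STxy : S T = x - y by exact: ST.
  have -> : x - y - S (f x - f y) = S (T - (f x - f y)) by rewrite [RHS]SB STxy.
  apply: le_trans (Sc _) _.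
  have h : `|T - (f x - f y)| <= 2^-1 / (c + 1) * `|x - y|.
    rewrite prod_norm_le /= distrC h3 ?(lts _ _ xa r73) ?(lts _ _ ya r73) //=.
    by rewrite distrC h4 ?(lts _ _ xa r74) ?(lts _ _ ya r74).
  apply: le_trans (ler_wpM2l c0 h) _.
  rewrite mulrA mulrC ler_wpM2l // mulrCA ler_piMr ?invr_ge0 //.
  by rewrite ler_pdivrMr // mul1r lerDl.
exists U, U', g; split=> //.
- split=> // x Ux; have [xa ?] := hU x Ux; split=> //; exact: lt_le_trans xa rr0.
- move=> w /set_mem U'w; apply/cvgrPdist_lt => e e1.
  apply: (@lip_near _ _ _ g w (2 * c)) => //; first by rewrite mulr_ge0.
  have : nbhs w U' by apply: open_nbhs_nbhs; split=> //; case: oU.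
  by apply: filterS => z U'z; apply: lg.
Qed.

(** Here both [L1] and [L2] are absorbed into the coordinates, G times an m-th root of [L2] and F
    times an n-th root of [L1], so the equation becomes exactly w1^m + w2^n. As F and G vanish at
    [a], the roots enter the Jacobian there only through their nonzero values. *)
Lemma local_model (F G L1 L2 : {mpoly K[3]}) (a : V) m n : (0 < m)%N -> (0 < n)%N ->
    aeval F a = 0 -> aeval G a = 0 -> aeval L1 a != 0 -> aeval L2 a != 0 ->
    aeval (mderiv 1 F) a * aeval (mderiv ord_max G) a -
    aeval (mderiv ord_max F) a * aeval (mderiv 1 G) a != 0 ->
  exists (U U' : set V) (f g : V -> V),
  [/\ open U /\ open U', U a /\ f a = 0,
      (forall x, U x -> U' (f x) /\ g (f x) = x) /\
      (forall y, U' y -> U (g y) /\ f (g y) = y),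
      {in U, continuous f} /\ {in U', continuous g} &
      forall x, U x -> aeval (pencil m n F G L1 L2) x = (f x).1 ^+ m + (f x).2 ^+ n].
Proof.
move=> m0 n0 F0 G0 L10 L20 jac.
have [b [lb b0 [rb rb0 hb]]] := local_root m0 L20.
have [d [ld d0 [rd rd0 hd]]] := local_root n0 L10.
have [sF sG] := (strict_diff_aeval F a, strict_diff_aeval G a).
have lL1 := strict_diff_lip (strict_diff_aeval L1 a).
have lL2 := strict_diff_lip (strict_diff_aeval L2 a).
have [r1 r10 h1] := lip_at_small lL1 rd0.
have [r2 r20 h2] := lip_at_small lL2 rb0.
have [r r0 [rr1 rr2]] := radius2 r10 r20.
pose b0' := b (aeval L2 a); pose d0' := d (aeval L1 a).
have s1 : strict_diff (fun x => aeval G x * b (aeval L2 x)) a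
    (fun u => b0' * aeval (mderiv 1 G) a * u.1 + b0' * aeval (mderiv ord_max G) a * u.2).
  have := strict_diff_mul0 sG G0 (lip_at_comp lL2 lb); congr (strict_diff _ a _).
  by apply/funext => u; rewrite /adiff /b0'; ring.
have s2 : strict_diff (fun x => aeval F x * d (aeval L1 x)) a
    (fun u => d0' * aeval (mderiv 1 F) a * u.1 + d0' * aeval (mderiv ord_max F) a * u.2).
  have := strict_diff_mul0 sF F0 (lip_at_comp lL1 ld); congr (strict_diff _ a _).
  by apply/funext => u; rewrite /adiff /d0'; ring.
have [|U [U' [g [[oU oU'] [Ua _] [hU hg] cf cg]]]] := pair_local_homeo s1 s2 _ r0.
  rewrite (_ : _ - _ = - (b0' * d0') * (aeval (mderiv 1 F) a * aeval (mderiv ord_max G) a -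
    aeval (mderiv ord_max F) a * aeval (mderiv 1 G) a)); last by ring.
  by rewrite mulf_neq0 // oppr_eq0 mulf_neq0.
exists U, U', (fun x => (aeval G x * b (aeval L2 x), aeval F x * d (aeval L1 x))), g.
split=> //.
- by rewrite G0 F0 !mul0r.
- by split=> // x /hU[].
- move=> x /hU[xa _] /=; rewrite !exprMn hb ?h2 ?(lt_le_trans xa) //.
  rewrite hd ?h1 ?(lt_le_trans xa) // /pencil /aeval mevalD !mevalM !rmorphXn /=.
  by rewrite addrC mulrC [X in _ + X]mulrC.
Qed.
End LocalModel.

(** * Charts of the projective plane *)

Lemma euler_homog (R : comNzRingType) k d (P : {mpoly R[k]}) (v : 'I_k -> R) :
  P \is d.-homog -> \sum_i v i * meval v (mderiv i P) = d%:R * meval v P.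
Proof.
move=> hP; rewrite {2}(mpolyE P) raddf_sum mulr_sumr /=.
rewrite (eq_bigr (fun i => \sum_(m <- msupp P)
  mcoeff m P * (v i * meval v (mderiv i (@mpolyX k R m))))); last first.
  move=> i _; have -> : meval v (mderiv i P) =
      \sum_(m <- msupp P) mcoeff m P * meval v (mderiv i (@mpolyX k R m)).
    rewrite {1}(mpolyE P) (big_morph _ (mderivD i) (mderiv0 _ i)) raddf_sum.
    apply: eq_bigr => m _ /=.
    by rewrite mderivZ mevalZ.
  by rewrite mulr_sumr; apply: eq_bigr => m _; rewrite mulrCA.
rewrite exchange_big /=; apply: eq_big_seq => m mP.
rewrite -mulr_sumr mevalZ mulrCA; congr (_ * _).
have monom i : v i * meval v (mderiv i (@mpolyX k R m)) = (m i)%:R * meval v (@mpolyX k R m).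
  rewrite mderivX mevalZ mulrCA; have [->|mi] := posnP (m i); first by rewrite !mul0r.
  congr (_ * _); rewrite -(mevalXU v i) -mevalM -mpolyXD; congr (meval v (@mpolyX k R _)).
  apply/mnmP => j; rewrite mnmDE mnmBE mnm1E; case: eqP => [<-|_]; first by rewrite subnKC.
  by rewrite add0n subn0.
rewrite (eq_bigr _ (fun i _ => monom i)) -mulr_suml -natr_sum -mdegE.
by have := dhomog_mf hP mP => /= ->.
Qed.

Section Charts.
Local Open Scope quotient_scope.
Variable K : numClosedFieldType.
Local Notation V := (K * K)%type.

(** One chart is enough: by [base_points], generic base points lie off the line v 0 = 0. *)
Definition aff (v : 'I_3 -> K) : V := (v 1 / v 0, v ord_max / v 0).

Lemma meval_aff d (P : {mpoly K[3]}) (v : 'I_3 -> K) : P \is d.-homog -> v 0 != 0 ->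
  aeval P (aff v) = (v 0)^-1 ^+ d * meval v P.
Proof.
move=> hP v0; rewrite -meval_homog // /aeval; apply: meval_eq => i.
rewrite /vec /aff; case: i => -[|[|[|//]]] i3 /=; rewrite [RHS]mulrC.
- by rewrite (_ : Ordinal i3 = 0) ?divff //; apply/val_inj.
- by congr (v _ / _); apply/val_inj.
- by congr (v _ / _); apply/val_inj.
Qed.

Lemma meval_aff_eq0 d (P : {mpoly K[3]}) (v : 'I_3 -> K) : P \is d.-homog -> v 0 != 0 ->
  (aeval P (aff v) == 0) = (meval v P == 0).
Proof.
by move=> hP v0; rewrite (meval_aff hP) // mulf_eq0 expf_eq0 invr_eq0 (negPf v0) andbF.
Qed.

(* By Euler's identity the gradients are orthogonal to v, so their cross product
   is a multiple of v. *)
Lemma jacobian_aff d e (F G : {mpoly K[3]}) (v : 'I_3 -> K) :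
    F \is d.-homog -> G \is e.-homog -> v 0 != 0 ->
    meval v F = 0 -> meval v G = 0 -> (exists i j, jacobian F G v i j != 0) ->
  aeval (mderiv 1 F) (aff v) * aeval (mderiv ord_max G) (aff v) -
  aeval (mderiv ord_max F) (aff v) * aeval (mderiv 1 G) (aff v) != 0.
Proof.
move=> hF hG v0 F0 G0 jac.
rewrite !(meval_aff (dhomog_mderiv _ hF)) // !(meval_aff (dhomog_mderiv _ hG)) //.
set a := _ ^+ _; set b := _ ^+ _.
have a0 : a != 0 by rewrite expf_neq0 // invr_eq0.
have b0 : b != 0 by rewrite expf_neq0 // invr_eq0.
suff : jacobian F G v 1 ord_max != 0.
  apply: contra => /eqP h; apply/eqP/(mulfI a0)/(mulfI b0); rewrite !mulr0 -[RHS]h /jacobian.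
  by ring.
apply/negP => /eqP J; case: jac => i [j /eqP]; apply.
have := euler_homog v hF; have := euler_homog v hG; rewrite F0 G0 !mulr0.
rewrite !big_ord_recl !big_ord0 !addr0.
rewrite (_ : lift ord0 ord0 = 1); last exact/val_inj.
rewrite (_ : lift ord0 (lift ord0 ord0) = ord_max); last exact/val_inj.
move: J; rewrite /jacobian.
have c3 (k : 'I_3) : [\/ k = 0, k = 1 | k = ord_max].
  by case: k => -[|[|[|//]]] k3; [apply: Or31|apply: Or32|apply: Or33]; apply/val_inj.
set f1 := meval v (mderiv 1 F); set f2 := meval v (mderiv ord_max F).
set g1 := meval v (mderiv 1 G); set g2 := meval v (mderiv ord_max G).
set f0 := meval v (mderiv 0 F); set g0 := meval v (mderiv 0 G).
move=> J eG eF.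
have J01 : f0 * g1 - f1 * g0 = 0.
  apply: (mulfI v0); rewrite mulr0.
  transitivity ((v 0 * f0 + (v 1 * f1 + v ord_max * f2)) * g1 -
      f1 * (v 0 * g0 + (v 1 * g1 + v ord_max * g2)) + v ord_max * (f1 * g2 - f2 * g1));
    first by ring.
  by rewrite eF eG J; ring.
have J02 : f0 * g2 - f2 * g0 = 0.
  apply: (mulfI v0); rewrite mulr0.
  transitivity ((v 0 * f0 + (v 1 * f1 + v ord_max * f2)) * g2 -
      f2 * (v 0 * g0 + (v 1 * g1 + v ord_max * g2)) - v 1 * (f1 * g2 - f2 * g1)); first by ring.
  by rewrite eF eG J; ring.
have sw (x y z t : K) : x * y - z * t = 0 -> z * t - x * y = 0 by move=> h; rewrite -opprB h oppr0.
case: (c3 i) => ->; case: (c3 j) => ->;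
  first [exact: subrr|exact: J|exact: J01|exact: J02|exact: sw J|exact: sw J01|exact: sw J02].
Qed.

Lemma vec_point_neq0 (x y z : K) : (exists i, vec x y z i != 0) ->
  (\row_i vec x y z i) \in [set v : 'rV[K]_3 | v != 0].
Proof.
move=> [i vi]; rewrite inE /=; apply: contraNneq vi => v0.
by have /rowP/(_ i) := v0; rewrite !mxE => ->.
Qed.

Lemma vec1_neq0 (x y : K) : exists i, vec 1 x y i != 0.
Proof. by exists 0; rewrite /vec /= oner_eq0. Qed.

Definition affine_rep (x : V) : nzvec K :=
  exist _ (\row_i vec 1 x.1 x.2 i) (vec_point_neq0 (vec1_neq0 x.1 x.2)).

Definition affine_point (x : V) : P2 K := \pi_(P2 K) (affine_rep x).

Lemma coords_pi (u : nzvec K) :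
  exists2 c : K, c != 0 & coords (\pi_(P2 K) u) =1 fun i => c * set_val u ord0 i.
Proof.
have /eqmodP/asboolP[c c0 uE] : repr (\pi_(P2 K) u) = u %[mod P2 K] by rewrite reprK.
exists c => // i; rewrite /coords; have -> := uE.
by rewrite mxE.
Qed.

Lemma pi_eq (u : nzvec K) (p : P2 K) c : c != 0 ->
  (forall i, set_val u ord0 i = c * coords p i) -> \pi_(P2 K) u = p.
Proof.
move=> c0 uE; rewrite -[p]reprK; apply/eqmodP/asboolP; exists c => //.
by apply/rowP => i; rewrite mxE; apply: uE.
Qed.

Lemma coords_affine x : exists2 c : K, c != 0 &
  coords (affine_point x) =1 fun i => c * vec 1 x.1 x.2 i.
Proof.
have [c c0 h] := coords_pi (affine_rep x); exists c => // i.
by rewrite /affine_point h /= mxE.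
Qed.

Lemma affine_pointK x : coords (affine_point x) 0 != 0 /\ aff (coords (affine_point x)) = x.
Proof.
have [c c0 h] := coords_affine x; rewrite /aff !h /vec /= mulr1; split=> //.
by case: x {h} => x y; congr pair; rewrite /= mulrC mulKf.
Qed.

Lemma affine_coords (p : P2 K) : coords p 0 != 0 -> affine_point (aff (coords p)) = p.
Proof.
move=> p0; apply: (@pi_eq _ _ (coords p 0)^-1); first by rewrite invr_eq0.
move=> i; rewrite /= mxE /vec /aff; case: i => -[|[|[|//]]] i3 /=.
- by rewrite (_ : Ordinal i3 = 0) ?mulVf //; apply/val_inj.
- by rewrite mulrC; congr (_ * coords p _); apply/val_inj.
- by rewrite mulrC; congr (_ * coords p _); apply/val_inj.
Qed.

Lemma aff_continuous (v : 'rV[K]_3) : v 0 0 != 0 ->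
  {for v, continuous (fun v : 'rV[K]_3 => aff (v 0))}.
Proof.
move=> v0; have h i : (fun v : 'rV[K]_3 => v 0 i) @ v --> v 0 i by exact: coord_continuous.
exact: (cvg_pair (cvgM (h 1) (cvgV v0 (h 0))) (cvgM (h ord_max) (cvgV v0 (h 0)))).
Qed.

(** Openness in the quotient is tested on nonzero vectors, and there the condition is invariant
    under scaling, hence independent of the representatives behind [coords]. *)
Lemma open_chart (W : set V) : open W ->
  open [set p : P2 K | coords p 0 != 0 /\ W (aff (coords p))].
Proof.
move=> oW.
pose O := [set v : 'rV[K]_3 | v 0 0 != 0 /\ W (aff (v 0))].
have oO : open O.
  rewrite openE => v [v0 Wv]; apply: filterI.
    apply: (@coord_continuous K 1 3 0 0 v [set x | x != 0]).
    apply/nbhs_normP; exists `|v 0 0|; first by rewrite /= normr_gt0.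
    by move=> x /=; apply: contraTneq => ->; rewrite subr0 ltxx.
  by apply: (aff_continuous v0); apply: open_nbhs_nbhs.
rewrite /open/= /quotient_open.
rewrite (_ : _ @^-1` _ = set_val @^-1` O); first by exists O.
apply/seteqP; split=> u /=; have [c c0 h] := coords_pi u.
  rewrite h /aff !h mulf_eq0 negb_or (negPf c0) /= -!mulf_div !divff // !mul1r.
  by move=> [u0 Wu]; split.
rewrite h /aff !h mulf_eq0 negb_or (negPf c0) /= -!mulf_div !divff // !mul1r.
by move=> [u0 Wu]; split.
Qed.

Lemma affine_rep_continuous : continuous (affine_rep : V -> nzvec K).
Proof.
apply: continuous_comp_initial => x.
rewrite (_ : set_val \o affine_rep = fun x : V => \row_i vec 1 x.1 x.2 i); last exact/funext.
apply/cvg_ballP => e e0.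
have bx : nbhs x (ball x e) by apply/nbhs_ballP; exists e.
apply: filterS bx => y [xy1 xy2].
split=> // i0 i; rewrite !mxE /vec; case: i => -[|[|[|//]]] i3 //=.
exact: ballxx.
Qed.
Hypotheses (archiK : geometric_archimedean K) (completeK : geometric_complete K).

Lemma germ_pencil (p : P2 K) (F G L1 L2 : {mpoly K[3]}) m n dF dG e d :
    (0 < m)%N -> (0 < n)%N ->
    F \is dF.-homog -> G \is dG.-homog -> L1 \is e.-homog -> L2 \is e.-homog ->
    pencil m n F G L1 L2 \is d.-homog -> coords p 0 != 0 ->
    meval (coords p) F = 0 -> meval (coords p) G = 0 ->
    meval (coords p) L1 != 0 -> meval (coords p) L2 != 0 ->
    (exists i j, jacobian F G (coords p) i j != 0) ->
  germ_homeo p (curve (pencil m n F G L1 L2))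
    ((0, 0) : V) [set w : V | w.1 ^+ m + w.2 ^+ n = 0].
Proof.
move=> m0 n0 hF hG hL1 hL2 hH p0 F0 G0 L10 L20 jac.
have := @local_model K archiK completeK F G L1 L2 (aff (coords p)) m n m0 n0.
case.
- by apply/eqP; rewrite (meval_aff_eq0 hF) // F0.
- by apply/eqP; rewrite (meval_aff_eq0 hG) // G0.
- by rewrite (meval_aff_eq0 hL1).
- by rewrite (meval_aff_eq0 hL2).
- exact: jacobian_aff hF hG p0 F0 G0 jac.
move=> U0 [U' [f0 [g0 [[oU oU'] [Up fp] [hU hg] [cf cg] Hf]]]].
pose U := [set q : P2 K | coords q 0 != 0 /\ U0 (aff (coords q))].
pose f (q : P2 K) := f0 (aff (coords q)); pose g (w : V) := affine_point (g0 w).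
have U'p : U' 0 by rewrite -fp; case: (hU _ Up).
exists U, U', f, g; split.
- by split=> //; exact: open_chart.
- split.
    apply: continuous_in_subspaceT => q /set_mem[q0 Uq] B nB.
    have nB' : nbhs (aff (coords q)) (f0 @^-1` B).
      by apply: cf => //; exact/mem_set.
    have : nbhs q [set q : P2 K | coords q 0 != 0 /\ interior (f0 @^-1` B) (aff (coords q))].
      apply: open_nbhs_nbhs; split; first by apply: open_chart; exact: open_interior.
      by split.
    by apply: filterS => q' [_ /interior_subset].
  apply: continuous_in_subspaceT => w U'w; apply: continuous_comp (cg w U'w) _.
  apply: continuous_comp; first exact: affine_rep_continuous.
  exact: pi_continuous.
- split=> [q [q0 /hU[U'q gq]]|w /hg[U0w fw]].
    by split=> //; rewrite /g /f gq affine_coords.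
  by have [w0 affw] := affine_pointK (g0 w); split; [split; rewrite ?affw|rewrite /f affw].
- exact: fp.
- move=> q [q0 Uq]; rewrite /curve /= /f -Hf //.
  by split=> /eqP h; apply/eqP; [rewrite (meval_aff_eq0 hH)|rewrite -(meval_aff_eq0 hH)].
Qed.
End Charts.

(** * Base points *)

Lemma poly_eq_horner (K : numClosedFieldType) (p q : {poly K}) :
  (forall z, p.[z] = q.[z]) -> p = q.
Proof.
move=> pq; apply/eqP; rewrite -subr_eq0; apply/eqP/poly_eq0_off0 => z _.
by rewrite hornerD hornerN pq subrr.
Qed.

Lemma uniq_roots_separable (K : numClosedFieldType) (p : {poly K}) (s : seq K) :
  p != 0 -> (size p <= (size s).+1)%N -> uniq s -> (forall y, y \in s -> p.[y] = 0) ->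
  size p = (size s).+1 /\ forall y, p.[y] = 0 -> p^`().[y] != 0.
Proof.
move=> p0 sp us hs.
have rs : all (root p) s by apply/allP => y /hs/eqP.
have sz : size p = (size s).+1.
  by apply/eqP; rewrite eqn_leq sp (max_poly_roots p0).
split=> // y py; have pE : p = lead_coef p *: \prod_(z <- s) ('X - z%:P).
  by apply: all_roots_prod_XsubC; rewrite ?uniq_rootsE.
have l0 : lead_coef p != 0 by rewrite lead_coef_eq0.
have : separable_poly (\prod_(z <- s) ('X - z%:P)) by rewrite separable_prod_XsubC.
rewrite unlock => /Pdiv.ClosedField.coprimepP sep.
have : root (\prod_(z <- s) ('X - z%:P)) y by rewrite -(rootZ _ _ l0) -pE; apply/eqP.
move=> /sep; rewrite pE derivZ hornerZ mulf_eq0 negb_or l0.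
by rewrite /root.
Qed.

Lemma separable_roots (K : numClosedFieldType) (p : {poly K}) :
  p != 0 -> (forall y, p.[y] = 0 -> p^`().[y] != 0) ->
  exists s : seq K, [/\ uniq s, size p = (size s).+1 & forall y, (p.[y] == 0) = (y \in s)].
Proof.
move=> p0 sep; have [s pE] := closed_field_poly_normal p.
have l0 : lead_coef p != 0 by rewrite lead_coef_eq0.
have rs y : (p.[y] == 0) = (y \in s) by rewrite -rootE {1}pE rootZ // root_prod_XsubC.
exists s; split=> //.
  rewrite -separable_prod_XsubC unlock; apply/Pdiv.ClosedField.coprimepP => y.
  rewrite root_prod_XsubC -rs => /eqP/sep; rewrite {1}pE derivZ hornerZ.
  by rewrite mulf_eq0 negb_or => /andP[].
by rewrite {1}pE size_scale // size_prod_XsubC.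
Qed.

Section Fibres.
Variables (K : numClosedFieldType) (T : Type) (A : (T -> K) -> Prop).
Hypothesis A_const : forall c, A (fun=> c).
Hypothesis A_add : forall a b, A a -> A b -> A (fun t => a t + b t).
Hypothesis A_mul : forall a b, A a -> A b -> A (fun t => a t * b t).

Lemma form_at k e p x : form A k e p -> A (fun t => p t x).
Proof.
elim: k e p => [|k IH] e p.
  move=> [a Aa pa]; apply: (A_ext (a := fun t => if e == 0%N then a t else 0)).
    by move=> t; rewrite pa.
  by case: (e == 0%N).
move=> [c [hc pc]].
apply: (A_ext (a := fun t => \sum_(j < e.+1) c j t x * x k ^+ j)) => [t|]; first by rewrite pc.
apply: (A_sum A_const A_add) => j _; apply: A_mul => //.
by apply: IH; apply: hc; rewrite -ltnS.
Qed.

Lemma A_det n (M : 'I_n -> 'I_n -> T -> K) : (forall i j, A (M i j)) ->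
  A (fun t => \det (\matrix_(i, j) M i j t)).
Proof.
move=> AM; apply: (A_ext (a := fun t => \sum_(s : 'S_n) (-1) ^+ s * \prod_i M i (s i) t)).
  move=> t; apply: eq_bigr => s _; congr (_ * _); apply: eq_bigr => i _.
  by rewrite mxE.
apply: (A_sum A_const A_add) => s _; apply: A_mul => //.
elim: (index_enum _) => [|i r IH].
  by apply: (A_ext (a := fun=> 1)) => // t; rewrite big_nil.
by apply: A_ext (A_mul (AM i (s i)) IH) => t; rewrite big_cons.
Qed.

Lemma A_det_syl d e (p q : T -> {poly K}) : (forall j, A (fun t => (p t)`_j)) ->
  (forall j, A (fun t => (q t)`_j)) -> A (fun t => \det (syl d e (p t) (q t))).
Proof.
move=> Ap Aq; apply: A_det => i j; case: (ltnP i e) => ie.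
  have [ji|ij] := ltnP j i; first by apply: A_ext (A_const 0) => t; rewrite coefXnM ji.
  by apply: A_ext (Ap (j - i)%N) => t; rewrite coefXnM ltnNge ij.
have [ji|ij] := ltnP j (i - e); first by apply: A_ext (A_const 0) => t; rewrite coefXnM ji.
by apply: A_ext (Aq (j - (i - e))%N) => t; rewrite coefXnM ltnNge ij.
Qed.

Definition slice (P : {mpoly K[3]}) (a b : K) : {poly K} :=
  mmap (@polyC K) (vec a%:P b%:P 'X) P.

Lemma sliceE P a b z : (slice P a b).[z] = meval (vec a b z) P.
Proof.
rewrite /slice horner_mmap /meval /mmap; apply: eq_bigr => m _.
rewrite /= /horner_eval hornerC; congr (_ * _); apply: eq_bigr => i _; congr (_ ^+ _).
by rewrite /vec; case: i => -[|[|[|//]]] i3 /=; rewrite ?hornerC ?hornerX.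
Qed.

Lemma hfam_slice d (p : T -> {mpoly K[3]}) : hfam A d p ->
  (forall j, (j <= d)%N -> form A 2 (d - j) (fun t x => (slice (p t) (x 0%N) (x 1%N))`_j)) /\
  (forall t a b, (size (slice (p t) a b) <= d.+1)%N).
Proof.
move=> /(hfam_form A_const A_add A_mul)/form_coefs[c [hc sc pc]].
have cE t (x : nat -> K) : slice (p t) (x 0%N) (x 1%N) = c t x.
  apply: poly_eq_horner => z; rewrite sliceE.
  transitivity (c t (put 2 x z)).[z].
    rewrite -[X in _.[X]]/(put 2 x z 2%N) -pc; apply: meval_eq => i.
    by rewrite /vec /put; case: i => -[|[|[|//]]].
  congr _.[_]; apply/polyP => j; have [jd|jd] := leqP j d; first exact: form_put (hc j jd).
  by rewrite !nth_default // (leq_trans (sc _ _)).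
split=> [j jd|t a b]; first by apply: eq_form (hc j jd) => t x; rewrite cE.
by rewrite -[a]/(nth 0 [:: a; b] 0) -[b in slice _ _ b]/(nth 0 [:: a; b] 1)
  (cE t (nth 0 [:: a; b])) sc.
Qed.

(** The top coefficient in the last variable is a form of degree 0 in the others, so it does not
    depend on [a] and [b]. *)
Lemma hfam_slice_lead d (p : T -> {mpoly K[3]}) t a b : hfam A d p ->
  (slice (p t) a b)`_d = meval (vec 0 0 1) (p t).
Proof.
move=> hp; have [hc sc] := hfam_slice hp.
have := hc d (leqnn d); rewrite subnn => /form_eval_deg0[l _ hl].
have lE a' b' : (slice (p t) a' b')`_d = l t by apply: (hl t (nth 0 [:: a'; b'])).
rewrite -sliceE lE -(lE 0 0) (horner_coef_wide _ (sc t 0 0)) (bigD1 ord_max) //=.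
rewrite expr1n mulr1 big1 ?addr0 // => j jd.
have jd' : (j < d)%N by rewrite ltn_neqAle -ltnS ltn_ord andbT.
rewrite (form_origin (x := fun=> 0) t (hc j (ltnW jd'))) ?mul0r //.
by rewrite subn_gt0.
Qed.

Variables (M N : nat) (F G : T -> {mpoly K[3]}).
Hypotheses (M1 : (1 < M)%N) (N1 : (1 < N)%N) (hF : hfam A M F) (hG : hfam A N G).
Let D := (M * N)%N.

Definition eliminant (P Q : {mpoly K[3]}) a b : K := \det (syl M N (slice P a b) (slice Q a b)).

(** The resultant is a binary form of degree D = M N in (a, b). [rho] is its restriction to a = 1,
    and at a = 0 only the term in b^D survives. *)
Lemma eliminant_polynomial : exists rho : T -> {poly K},
  [/\ forall j, A (fun t => (rho t)`_j), forall t, (size (rho t) <= D.+1)%N,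
      forall t y, (rho t).[y] = eliminant (F t) (G t) 1 y &
      forall t y, eliminant (F t) (G t) 0 y = (rho t)`_D * y ^+ D].
Proof.
have [hcF scF] := hfam_slice hF; have [hcG scG] := hfam_slice hG.
have := form_det_syl A_const A_add A_mul hcF (fun t x => scF t _ _) hcG (fun t x => scG t _ _).
move=> /form_coefs[c [hc sc pc]].
have cE t x y : (forall j, (j < 1)%N -> x j = y j) -> c t x = c t y.
  move=> xy; apply/polyP => j; have [jd|jd] := leqP j D; first exact: form_supp (hc j jd) xy.
  by rewrite !nth_default // (leq_trans (sc _ _)).
exists (fun t => c t (fun=> 1)); split=> //.
- move=> j; have [jd|jd] := leqP j D; first exact: form_at (hc j jd).
  by apply: A_ext (A_const 0) => t; rewrite nth_default // (leq_trans (sc _ _)).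
- by move=> t y; rewrite /eliminant (pc t (nth 0 [:: 1; y])) (cE t _ (fun=> 1)) // => -[].
- move=> t y; rewrite /eliminant (pc t (nth 0 [:: 0; y])) (horner_coef_wide _ (sc _ _)).
  rewrite big_ord_recr /= big1 ?add0r.
    have := hc D (leqnn D); rewrite subnn => /form_eval_deg0[l _ hl].
    by rewrite !hl.
  move=> j _; rewrite (form_origin t (hc j (ltnW (ltn_ord j)))) ?mul0r ?subn_gt0 //.
  by case.
Qed.

(** The slices over a = 1 with y kept as a variable, so that divisibility of the resultant in K[y]
    makes sense. *)
Definition slice2 (P : {mpoly K[3]}) : {poly {poly K}} :=
  mmap (polyC \o @polyC K) (vec 1 ('X)%:P 'X) P.

Lemma map_slice2 P y : map_poly (horner_eval y) (slice2 P) = slice P 1 y.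
Proof.
rewrite /slice2 /slice /mmap rmorph_sum /=; apply: eq_bigr => m _.
rewrite rmorphM /= map_polyC /= /horner_eval hornerC; congr (_ * _).
rewrite /mmap1 (rmorph_prod (map_poly (horner_eval y))); apply: eq_bigr => i _.
rewrite rmorphXn; congr (_ ^+ _).
rewrite /vec; case: i => -[|[|[|//]]] i3 /=.
- by rewrite rmorph1.
- by rewrite map_polyC /= /horner_eval hornerX.
- by rewrite map_polyX.
Qed.

Lemma det_slice2 P Q y :
  (\det (syl M N (slice2 P) (slice2 Q))).[y] = eliminant P Q 1 y.
Proof. by rewrite -[LHS]/(horner_eval y _) -det_map_mx map_syl !map_slice2. Qed.

Lemma size_slice2 d t (p : T -> {mpoly K[3]}) : hfam A d p -> (size (slice2 (p t)) <= d.+1)%N.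
Proof.
move=> /hfam_slice[_ sc]; apply/leq_sizeP => j dj; apply: poly_eq_horner => y.
rewrite horner0 -[LHS]/(horner_eval y _) -coef_map map_slice2 nth_default //.
exact: leq_trans (sc _ _ _) dj.
Qed.

(** A value at (0 : 0 : 1) other than zero gives the slice of F its full degree M, as [det_syl_neq0]
    requires. *)
Lemma common_zeroP t a b : meval (vec 0 0 1) (F t) != 0 ->
  (eliminant (F t) (G t) a b = 0) <->
  (exists z, meval (vec a b z) (F t) = 0 /\ meval (vec a b z) (G t) = 0).
Proof.
have [[_ sF] [_ sG]] := (hfam_slice hF, hfam_slice hG).
move=> l0; split=> [E0|[z [Fz Gz]]]; last first.
  by apply: (@det_syl_root _ _ _ _ _ z); rewrite ?sliceE // addn_gt0 ltnW.
have sF' : size (slice (F t) a b) = M.+1.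
  apply/eqP; rewrite eqn_leq sF ltnNge; apply: contra l0 => sz.
  by rewrite -(hfam_slice_lead t a b hF) nth_default.
apply: contrapT => nz; move/eqP: E0; apply/negP; apply: det_syl_neq0 => // z.
by rewrite !sliceE => Fz; apply/eqP => Gz; apply: nz; exists z.
Qed.

Variable rho : T -> {poly K}.
Hypotheses (rho_size : forall t, (size (rho t) <= D.+1)%N)
  (rhoE : forall t y, (rho t).[y] = eliminant (F t) (G t) 1 y)
  (rho_infty : forall t y, eliminant (F t) (G t) 0 y = (rho t)`_D * y ^+ D).

(** Nonzero exactly when F avoids the centre of projection (0 : 0 : 1) and [rho t] has degree D with
    simple roots only; the nominal degrees D and D - 1 also detect a drop of the degree. *)
Definition base_discriminant t :=
  meval (vec 0 0 1) (F t) * \det (syl D D.-1 (rho t) (rho t)^`()).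

Lemma D_gt1 : (1 < D)%N.
Proof. by rewrite (leq_trans M1) // leq_pmulr // ltnW. Qed.

Lemma size_deriv_rho t : (size (rho t)^`() <= D.-1.+1)%N.
Proof.
apply: leq_trans (size_poly _ _) _; rewrite prednK ?(ltnW D_gt1) //.
by have := rho_size t; case: (size (rho t)).
Qed.

(** The empty fibre over [y1] shows that [rho t] is not zero; its D distinct roots then fill the
    degree and are simple. *)
Lemma base_discriminant_neq0 t s y1 : meval (vec 0 0 1) (F t) != 0 ->
  uniq s -> size s = D ->
  (forall y, y \in s -> exists z, meval (vec 1 y z) (F t) = 0 /\ meval (vec 1 y z) (G t) = 0) ->
  (forall z, meval (vec 1 y1 z) (F t) = 0 -> meval (vec 1 y1 z) (G t) != 0) ->
  base_discriminant t != 0.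
Proof.
move=> l0 us sD hs hy1; rewrite mulf_neq0 //.
have rho0 : rho t != 0.
  apply/eqP => rho0; have : eliminant (F t) (G t) 1 y1 = 0 by rewrite -rhoE rho0 horner0.
  by move=> /(common_zeroP _ _ l0)[z [/hy1/eqP]].
have [||sz sep] := uniq_roots_separable rho0 _ us; first by rewrite sD.
  by move=> y ys; rewrite rhoE; apply/common_zeroP => //; apply: hs.
by apply: det_syl_neq0; rewrite ?sz ?sD ?size_deriv_rho.
Qed.

(** Two base points over one [y] would make [y] a double root of [rho t], so the last coordinate is
    a function [h] of [y]. On v 0 = 0 the nonzero top coefficient forces v 1 = 0, and the remaining
    point (0 : 0 : 1) is not on F. *)
Lemma base_points t : base_discriminant t != 0 -> exists (s : seq K) (h : K -> K),
  [/\ uniq s, size s = D, forall y, ((rho t).[y] == 0) = (y \in s) &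
      forall v : 'I_3 -> K, (exists i, v i != 0) ->
      (meval v (F t) = 0 /\ meval v (G t) = 0) <->
      [/\ v 0 != 0, v 1 / v 0 \in s & v ord_max / v 0 = h (v 1 / v 0)]].
Proof.
rewrite mulf_eq0 negb_or => /andP[l0 disc].
have D0 := ltnW D_gt1; have D1 := D_gt1.
have rhoD : (rho t)`_D != 0.
  have [||//|] := det_syl_lead _ _ (rho_size t) (size_deriv_rho t) disc => //; first by lia.
  by rewrite coef_deriv prednK // mulrn_eq0 negb_or => /andP[].
have rho0 : rho t != 0 by apply: contraNneq rhoD => ->; rewrite coef0.
have sep y : (rho t).[y] = 0 -> (rho t)^`().[y] != 0.
  move=> ry; apply: contra disc => /eqP r'y.
  by apply/eqP/(det_syl_root _ (rho_size t) (size_deriv_rho t) ry r'y); rewrite addn_gt0 D0 orbT.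
have [s [us sz hs]] := separable_roots rho0 sep.
have sD : size s = D.
  apply/eqP; rewrite -eqSS -sz eqn_leq rho_size ltnNge; apply: contra rhoD => sz'.
  by rewrite nth_default.
pose cz y z := meval (vec 1 y z) (F t) = 0 /\ meval (vec 1 y z) (G t) = 0.
pose h y := xget 0 [set z | cz y z]%classic.
have hP y : y \in s -> cz y (h y).
  rewrite -hs rhoE => /eqP/(common_zeroP _ _ l0)[z zP].
  exact: (@xgetI _ 0 [set z | cz y z]%classic z zP).
have cz_s y z : cz y z -> y \in s.
  by move=> czy; rewrite -hs rhoE; apply/eqP/common_zeroP => //; exists z.
have inj y z1 z2 : cz y z1 -> cz y z2 -> z1 = z2.
  move=> c1 c2; apply/eqP/negPn/negP => z12.
  have ys := cz_s _ _ c1; have /eqP ry : (rho t).[y] == 0 by rewrite hs.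
  have rE : rho t = \det (syl M N (slice2 (F t)) (slice2 (G t))).
    by apply: poly_eq_horner => y'; rewrite rhoE det_slice2.
  have : ('X - y%:P) ^+ 2 %| rho t.
    rewrite rE; apply: (dvdp_det_syl (a := z1) (b := z2)) => //.
    - by rewrite (leq_trans M1) // leq_addl.
    - exact: size_slice2.
    - exact: size_slice2.
    - by move=> c [->|->]; rewrite !map_slice2 !sliceE.
  move=> /dvdpP[q qE]; have /eqP[] := sep y ry.
  by rewrite qE expr2 !derivM !derivXsubC !hornerE /= subrr !(mulr0, mul0r, addr0) /=; ring.
exists s, h; split=> // v [i vi].
have scale (P : {mpoly K[3]}) d : P \is d.-homog -> v 0 != 0 ->
    (meval (vec 1 (v 1 / v 0) (v ord_max / v 0)) P = 0 <-> meval v P = 0).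
  move=> homP v0; have -> : meval v P = v 0 ^+ d * meval (vec 1 (v 1 / v 0) (v ord_max / v 0)) P.
    rewrite -meval_homog //; apply: meval_eq => j.
    rewrite /vec; case: j => -[|[|[|//]]] j3 /=; rewrite ?mulr1 ?[_ * (_ / _)]mulrC ?divfK //;
      by congr v; apply/val_inj.
  by split=> [->|/eqP]; rewrite ?mulr0 // mulf_eq0 expf_eq0 (negPf v0) andbF => /eqP.
split=> [[Fv Gv]|[v0 vs vh]]; last first.
  by have [Fz Gz] := hP _ vs; rewrite -vh in Fz Gz; split; apply/scale;
    [exact: (proj1 hF t)| |exact: Fz|exact: (proj1 hG t)| |].
have v0 : v 0 != 0.
  apply/eqP => v0; have vE : v =1 vec 0 (v 1) (v ord_max).
    by move=> j; rewrite /vec; case: j => -[|[|[|//]]] j3 /=; rewrite -?v0; congr v; apply/val_inj.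
  have E0 : eliminant (F t) (G t) 0 (v 1) = 0.
    by apply/common_zeroP => //; exists (v ord_max); rewrite -!(meval_eq _ vE).
  move/eqP: E0; rewrite rho_infty mulf_eq0 (negPf rhoD) /= expf_eq0 D0 /= => /eqP v1.
  have v2 : v ord_max != 0.
    by move: vi; rewrite vE /vec; case: i => -[|[|[|//]]] i3 /=; rewrite ?v1 ?eqxx.
  move/eqP: Fv; rewrite (meval_eq _ vE) v1.
  have -> : meval (vec 0 0 (v ord_max)) (F t) = v ord_max ^+ M * meval (vec 0 0 1) (F t).
    rewrite -meval_homog; last exact: (proj1 hF t).
    by apply: meval_eq => j; rewrite /vec; case: j => -[|[|[|//]]] j3 /=; rewrite ?mulr0 ?mulr1.
  by rewrite mulf_eq0 (negPf l0) orbF expf_eq0 (negPf v2) andbF.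
have czv : cz (v 1 / v 0) (v ord_max / v 0).
  by split; apply/scale => //; [exact: (proj1 hF t)|exact: (proj1 hG t)].
by split=> //; [apply: cz_s czv|apply: inj czv (hP _ (cz_s _ _ czv))].
Qed.

End Fibres.

(** * Polynomials in the coefficients *)

Lemma meval_mmap (R : comNzRingType) k l (v : 'I_l -> R) (h : 'I_k -> {mpoly R[l]})
    (P : {mpoly R[k]}) :
  meval v (mmap (@mpolyC l R) h P) = meval (fun i => meval v (h i)) P.
Proof.
rewrite /mmap raddf_sum; apply: eq_bigr => m _; rewrite /= mevalM mevalC; congr (_ * _).
by rewrite /mmap1 rmorph_prod; apply: eq_bigr => i _; rewrite rmorphXn.
Qed.

Section CoefficientPolynomials.
Variables (K : numClosedFieldType) (k : nat).
Local Notation T := (k.-tuple {mpoly K[3]}).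
Implicit Types f g : T -> K.

Lemma coef_polynomial_const c : coef_polynomial (fun _ : T => c).
Proof.
exists 0%N, (fun i : 'I_0 => match i with Ordinal _ lt0 => False_rect _ (notF lt0) end).
exists (@mpolyC 0 K c).
by move=> t; rewrite mevalC.
Qed.

Lemma coef_polynomial_coef i m : coef_polynomial (fun t : T => mcoeff m (tnth t i)).
Proof.
by exists 1%N, (fun=> (i, m)), (@mpolyX 1 K (mnm1 0)) => t; rewrite mevalXU.
Qed.

Lemma coef_polynomial2 f g : coef_polynomial f -> coef_polynomial g ->
  exists N (x : 'I_N -> 'I_k * multinom 3) (P Q : {mpoly K[N]}), forall t,
    f t = meval (fun j => mcoeff (x j).2 (tnth t (x j).1)) P /\
    g t = meval (fun j => mcoeff (x j).2 (tnth t (x j).1)) Q.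
Proof.
move=> [N1 [x1 [P fP]]] [N2 [x2 [Q gQ]]].
exists (N1 + N2)%N, (fun i => match fintype.split i with inl j => x1 j | inr j => x2 j end).
exists (mmap (@mpolyC _ K) (fun i => @mpolyX _ K (mnm1 (lshift N2 i))) P).
exists (mmap (@mpolyC _ K) (fun i => @mpolyX _ K (mnm1 (rshift N1 i))) Q).
move=> t; rewrite !meval_mmap fP gQ; split; apply: meval_eq => i; rewrite mevalXU.
  by rewrite (unsplitK (inl _)).
by rewrite (unsplitK (inr _)).
Qed.

Lemma coef_polynomialD f g : coef_polynomial f -> coef_polynomial g ->
  coef_polynomial (fun t => f t + g t).
Proof.
move=> cf cg; have [N [x [P [Q fg]]]] := coef_polynomial2 cf cg.
by exists N, x, (P + Q) => t; rewrite mevalD; have [-> ->] := fg t.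
Qed.

Lemma coef_polynomialM f g : coef_polynomial f -> coef_polynomial g ->
  coef_polynomial (fun t => f t * g t).
Proof.
move=> cf cg; have [N [x [P [Q fg]]]] := coef_polynomial2 cf cg.
by exists N, x, (P * Q) => t; rewrite mevalM; have [-> ->] := fg t.
Qed.

Definition line (t u : T) (s : K) : T := [tuple tnth t i + s *: (tnth u i - tnth t i) | i < k].

Lemma line0 t u : line t u 0 = t.
Proof. by apply: eq_from_tnth => i; rewrite tnth_mktuple scale0r addr0. Qed.

Lemma line1 t u : line t u 1 = u.
Proof. by apply: eq_from_tnth => i; rewrite tnth_mktuple scale1r addrC subrK. Qed.

Lemma line_homog ds t u s : homog_tuples ds t -> homog_tuples ds u ->
  homog_tuples ds (line t u s).
Proof.
by move=> ht hu i; rewrite tnth_mktuple rpredD ?rpredZ ?rpredB ?ht ?hu.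
Qed.

(** Reduces the search for generic tuples to avoiding the roots of a polynomial in one variable. *)
Lemma coef_polynomial_line f t u : coef_polynomial f ->
  exists q : {poly K}, forall s, f (line t u s) = q.[s].
Proof.
move=> [N [x [Q fQ]]].
pose h j : {poly K} := (mcoeff (x j).2 (tnth t (x j).1))%:P +
  (mcoeff (x j).2 (tnth u (x j).1 - tnth t (x j).1))%:P * 'X.
exists (mmap (@polyC K) h Q) => s; rewrite fQ horner_mmap /meval /mmap.
apply: eq_bigr => m _; rewrite /= /horner_eval hornerC; congr (_ * _).
apply: eq_bigr => i _; congr (_ ^+ _).
by rewrite /h !hornerE tnth_mktuple mcoeffD mcoeffZ mulrC.
Qed.

Lemma mcoeff_pihomog d m (P : {mpoly K[3]}) :
  mcoeff m (pihomog mdeg d P) = if mdeg m == d then mcoeff m P else 0.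
Proof.
case: eqP => [<-|/eqP md]; last exact: dhomog_nemf_coeff (pihomogP _ _ _) md.
have md' : (mdeg m < maxn (msize P) (mdeg m).+1)%N by rewrite leq_maxr.
transitivity (mcoeff m (\sum_(i < maxn (msize P) (mdeg m).+1) pihomog mdeg i P)); last first.
  by rewrite -pihomog_partitionE // leq_maxl.
rewrite [RHS]raddf_sum (bigD1 (Ordinal md')) //= big1 ?addr0 // => i ni.
apply: dhomog_nemf_coeff (pihomogP _ _ _) _; apply: contra ni => /eqP mi.
by apply/eqP/val_inj.
Qed.

Lemma hfam_pihomog d i : hfam (@coef_polynomial K k) d (fun t => pihomog mdeg d (tnth t i)).
Proof.
split=> [t|m]; first exact: pihomogP.
have [md|md] := eqVneq (mdeg m) d.
  apply: (A_ext (a := fun t => mcoeff m (tnth t i))); last exact: coef_polynomial_coef.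
  by move=> t; rewrite mcoeff_pihomog md eqxx.
apply: (A_ext (a := fun=> 0)); last exact: coef_polynomial_const.
by move=> t; rewrite mcoeff_pihomog (negPf md).
Qed.

Lemma basic_zariski_open (ds : k.-tuple nat) f : coef_polynomial f ->
  zariski_open ds (homog_tuples ds `&` [set t | f t != 0]).
Proof.
move=> cf; exists [set f] => [_ -> //|]; congr (_ `&` _).
by apply/seteqP; split=> t /= => [ft|[_ ->]//]; exists f.
Qed.

End CoefficientPolynomials.

(** * Reality *)

Lemma horner_pos_near0 (R : realFieldType) (p : {poly R}) : 0 < p.[0] ->
  exists2 eta, 0 < eta & forall x, 0 <= x -> x < eta -> 0 < p.[x].
Proof.
move=> p0; have : root (p - p.[0]%:P) 0 by rewrite /root !hornerE subrr.
move=> /factor_theorem[q qE].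
have pE x : p.[x] = p.[0] + q.[x] * x.
  have := congr1 (fun p : {poly R} => p.[x]) qE.
  by rewrite /= !hornerE subr0 => <-; rewrite addrC subrK.
pose B := \sum_(i < size q) `|q`_i|.
have B0 : 0 <= B by apply: sumr_ge0.
have qB x : 0 <= x -> x <= 1 -> `|q.[x]| <= B.
  move=> x0 x1; rewrite horner_coef (le_trans (ler_norm_sum _ _ _)) //.
  apply: ler_sum => i _; rewrite normrM ler_piMr // normrX ger0_norm //.
  exact: exprn_ile1.
have B1 : 0 < B + 1 by rewrite ltr_wpDl.
exists (Num.min 1 (p.[0] / (B + 1))); first by rewrite lt_min ltr01 divr_gt0.
move=> x x0; rewrite lt_min => /andP[x1 xB]; rewrite pE.
have : `|q.[x] * x| < p.[0].
  rewrite normrM [`|x|]ger0_norm // (@le_lt_trans _ _ (B * x)) //.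
    by rewrite ler_wpM2r // qB // ltW.
  move: xB; rewrite ltr_pdivlMr //; apply: le_lt_trans.
  by rewrite mulrDr mulr1 mulrC lerDl.
by rewrite ltr_norml => /andP[]; lra.
Qed.

Lemma horner_pos_near0_seq (R : realFieldType) (I : eqType) (r : seq I) (p : I -> {poly R}) :
  (forall i, i \in r -> 0 < (p i).[0]) ->
  exists2 eta, 0 < eta & forall i x, i \in r -> 0 <= x -> x < eta -> 0 < (p i).[x].
Proof.
elim: r => [|i r IH] h; first by exists 1.
have [j jr|e e0 he] := IH; first by apply: h; rewrite inE jr orbT.
have [d d0 hd] := horner_pos_near0 (h i (mem_head _ _)).
exists (Num.min d e); first by rewrite lt_min d0.
move=> j x; rewrite inE lt_min => /predU1P[->|jr] x0 /andP[xd xe]; first exact: hd.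
exact: he.
Qed.

Lemma ivt_sign_change (R : rcfType) (p : {poly R}) a b : a <= b -> p.[a] * p.[b] < 0 ->
  exists2 x, a <= x <= b & p.[x] = 0.
Proof.
move=> ab; wlog pa : p / p.[a] < 0 => [hwlog pab|pab].
  have [pa|pa|pa0] := ltgtP p.[a] 0; first exact: hwlog pa pab.
    have [||x xab] := hwlog (- p); rewrite ?hornerN ?oppr_lt0 ?mulrNN //.
    by move/eqP; rewrite oppr_eq0 => /eqP; exists x.
  by move: pab; rewrite pa0 mul0r ltxx.
have pb : 0 < p.[b] by move: pab; rewrite nmulr_rlt0.
have [|x xab /rootP px] := @poly_ivt _ p a b ab; last by exists x.
by rewrite !ltW.
Qed.

(* Around each simple root y, the sign change between y - delta and y + delta
   persists for small s. *)
Lemma real_roots_persist (R : rcfType) (p : R -> {poly R}) (ys : seq R) :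
    (forall y, exists w : {poly R}, forall s, (p s).[y] = w.[s]) ->
    uniq ys -> (forall y, y \in ys -> (p 0).[y] = 0 /\ (p 0)^`().[y] != 0) ->
  exists2 eta, 0 < eta & forall s, 0 <= s -> s < eta ->
    exists zs, [/\ uniq zs, size zs = size ys & forall z, z \in zs -> (p s).[z] = 0].
Proof.
move=> hw us simple.
have [q qE] : exists q : R -> {poly R}, forall y, y \in ys -> p 0 = q y * ('X - y%:P).
  have ex y : exists q, y \in ys -> p 0 = q * ('X - y%:P).
    have [ys_y|] := boolP (y \in ys); last by exists 0.
    by have [/rootP/factor_theorem[q qE] _] := simple y ys_y; exists q.
  by have [q qE] := boolp.choice ex; exists q.
have q_neq0 y : y \in ys -> (q y).[y] != 0.
  move=> yys; have [_] := simple y yys; rewrite (qE y yys) derivM derivXsubC.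
  by rewrite hornerD !hornerM hornerXsubC subrr mulr0 add0r hornerC mulr1.
(* The product of the values of [p 0] at y - d and y + d is - d^2 times the value of [g y] at d, and
   at 0 the latter is a nonzero square: a sign change for small d > 0. *)
pose g y := (q y \Po (y%:P + 'X)) * (q y \Po (y%:P - 'X)).
have gE y d : (g y).[d] = (q y).[y + d] * (q y).[y - d].
  by rewrite hornerM !horner_comp !hornerE.
have [|d1 d10 h1] := @horner_pos_near0_seq R R ys g.
  move=> y yys; rewrite gE addr0 subr0 -expr2 lt_neqAle sqr_ge0 andbT eq_sym.
  by rewrite sqrf_eq0 q_neq0.
pose r := [seq yz <- [seq (y, z) | y <- ys, z <- ys] | yz.1 != yz.2].
(* Positive at d when the intervals of radius d around the two distinct roots are disjoint, which
   keeps the new roots distinct. *)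
pose h (yz : R * R) : {poly R} := ((yz.1 - yz.2) ^+ 2)%:P - 4%:P * 'X^2.
have [|d2 d20 h2] := @horner_pos_near0_seq R (R * R)%type r h.
  move=> [y z]; rewrite mem_filter /= => /andP[yz _].
  rewrite /h hornerD hornerN hornerM hornerXn !hornerC expr0n /= mulr0 subr0.
  by rewrite lt_neqAle sqr_ge0 andbT eq_sym sqrf_eq0 subr_eq0.
pose d := Num.min d1 d2 / 2.
have m0 : 0 < Num.min d1 d2 by rewrite lt_min d10.
have d0 : 0 < d by rewrite divr_gt0.
have dm : d < Num.min d1 d2 by rewrite /d; lra.
have [dd1 dd2] : d < d1 /\ d < d2 by apply/andP; rewrite -lt_min.
have sep y z : y \in ys -> z \in ys -> y != z -> 2 * d < `|y - z|.
  move=> yys zys yz; have := h2 (y, z) d _ (ltW d0) dd2.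
  rewrite mem_filter /= yz (allpairs_f pair yys zys) => /(_ isT).
  rewrite /h hornerD hornerN hornerM hornerXn !hornerC /= subr_gt0 => sq.
  move: sq; rewrite -(real_normK (num_real (y - z))) ltNge; apply: contraNlt => le_yz.
  have yz0 := normr_ge0 (y - z); move: (`|y - z|) le_yz yz0 => u *; nra.
have [w hw'] := boolp.choice hw.
(* Now d is fixed and the variable is [s]: the values of [p s] at y - d and y + d are polynomials in
   [s], with opposite signs at s = 0. *)
have [|e e0 he] := @horner_pos_near0_seq R R ys (fun y => - (w (y - d) * w (y + d))).
  move=> y yys; rewrite hornerN hornerM -!hw' (qE y yys) !hornerM !hornerXsubC.
  rewrite (_ : - (_ * _) = d ^+ 2 * (g y).[d]); last by rewrite gE; ring.
  by rewrite mulr_gt0 ?exprn_gt0 ?h1 // ltW.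
exists e => // s s0 se.
have root_near y : y \in ys -> exists2 z, y - d <= z <= y + d & (p s).[z] = 0.
  move=> yys; apply: ivt_sign_change; first lra.
  by have := he y s yys s0 se; rewrite hornerN hornerM -!hw' oppr_gt0.
have ex y : exists z, y \in ys -> y - d <= z <= y + d /\ (p s).[z] = 0.
  by have [/root_near[z]|] := boolP (y \in ys); [exists z|exists 0].
have [z zP] := boolp.choice ex.
exists (map z ys); split; rewrite ?size_map //; last first.
  by move=> _ /mapP[y yys ->]; have [] := zP y yys.
rewrite map_inj_in_uniq // => y1 y2 y1s y2s z12; apply/eqP/negPn/negP => y12.
have := sep _ _ y1s y2s y12; have [/andP[a1 a2] _] := zP _ y1s; have [/andP[b1 b2] _] := zP _ y2s.
rewrite ltNge ler_norml => /negP[]; rewrite z12 in a1 a2.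
by apply/andP; split; lra.
Qed.

(** * Real polynomials and the grids *)

Section RealPolynomials.
Variable K : numClosedFieldType.
Local Notation XX i := (@mpolyX 3 K (mnm1 i)).

Definition real_mpoly (P : {mpoly K[3]}) := forall m, mcoeff m P \is Num.real.

Lemma real_mpolyC c : c \is Num.real -> real_mpoly (@mpolyC 3 K c).
Proof. by move=> cr m; rewrite mcoeffC rpredM // realn. Qed.

Lemma real_mpoly1 : real_mpoly 1.
Proof. by rewrite -mpolyC1; apply: real_mpolyC; rewrite rpred1. Qed.

Lemma real_mpolyX i : real_mpoly (XX i).
Proof. by move=> m; rewrite mcoeffX realn. Qed.

Lemma real_mpolyD P Q : real_mpoly P -> real_mpoly Q -> real_mpoly (P + Q).
Proof. by move=> hP hQ m; rewrite mcoeffD rpredD. Qed.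

Lemma real_mpolyM P Q : real_mpoly P -> real_mpoly Q -> real_mpoly (P * Q).
Proof. by move=> hP hQ m; rewrite mcoeffM rpred_sum // => k _; rewrite rpredM. Qed.

Lemma real_mpolyZ c P : c \is Num.real -> real_mpoly P -> real_mpoly (c *: P).
Proof. by move=> cr hP m; rewrite mcoeffZ rpredM. Qed.

Lemma real_mpolyB P Q : real_mpoly P -> real_mpoly Q -> real_mpoly (P - Q).
Proof. by move=> hP hQ m; rewrite mcoeffB rpredB. Qed.

Lemma real_mpolyXn P e : real_mpoly P -> real_mpoly (P ^+ e).
Proof.
move=> hP; elim: e => [|e IH]; first exact: real_mpoly1.
by rewrite exprS; apply: real_mpolyM.
Qed.

Lemma real_mpoly_prod I (r : seq I) (P : I -> {mpoly K[3]}) :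
  (forall i, real_mpoly (P i)) -> real_mpoly (\prod_(i <- r) P i).
Proof.
move=> hP; elim/big_ind: _ => // [|p q]; first exact: real_mpoly1.
exact: real_mpolyM.
Qed.

Lemma real_pencil m n F G (L1 L2 : {mpoly K[3]}) : real_mpoly F -> real_mpoly G ->
  real_mpoly L1 -> real_mpoly L2 -> real_mpoly (pencil m n F G L1 L2).
Proof.
by move=> *; apply: real_mpolyD; apply: real_mpolyM => //; apply: real_mpolyXn.
Qed.

Lemma conj_meval P (v : 'I_3 -> K) : real_mpoly P ->
  (meval v P)^* = meval (fun i => (v i)^*) P.
Proof.
move=> hP; rewrite !mevalE rmorph_sum; apply: eq_bigr => m _ /=.
rewrite rmorphM /= (CrealP (hP m)) rmorph_prod; congr (_ * _).
by apply: eq_bigr => i _; rewrite rmorphXn.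
Qed.

Lemma conj_horner (p : {poly K}) z : (map_poly Num.conj p).[z] = (p.[z^*])^*.
Proof. by rewrite -[in LHS](conjCK z) horner_map. Qed.

Lemma conj_vec a b c : (fun i => (vec a b c i)^*) =1 vec a^* b^* c^* :> ('I_3 -> K).
Proof. by move=> i; rewrite /vec; case: i => -[|[|[|//]]]. Qed.

Lemma conj_eliminant M N P Q a b : real_mpoly P -> real_mpoly Q ->
  (eliminant M N P Q a b)^* = eliminant M N P Q a^* b^*.
Proof.
move=> hP hQ; have slice_conj S : real_mpoly S -> map_poly Num.conj (slice S a b) = slice S a^* b^*.
  move=> hS; apply: poly_eq_horner => z.
  by rewrite conj_horner !sliceE conj_meval // (meval_eq _ (conj_vec _ _ _)) conjCK.
by rewrite /eliminant -det_map_mx map_syl !slice_conj.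
Qed.

Lemma real_eliminant_poly M N P Q (rho : {poly K}) : real_mpoly P -> real_mpoly Q ->
  (forall y, rho.[y] = eliminant M N P Q 1 y) -> forall j, rho`_j \is Num.real.
Proof.
move=> hP hQ rhoE j; apply/CrealP; rewrite -coef_map.
rewrite (_ : map_poly _ rho = rho) //; apply: poly_eq_horner => z.
by rewrite conj_horner !rhoE conj_eliminant // conjC1 conjCK.
Qed.

Lemma real_line k (t u : k.-tuple {mpoly K[3]}) s : s \is Num.real ->
  (forall i, real_mpoly (tnth t i)) -> (forall i, real_mpoly (tnth u i)) ->
  forall i, real_mpoly (tnth (line t u s) i).
Proof.
move=> sr ht hu i; rewrite tnth_mktuple; apply: real_mpolyD => //.
by apply: real_mpolyZ => //; apply: real_mpolyB.
Qed.

Lemma real_pihomog d P : real_mpoly P -> real_mpoly (pihomog mdeg d P).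
Proof. by move=> hP m; rewrite mcoeff_pihomog; case: ifP => _; rewrite ?rpred0. Qed.

(* M N real lines meeting in the points (1 : 2^(i + M j) : 2^i). *)
Definition grid1 M : {mpoly K[3]} := \prod_(i < M) ((2 ^+ i) *: XX 0 - XX ord_max).
Definition grid2 M N : {mpoly K[3]} := \prod_(j < N) (XX 1 - (2 ^+ (M * j)) *: XX ord_max).

Lemma homog_prod_lines d (L : nat -> {mpoly K[3]}) : (forall i, L i \is 1.-homog) ->
  \prod_(i < d) L i \is d.-homog.
Proof.
move=> hL; elim: d => [|d IH]; first by rewrite big_ord0 dhomog1.
by rewrite big_ord_recr /=; have := dhomogM IH (hL d); rewrite addn1.
Qed.

Lemma homog_grid1 M : grid1 M \is M.-homog.
Proof.
apply: (@homog_prod_lines _ (fun i => (2 ^+ i) *: XX 0 - XX ord_max)) => i.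
by rewrite rpredB ?rpredZ ?homogXX.
Qed.

Lemma homog_grid2 M N : grid2 M N \is N.-homog.
Proof.
apply: (@homog_prod_lines _ (fun j => XX 1 - (2 ^+ (M * j)) *: XX ord_max)) => j.
by rewrite rpredB ?rpredZ ?homogXX.
Qed.

Lemma real_pow2 i : (2 : K) ^+ i \is Num.real.
Proof. by rewrite rpredX // realn. Qed.

Lemma real_grid1 M : real_mpoly (grid1 M).
Proof.
apply: real_mpoly_prod => i; apply: real_mpolyB; last exact: real_mpolyX.
by apply: real_mpolyZ; [apply: real_pow2|apply: real_mpolyX].
Qed.

Lemma real_grid2 M N : real_mpoly (grid2 M N).
Proof.
apply: real_mpoly_prod => j; apply: real_mpolyB; first exact: real_mpolyX.
by apply: real_mpolyZ; [apply: real_pow2|apply: real_mpolyX].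
Qed.

Lemma meval_grid1 M (v : 'I_3 -> K) : meval v (grid1 M) = \prod_(i < M) (2 ^+ i * v 0 - v ord_max).
Proof. by rewrite rmorph_prod; apply: eq_bigr => i _; rewrite /= mevalB mevalZ !mevalXU. Qed.

Lemma meval_grid2 M N (v : 'I_3 -> K) :
  meval v (grid2 M N) = \prod_(j < N) (v 1 - 2 ^+ (M * j) * v ord_max).
Proof. by rewrite rmorph_prod; apply: eq_bigr => i _; rewrite /= mevalB mevalZ !mevalXU. Qed.

Lemma grid_infty M : meval (vec 0 0 1) (grid1 M) != 0.
Proof.
rewrite meval_grid1 /vec /=; apply/prodf_neq0 => i _.
by rewrite mulr0 sub0r oppr_eq0 oner_eq0.
Qed.

(** The division l = i + M j picks one line from each grid. Powers of 2 serve to give the M N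
    intersection points distinct projections 2^l. *)
Lemma grid_points M N l : (l < M * N)%N ->
  exists z, meval (vec 1 (2 ^+ l) z) (grid1 M) = 0 /\ meval (vec 1 (2 ^+ l) z) (grid2 M N) = 0.
Proof.
move=> lMN; have M0 : (0 < M)%N by case: M lMN.
have lm : (l %% M < M)%N by rewrite ltn_mod.
have ld : (l %/ M < N)%N by rewrite ltn_divLR // mulnC.
exists (2 ^+ (l %% M)); split.
  rewrite meval_grid1 (bigD1 (Ordinal lm)) //= /vec /= mulr1 subrr mul0r //.
rewrite meval_grid2 (bigD1 (Ordinal ld)) //= /vec /= -exprD mulnC -divn_eq subrr mul0r //.
Qed.

Lemma grid_empty_line M N z : meval (vec 1 0 z) (grid1 M) = 0 -> meval (vec 1 0 z) (grid2 M N) != 0.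
Proof.
rewrite meval_grid1 meval_grid2 /vec /= => /eqP/prodf_eq0[i _].
rewrite mulr1 subr_eq0 => /eqP <-; apply/prodf_neq0 => j _.
by rewrite sub0r oppr_eq0 mulf_neq0 // expf_neq0 // pnatr_eq0.
Qed.

End RealPolynomials.

(** * Generic pencils *)

Lemma nonroot (D : idomainType) (p : {poly D}) (f : nat -> D) : p != 0 -> injective f ->
  exists i, p.[f i] != 0.
Proof.
move=> p0 fi; apply/not_existsP => hp.
have : all (root p) [seq f i | i <- iota 0 (size p)].
  by apply/allP => _ /mapP[i _ ->]; have /negP := hp i; rewrite negbK.
move=> /(max_poly_roots p0); rewrite map_inj_uniq // iota_uniq size_map size_iota ltnn.
by move=> /(_ isT).
Qed.

Lemma vec_scale (K : fieldType) (v : 'I_3 -> K) : v 0 != 0 ->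
  v =1 fun i => v 0 * vec 1 (v 1 / v 0) (v ord_max / v 0) i.
Proof.
move=> v0 i; rewrite /vec; case: i => -[|[|[|//]]] i3 /=.
- by rewrite mulr1; congr v; apply/val_inj.
- by rewrite mulrC divfK //; congr v; apply/val_inj.
- by rewrite mulrC divfK //; congr v; apply/val_inj.
Qed.

(** * Singular points of the pencil in the projective plane *)

Section PencilBasePoints.
Local Open Scope card_scope.
Variables (K : numClosedFieldType) (m n : nat).
Hypotheses (archiK : geometric_archimedean K) (completeK : geometric_complete K).
Hypotheses (m_gt1 : (1 < m)%N) (n_gt1 : (1 < n)%N).

Lemma coords_neq0 (p : P2 K) : exists i, coords p i != 0.
Proof.
have := set_valP (repr p); rewrite /= => p0; apply: contrapT => h.
case/eqP: p0; apply/rowP => i; rewrite mxE; apply/eqP/negPn/negP => hi.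
by apply: h; exists i.
Qed.

Lemma singular_pencilP F G (L1 L2 : {mpoly K[3]}) (p : P2 K) :
  regular_at m n F G L1 L2 (coords p) ->
  singular_points (pencil m n F G L1 L2) p <->
  meval (coords p) F = 0 /\ meval (coords p) G = 0.
Proof. by move=> reg; apply: pencil_singularP. Qed.

Lemma card_singular_pencil F G (L1 L2 : {mpoly K[3]}) (s : seq K) (h : K -> K) :
    (forall v : 'I_3 -> K, (exists i, v i != 0) -> regular_at m n F G L1 L2 v) ->
    uniq s ->
    (forall v : 'I_3 -> K, (exists i, v i != 0) ->
      (meval v F = 0 /\ meval v G = 0) <->
      [/\ v 0 != 0, v 1 / v 0 \in s & v ord_max / v 0 = h (v 1 / v 0)]) ->
  singular_points (pencil m n F G L1 L2) #= `I_(size s).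
Proof.
move=> reg us base.
pose g (y : K) : P2 K := affine_point (y, h y).
have -> : singular_points (pencil m n F G L1 L2) = (fun i => g (nth 0 s i)) @` `I_(size s).
  apply/seteqP; split=> [p|_ [i /= i_lt <-]].
    move=> /(singular_pencilP (reg _ (coords_neq0 p)))/(base _ (coords_neq0 p))[p0 ps ph].
    exists (index (coords p 1 / coords p 0) s); first by rewrite /= index_mem.
    by rewrite /g nth_index // -ph -[RHS](affine_coords p0).
  apply/(singular_pencilP (reg _ (coords_neq0 _)))/(base _ (coords_neq0 _)).
  have [g0 [-> ->]] := affine_pointK (nth 0 s i, h (nth 0 s i)).
  by split=> //; apply: mem_nth.
apply: inj_card_eq => i j /set_mem i_lt /set_mem j_lt gij.
have [_ e1] := affine_pointK (nth 0 s i, h (nth 0 s i)).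
have [_ e2] := affine_pointK (nth 0 s j, h (nth 0 s j)).
by move: e1; rewrite -/(g _) gij e2 => -[/eqP]; rewrite nth_uniq // => /eqP ->.
Qed.

(** The conjugate of a base point over a real [y] is a base point over the same [y], and there is
    only one. *)
Lemma real_singular_pencil F G (L1 L2 : {mpoly K[3]}) (s : seq K) (h : K -> K) :
    real_mpoly F -> real_mpoly G ->
    (forall v : 'I_3 -> K, (exists i, v i != 0) -> regular_at m n F G L1 L2 v) ->
    (forall y, y \in s -> y \is Num.real) ->
    (forall v : 'I_3 -> K, (exists i, v i != 0) ->
      (meval v F = 0 /\ meval v G = 0) <->
      [/\ v 0 != 0, v 1 / v 0 \in s & v ord_max / v 0 = h (v 1 / v 0)]) ->
  forall p, singular_points (pencil m n F G L1 L2) p -> real_point p.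
Proof.
move=> rF rG reg rs base p /(singular_pencilP (reg _ (coords_neq0 p))).
move=> /(base _ (coords_neq0 p))[p0 ps ph].
set y := coords p 1 / coords p 0 in ps ph; set z := coords p ord_max / coords p 0 in ph.
have nz c : exists i, vec (1 : K) y c i != 0 by exact: vec1_neq0.
have cy : y^* = y by apply/CrealP/rs.
have cz : z^* = z.
  have [Fz Gz] : meval (vec 1 y z) F = 0 /\ meval (vec 1 y z) G = 0.
    by apply/(base _ (nz z)); rewrite /vec /= !divr1; split; rewrite // oner_eq0.
  have : meval (vec 1 y z^*) F = 0 /\ meval (vec 1 y z^*) G = 0.
    have e : vec 1 y z^* =1 (fun i => (vec 1 y z i)^*).
      by move=> i; rewrite conj_vec conjC1 cy.
    by rewrite !(meval_eq _ e) -!conj_meval // Fz Gz conjC0.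
  by move=> /(base _ (nz z^*)); rewrite /vec /= !divr1 ph => -[].
(* The coordinates of [p] are [coords p 0] times the real vector (1, y, z), so conjugation
   multiplies them by this ratio. *)
apply: (@pi_eq _ _ _ ((coords p 0)^* / coords p 0)).
  by rewrite mulf_neq0 ?invr_eq0 // conjC_eq0.
move=> i; rewrite /conj_nzvec /= mxE -/(coords p i).
rewrite (vec_scale p0 i) -/y -/z.
rewrite rmorphM /= (_ : (vec 1 y z i)^* = vec 1 y z i).
  by rewrite mulrA divfK.
by rewrite [LHS](conj_vec 1 y z i) conjC1 cy cz.
Qed.
End PencilBasePoints.

(** * Real roots along a real line *)

Section RealRoots.
Variable R : realType.
Local Notation K := (Cfield R).
Local Notation toK x := (real_complex R x : K).

Definition real_part (p : {poly K}) : {poly R} := \poly_(i < size p) complex.Re (p`_i).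

Lemma ReM_real (a : K) (x : R) : complex.Re (a * toK x) = complex.Re a * x.
Proof. by case: a => a b /=; rewrite mulr0 subr0. Qed.

Lemma horner_real_part (p : {poly K}) x : (real_part p).[x] = complex.Re p.[toK x].
Proof.
rewrite horner_poly horner_coef.
rewrite (big_morph (@complex.Re R) (id1 := 0) (op1 := +%R)) //; last first.
  by move=> [a b] [c d].
by apply: eq_bigr => i _; rewrite -rmorphXn ReM_real.
Qed.

Lemma real_partK (p : {poly K}) : (forall j, p`_j \is Num.real) ->
  map_poly (real_complex R) (real_part p) = p.
Proof.
move=> hp; apply/polyP => j; rewrite coef_map coef_poly /=.
case: ltnP => [_|pj]; first by rewrite RRe_real.
by rewrite nth_default.
Qed.

(** The D simple real roots at s = 0 persist as D distinct real roots. A list of length at most D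
    containing all roots consists of precisely these. *)
Lemma real_roots_line (rho : R -> {poly K}) (D : nat) (ys : seq R) :
    (forall y, exists w : {poly K}, forall s, (rho s).[toK y] = w.[toK s]) ->
    (forall s j, (rho s)`_j \is Num.real) ->
    rho 0 != 0 -> (size (rho 0%R) <= D.+1)%N -> uniq ys -> size ys = D ->
    (forall y, y \in ys -> (rho 0).[toK y] = 0) ->
  exists2 eta : R, 0 < eta & forall s, 0 <= s -> s < eta ->
    forall S : seq K, (size S <= D)%N -> (forall y, (rho s).[y] = 0 -> y \in S) ->
    forall y, y \in S -> y \is Num.real.
Proof.
move=> hw hr rho0 srho us sys hys.
have E s : map_poly (real_complex R) (real_part (rho s)) = rho s by apply: real_partK.
have ucs (zs : seq R) : uniq zs -> uniq (map (real_complex R) zs).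
  by move=> uzs; rewrite map_inj_uniq //; apply: complexI.
have [||_ simple] := uniq_roots_separable rho0 _ (ucs _ us).
- by rewrite size_map sys.
- by move=> _ /mapP[y yys ->]; apply: hys.
have [|y yys|eta eta0 h] := @real_roots_persist R (fun s => real_part (rho s)) ys _ us.
- move=> y; have [w wE] := hw y; exists (real_part w) => s.
  by rewrite !horner_real_part wE.
- split; first by rewrite horner_real_part hys.
  have dy := simple (toK y) (hys y yys); rewrite -(E 0) deriv_map horner_map in dy.
  by apply: contraNneq dy => ->; rewrite rmorph0.
exists eta => // s s0 se S sS hS.
have [zs [uzs szs hzs]] := h s s0 se.
have sub : {subset map (real_complex R) zs <= S}.
  move=> _ /mapP[z zzs ->]; apply: hS; rewrite -(E s) horner_map (hzs z zzs).
  exact: rmorph0.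
have Szs : (size S <= size (map (real_complex R) zs))%N by rewrite size_map szs sys.
have [_ eqS] := uniq_min_size (ucs _ uzs) sub Szs.
move=> y; rewrite -eqS => /mapP[z _ ->].
by apply/complex_realP; exists z.
Qed.
End RealRoots.

Section GenericPencil.
Variables (R : realType) (k r m n e : nat).
Local Notation K := (Cfield R).
Local Notation T := (k.-tuple {mpoly K[3]}).
Local Notation A := (@coef_polynomial K k).
Variables (ds : k.-tuple nat) (F G L1 L2 : T -> {mpoly K[3]}).
Hypotheses (r_gt0 : (0 < r)%N) (m_gt1 : (1 < m)%N) (n_gt1 : (1 < n)%N).
Hypotheses (hF : hfam A (r * m) F) (hG : hfam A (r * n) G)
  (hL1 : hfam A e L1) (hL2 : hfam A e L2).
Let real_tuple (t : T) := forall i, real_mpoly (tnth t i).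
Hypothesis real_families : forall t, real_tuple t ->
  [/\ real_mpoly (F t), real_mpoly (G t), real_mpoly (L1 t) & real_mpoly (L2 t)].
Let H t := pencil m n (F t) (G t) (L1 t) (L2 t).
Let d := (r * m * n + e)%N.
Let D := (r * m * (r * n))%N.

Variables tA tB tC : T.
Hypotheses (homA : homog_tuples ds tA) (homB : homog_tuples ds tB) (homC : homog_tuples ds tC).
Hypotheses (realA : real_tuple tA) (realB : real_tuple tB) (realC : real_tuple tC).
Hypotheses (FA : F tA = grid1 K (r * m)) (GA : G tA = grid2 K (r * m) (r * n)).
Hypothesis regB : forall v : 'I_3 -> K, (exists i, v i != 0) ->
  regular_at m n (F tB) (G tB) (L1 tB) (L2 tB) v.
Hypothesis irrC : forall a, (0 < a < d)%N -> no_factor a (d - a) (H tC).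

Let A_const := @coef_polynomial_const K k.
Let A_add := @coef_polynomialD K k.
Let A_mul := @coef_polynomialM K k.

(** Each degree [a] of a factor has its own eliminant; the induction on the bound [b] multiplies
    them together. *)
Lemma irreducible_open : exists2 f, A f & f tC != 0 /\
  forall t, f t != 0 -> forall a, (0 < a < d)%N -> no_factor a (d - a) (H t).
Proof.
have hH : hfam A d H by apply: hfam_pencil.
suff : forall b, (b <= d)%N -> exists2 f, A f & f tC != 0 /\
    forall t, f t != 0 -> forall a, (0 < a < b)%N -> no_factor a (d - a) (H t).
  by apply.
elim=> [_|b IH bd].
  by exists (fun=> 1); [apply: A_const|split=> [|t _ a]; rewrite ?oner_neq0 ?ltn0 ?andbF].
have [f Af [f0 hf]] := IH (ltnW bd).
have [b0|b0] := posnP b.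
  exists f => //; split=> // t ft a; rewrite b0; case: a => [|a]; rewrite ?ltnS ?ltn0 //.
have hH' : hfam A (b + (d - b)) H by rewrite subnKC // ltnW.
have [|g Ag [g0 hg]] := @no_factor_open K 3 T A A_const A_add A_mul b (d - b) H tC hH'.
  by apply: irrC; rewrite b0.
exists (fun t => f t * g t); first exact: A_mul.
split=> [|t]; first by rewrite mulf_neq0.
rewrite mulf_eq0 negb_or => /andP[ft gt] a /andP[a0]; rewrite ltnS leq_eqVlt.
by case/predU1P => [->|ab]; [apply: hg|apply: hf; rewrite ?a0].
Qed.

Theorem generic_pencil : exists U : set T, [/\ zariski_open ds U, U !=set0,
  forall t, U t -> irreducible_curve_with d (r ^ 2 * m * n) m n (H t) &
  exists t, U t /\ real_with_real_singularities (H t)].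
Proof.
have [m0 n0] : (0 < m)%N /\ (0 < n)%N by split; apply: ltnW.
have rm : (1 < r * m)%N by rewrite (leq_trans m_gt1) // leq_pmull.
have rn : (1 < r * n)%N by rewrite (leq_trans n_gt1) // leq_pmull.
have DN : D = (r ^ 2 * m * n)%N by rewrite /D; lia.
have d1 : (1 < d)%N by rewrite /d; have := leq_mul rm n_gt1; lia.
have [fB AfB [fB0 hfB]] := @regular_open K m n m_gt1 n_gt1 T A
  A_const A_add A_mul r e F G L1 L2 r_gt0 hF hG hL1 hL2 tB regB.
have [fC AfC [fC0 hfC]] := irreducible_open.
have [rho [Arho srho rhoE rho_infty]] := eliminant_polynomial A_const A_add A_mul hF hG.
pose fA := base_discriminant (r * m) (r * n) F rho.
have AfA : A fA.
  apply: A_mul; first exact: (form_at A_const A_add A_mul (nth 0 [:: 0; 0; 1])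
    (hfam_form A_const A_add A_mul hF)).
  apply: (A_det_syl A_const A_add A_mul) => // j.
  apply: (A_ext (a := fun t => j.+1%:R * (rho t)`_j.+1)); last exact: A_mul.
  by move=> t; rewrite coef_deriv mulr_natl.
pose ys : seq R := [seq 2 ^+ l | l <- iota 0 D].
have us : uniq ys.
  rewrite map_inj_uniq ?iota_uniq // => i j /eqP.
  by rewrite -!natrX eqr_nat eqn_exp2l // => /eqP.
have sys : size ys = D by rewrite size_map size_iota.
have infA : meval (vec 0 0 1) (F tA) != 0 by rewrite FA grid_infty.
have ptsA (y : R) : y \in ys -> exists z : K, meval (vec 1 (real_complex R y) z) (F tA) = 0 /\
    meval (vec 1 (real_complex R y) z) (G tA) = 0.
  move=> /mapP[l]; rewrite mem_iota => /andP[_ lD] ->.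
  by rewrite rmorphXn rmorph_nat FA GA; apply: grid_points.
have fA0 : fA tA != 0.
  apply: (base_discriminant_neq0 A_const A_add A_mul rm rn hF hG srho rhoE
    (s := map (real_complex R) ys) (y1 := 0)) => //.
  - by rewrite map_inj_uniq //; apply: complexI.
  - by rewrite size_map.
  - by move=> _ /mapP[y yys ->]; apply: ptsA.
  - by move=> z; rewrite FA GA; apply: grid_empty_line.
pose f t := fA t * (fB t * fC t).
have Af : A f by apply: A_mul => //; apply: A_mul.
pose U := homog_tuples ds `&` [set t | f t != 0].
have fP t : f t != 0 -> [/\ fA t != 0, fB t != 0 & fC t != 0].
  by rewrite /f !mulf_eq0 !negb_or => /andP[-> /andP[-> ->]].
(* A real tuple in [U] serves both for nonemptiness and for reality. Its roots are spoken of through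
   lists [S], since the list of roots is supplied only by [base_points]. *)
suff [t [[Ut rt] real_roots]] : exists t, (U t /\ real_tuple t) /\
    forall S : seq K, (size S <= D)%N -> (forall y, (rho t).[y] = 0 -> y \in S) ->
    forall y, y \in S -> y \is Num.real.
  exists U; split.
  - exact: basic_zariski_open.
  - by exists t.
  - move=> t' [_ /fP[fAt fBt fCt]].
    have [s [h [us' ss rs base]]] := base_points A_const A_add A_mul
      rm rn hF hG srho rhoE rho_infty fAt.
    have reg v := hfB t' v fBt.
    have hH : H t' \is d.-homog.
      by have [h1 _] := hfam_pencil A_const A_add A_mul hF hG hL1 hL2; apply: h1.
    split=> //.
    - exact: (no_factor_irreducible hH d1 (hfC t' fCt)).
    - rewrite (_ : (r ^ 2 * m * n)%N = size s); last by rewrite ss -DN.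
      exact: (card_singular_pencil m_gt1 n_gt1 reg us' base).
    - move=> p sp; split=> //.
      have /(singular_pencilP m_gt1 n_gt1 (reg _ (coords_neq0 p)))[Fp Gp] := sp.
      have [L1p L2p jac] := pencil_transversal m_gt1 n_gt1 (reg _ (coords_neq0 p)) Fp Gp.
      have /(base _ (coords_neq0 p))[p0 _ _] := conj Fp Gp.
      exact: (germ_pencil (@complex_archimedean R) (@complex_complete R) m0 n0
        (proj1 hF t') (proj1 hG t') (proj1 hL1 t') (proj1 hL2 t') hH p0 Fp Gp L1p L2p jac).
  - exists t; split=> //; have [_ /fP[fAt fBt fCt]] := Ut.
    have [rF rG rL1 rL2] := real_families rt.
    split.
      exists 1, (H t); split; rewrite ?oner_eq0 ?scale1r //; exact: real_pencil.
    have [s [h [us' ss rs base]]] := base_points A_const A_add A_mul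
      rm rn hF hG srho rhoE rho_infty fAt.
    apply: (real_singular_pencil m_gt1 n_gt1 rF rG (fun v => hfB t v fBt) _ base).
    apply: real_roots; first by rewrite ss.
    by move=> y /eqP; rewrite rs.
have line_real t u s : s \is Num.real -> real_tuple t -> real_tuple u -> real_tuple (line t u s).
  exact: real_line.
have natK_inj : injective (fun i : nat => i%:R : K).
  by move=> i j /eqP; rewrite eqr_nat => /eqP.
(* Two lines are used. The one from [tB] to [tC] contains a real [t1] where [fB] and [fC] are
   nonzero; on the one from [tA] to [t1], [fA] is nonzero at the start and [fB], [fC] at the end,
   while small parameters stay close to the grids. *)
have [qB qBE] := coef_polynomial_line tB tC AfB.
have [qC qCE] := coef_polynomial_line tB tC AfC.
have qBC0 : qB * qC != 0.
  rewrite mulf_neq0 //; apply/eqP => q0.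
    by move: fB0; rewrite -(line0 tB tC) qBE q0 horner0 eqxx.
  by move: fC0; rewrite -(line1 tB tC) qCE q0 horner0 eqxx.
have [i0 hi0] := nonroot qBC0 natK_inj.
pose t1 := line tB tC i0%:R.
have hom1 : homog_tuples ds t1 by apply: line_homog.
have real1 : real_tuple t1 by apply: line_real => //; rewrite realn.
have [q qE] := coef_polynomial_line tA t1 Af.
have [qA qAE] := coef_polynomial_line tA t1 AfA.
have [q1 q1E] := coef_polynomial_line tA t1 (A_mul AfB AfC).
have qA1 : qA * q1 != 0.
  rewrite mulf_neq0 //; apply/eqP => q0.
    by move: fA0; rewrite -(line0 tA t1) qAE q0 horner0 eqxx.
  have := q1E 1; rewrite line1 q0 horner0 /t1 qBE qCE -hornerM => /eqP.
  by rewrite (negPf hi0).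
pose tt s := line tA t1 (real_complex R s).
have tt0 : tt 0 = tA by rewrite /tt rmorph0 line0.
have real_tt s : real_tuple (tt s).
  by apply: line_real => //; apply/complex_realP; exists s.
have hom_tt s : homog_tuples ds (tt s) by apply: line_homog.
have rho_horner y : A (fun t => (rho t).[y]).
  apply: (A_ext (a := fun t => \sum_(i < D.+1) (rho t)`_i * y ^+ i)).
    by move=> t; rewrite (horner_coef_wide _ (srho t)).
  by apply: (A_sum A_const A_add) => i _; apply: A_mul.
have [||||y yys|eta eta0 heta] := @real_roots_line R (fun s => rho (tt s)) D ys _ _ _ _ us sys.
- move=> y; have [w wE] := coef_polynomial_line tA t1 (rho_horner (real_complex R y)).
  by exists w => s; rewrite -wE.
- move=> s; have [rF rG _ _] := real_families (real_tt s).
  exact: real_eliminant_poly rF rG (rhoE (tt s)).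
- rewrite tt0; apply/eqP => rho0.
  have : (rho tA).[0] = 0 by rewrite rho0 horner0.
  rewrite rhoE => /(common_zeroP A_const A_add A_mul rn hF hG _ _ infA)[z [Fz]].
  by apply/eqP; rewrite GA; apply: (@grid_empty_line _ (r * m)); rewrite -FA.
- by [].
- rewrite tt0 rhoE; apply/(common_zeroP A_const A_add A_mul rn hF hG) => //.
  exact: ptsA.
(* Infinitely many parameters strictly between 0 and [eta], whence the denominators starting at 2;
   one of them avoids the finitely many bad values. *)
have inv_inj : injective (fun i : nat => real_complex R (eta / i.+2%:R) : K).
  move=> i j /(@complexI R) /(mulfI (lt0r_neq0 eta0)) /invr_inj/eqP.
  by rewrite eqr_nat => /eqP[].
have [i hi] := nonroot qA1 inv_inj.
pose s := eta / i.+2%:R.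
have s0 : 0 <= s by rewrite divr_ge0 // ltW.
have s1 : s < eta by rewrite ltr_pdivrMr // ltr_pMr // ltr1n.
exists (tt s); split; last exact: heta s0 s1.
split; last exact: real_tt.
split; first exact: hom_tt.
by rewrite /= /f /tt qAE q1E -hornerM.
Qed.
End GenericPencil.

(** * The two cases of the theorem *)

Section Tuples.
Variable K : numClosedFieldType.
Implicit Types F G L : {mpoly K[3]}.

Lemma homog_tuples2 d e F G : F \is d.-homog -> G \is e.-homog ->
  homog_tuples [tuple d; e] [tuple F; G].
Proof. by move=> hF hG [[|[|//]] ilt]; rewrite !(tnth_nth 0). Qed.

Lemma homog_tuples4 d e F G L1 L2 : F \is d.-homog -> G \is e.-homog ->
  L1 \is 1.-homog -> L2 \is 1.-homog ->
  homog_tuples [tuple d; e; 1%N; 1%N] [tuple F; G; L1; L2].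
Proof. by move=> hF hG h1 h2 [[|[|[|[|//]]]] ilt]; rewrite !(tnth_nth 0). Qed.

Lemma real_tuple2 F G : real_mpoly F -> real_mpoly G ->
  forall i, real_mpoly (tnth [tuple F; G] i).
Proof. by move=> hF hG [[|[|//]] ilt]; rewrite !(tnth_nth 0). Qed.

Lemma real_tuple4 F G L1 L2 : real_mpoly F -> real_mpoly G -> real_mpoly L1 ->
  real_mpoly L2 -> forall i, real_mpoly (tnth [tuple F; G; L1; L2] i).
Proof. by move=> hF hG h1 h2 [[|[|[|[|//]]]] ilt]; rewrite !(tnth_nth 0). Qed.

Lemma real_fermat i j e : real_mpoly (fermat K i j e).
Proof. by apply: real_mpolyD; apply: real_mpolyXn; apply: real_mpolyX. Qed.

Lemma real_rationalF r m : real_mpoly (rationalF K r m).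
Proof.
apply: real_mpolyD; last by apply: real_mpolyXn; apply: real_mpolyX.
by apply: real_mpolyM; [apply: real_mpolyX|apply: real_mpolyXn; apply: real_mpolyX].
Qed.

Lemma real_rationalG r m : real_mpoly (rationalG K r m).
Proof.
by apply: real_mpolyM; [apply: real_mpolyX|apply: real_mpolyXn; apply: real_mpolyX].
Qed.
End Tuples.

Lemma tuple2_eta T (t : 2.-tuple T) : [tuple tnth t 0; tnth t 1] = t.
Proof.
apply: eq_from_tnth => -[[|[|//]] ilt];
  by rewrite (tnth_nth (tnth t 0)) /=; congr tnth; apply/val_inj.
Qed.

Lemma tuple4_eta T (t : 4.-tuple T) :
  [tuple tnth t 0; tnth t 1; tnth t (inord 2); tnth t ord_max] = t.
Proof.
apply: eq_from_tnth => -[[|[|[|[|//]]]] ilt];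
  by rewrite (tnth_nth (tnth t 0)) /=; congr tnth; apply/val_inj; rewrite //= inordK.
Qed.

Section Examples.
Variables (R : realType) (r m n : nat).
Local Notation K := (Cfield R).
Local Notation XX i := (@mpolyX 3 K (mnm1 i)).
Hypotheses (r_gt0 : (0 < r)%N) (m_gt1 : (1 < m)%N) (n_gt1 : (1 < n)%N).

Lemma generic_coprime_pencil : coprime m n -> exists U : set (2.-tuple {mpoly K[3]}),
  [/\ zariski_open [tuple (r * m)%N; (r * n)%N] U, U !=set0,
      forall F G, U [tuple F; G] ->
        irreducible_curve_with (r * m * n) (r ^ 2 * m * n) m n (F ^+ n + G ^+ m) &
      exists F G, U [tuple F; G] /\ real_with_real_singularities (F ^+ n + G ^+ m)].
Proof.
move=> cmn.
have rm : (0 < r * m)%N by rewrite muln_gt0 r_gt0 ltnW.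
have rn : (0 < r * n)%N by rewrite muln_gt0 r_gt0 ltnW.
(* hfam asks for homogeneity at all tuples, not only those in homog_tuples. *)
pose F (t : 2.-tuple {mpoly K[3]}) := pihomog mdeg (r * m) (tnth t 0).
pose G (t : 2.-tuple {mpoly K[3]}) := pihomog mdeg (r * n) (tnth t 1).
pose L (t : 2.-tuple {mpoly K[3]}) : {mpoly K[3]} := 1.
have hL : hfam (@coef_polynomial K 2) 0 L.
  by apply: hfam_const; [apply: coef_polynomial_const|apply: dhomog1].
have FE P Q : P \is (r * m).-homog -> F [tuple P; Q] = P by exact: pihomog_dE.
have GE P Q : Q \is (r * n).-homog -> G [tuple P; Q] = Q by exact: pihomog_dE.
have HE P Q : P \is (r * m).-homog -> Q \is (r * n).-homog ->
    pencil m n (F [tuple P; Q]) (G [tuple P; Q]) 1 1 = P ^+ n + Q ^+ m.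
  by move=> hP hQ; rewrite FE // GE // /pencil !mul1r.
have [|||||||||||U [Uo U0 Ucurve [t [Ut rt]]]] := @generic_pencil R 2 r m n 0
  [tuple (r * m)%N; (r * n)%N] F G L L r_gt0 m_gt1 n_gt1
  (hfam_pihomog _ _ _) (hfam_pihomog _ _ _) hL hL _
  [tuple grid1 K (r * m); grid2 K (r * m) (r * n)]
  [tuple fermat K 0 ord_max (r * m); fermat K 1 ord_max (r * n)]
  [tuple rationalF K r m; rationalG K r n].
- by move=> t rt; split; do ?[exact: real_pihomog]; apply: real_mpoly1.
- by apply: homog_tuples2; [apply: homog_grid1|apply: homog_grid2].
- by apply: homog_tuples2; apply: homog_fermat.
- by apply: homog_tuples2; [apply: homog_rationalF|apply: homog_rationalG].
- by apply: real_tuple2; [apply: real_grid1|apply: real_grid2].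
- by apply: real_tuple2; apply: real_fermat.
- by apply: real_tuple2; [apply: real_rationalF|apply: real_rationalG].
- by rewrite FE ?homog_grid1.
- by rewrite GE ?homog_grid2.
- by move=> v v0; rewrite FE ?homog_fermat // GE ?homog_fermat //; apply: regular_at_fermat.
- move=> a a_lt; rewrite FE ?homog_rationalF // GE ?homog_rationalG // addn0.
  by apply: no_factor_rational_pencil => //; move: a_lt; rewrite addn0.
have homU P Q : U [tuple P; Q] -> P \is (r * m).-homog /\ Q \is (r * n).-homog.
  by case: Uo => S _ -> [h _]; split; [apply: (h ord0)|apply: (h 1)].
exists U; split=> // [P Q UPQ|].
  have [hP hQ] := homU _ _ UPQ.
  by have := Ucurve _ UPQ; rewrite HE // addn0.
exists (tnth t 0), (tnth t 1).
rewrite -[t in U t]tuple2_eta in Ut.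
have [hP hQ] := homU _ _ Ut; split=> //.
by move: rt; rewrite -[t]tuple2_eta HE // tuple2_eta.
Qed.

Lemma generic_linear_pencil : exists U : set (4.-tuple {mpoly K[3]}),
  [/\ zariski_open [tuple (r * m)%N; (r * n)%N; 1%N; 1%N] U, U !=set0,
      forall F G L1 L2, U [tuple F; G; L1; L2] ->
        irreducible_curve_with (r * m * n + 1) (r ^ 2 * m * n) m n (L1 * F ^+ n + L2 * G ^+ m) &
      exists F G L1 L2, U [tuple F; G; L1; L2] /\
        real_with_real_singularities (L1 * F ^+ n + L2 * G ^+ m)].
Proof.
have rm : (0 < r * m)%N by rewrite muln_gt0 r_gt0 ltnW.
have rn : (0 < r * n)%N by rewrite muln_gt0 r_gt0 ltnW.
pose i2 : 'I_4 := inord 2.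
pose F (t : 4.-tuple {mpoly K[3]}) := pihomog mdeg (r * m) (tnth t 0).
pose G (t : 4.-tuple {mpoly K[3]}) := pihomog mdeg (r * n) (tnth t 1).
pose L1 (t : 4.-tuple {mpoly K[3]}) := pihomog mdeg 1 (tnth t i2).
pose L2 (t : 4.-tuple {mpoly K[3]}) := pihomog mdeg 1 (tnth t ord_max).
have hE P Q M1 M2 : P \is (r * m).-homog -> Q \is (r * n).-homog ->
    M1 \is 1.-homog -> M2 \is 1.-homog ->
    [/\ F [tuple P; Q; M1; M2] = P, G [tuple P; Q; M1; M2] = Q,
        L1 [tuple P; Q; M1; M2] = M1 & L2 [tuple P; Q; M1; M2] = M2].
  move=> hP hQ h1 h2; split; try exact: pihomog_dE.
  by rewrite /L1 (tnth_nth 0) inordK //=; apply: pihomog_dE.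
have [c _ regB] := @regular_at_fermat_linear K r m n r_gt0 m_gt1 n_gt1.
have hX i : XX i \is 1.-homog by exact: homogXX.
have hcX i : c%:R *: XX i \is 1.-homog by rewrite rpredZ.
have rX i : real_mpoly (XX i) by exact: real_mpolyX.
have [|||||||||||U [Uo U0 Ucurve [t [Ut rt]]]] := @generic_pencil R 4 r m n 1
  [tuple (r * m)%N; (r * n)%N; 1%N; 1%N] F G L1 L2 r_gt0 m_gt1 n_gt1
  (hfam_pihomog _ _ _) (hfam_pihomog _ _ _) (hfam_pihomog _ _ _) (hfam_pihomog _ _ _) _
  (* The condition tested at the grids concerns F and G alone, so any real linear forms complete the
     tuple. *)
  [tuple grid1 K (r * m); grid2 K (r * m) (r * n); XX 0; XX 0]
  [tuple fermat K 0 ord_max (r * m); fermat K 1 ord_max (r * n); XX 0; c%:R *: XX 1]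
  [tuple XX 1 ^+ (r * m); XX ord_max ^+ (r * n); XX 0; XX ord_max].
- by move=> t rt; split; exact: real_pihomog.
- by apply: homog_tuples4 => //; [apply: homog_grid1|apply: homog_grid2].
- by apply: homog_tuples4 => //; apply: homog_fermat.
- by apply: homog_tuples4 => //; apply: homogXXn.
- by apply: real_tuple4 => //; [apply: real_grid1|apply: real_grid2].
- apply: real_tuple4 => //; try exact: real_fermat.
  by apply: real_mpolyZ => //; apply: realn.
- by apply: real_tuple4 => //; apply: real_mpolyXn.
- by have [] := hE _ _ _ _ (homog_grid1 K (r * m)) (homog_grid2 K (r * m) (r * n)) (hX 0) (hX 0).
- by have [] := hE _ _ _ _ (homog_grid1 K (r * m)) (homog_grid2 K (r * m) (r * n)) (hX 0) (hX 0).
- move=> v v0.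
  have [-> -> -> ->] := hE _ _ _ _ (homog_fermat K 0 ord_max (r * m))
    (homog_fermat K 1 ord_max (r * n)) (hX 0) (hcX 1).
  exact: regB.
- move=> a a_lt.
  have [-> -> -> ->] := hE _ _ _ _ (homogXXn K 1 (r * m)) (homogXXn K ord_max (r * n))
    (hX 0) (hX ord_max).
  exact: no_factor_monomial_pencil.
have homU P Q M1 M2 : U [tuple P; Q; M1; M2] ->
    [/\ P \is (r * m).-homog, Q \is (r * n).-homog, M1 \is 1.-homog & M2 \is 1.-homog].
  case: Uo => S _ -> [h _]; have := h i2; rewrite !(tnth_nth 0) inordK //= => h2.
  by split=> //; [apply: (h ord0)|apply: (h 1)|apply: (h ord_max)].
have HE P Q M1 M2 : U [tuple P; Q; M1; M2] ->
    pencil m n (F [tuple P; Q; M1; M2]) (G [tuple P; Q; M1; M2])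
      (L1 [tuple P; Q; M1; M2]) (L2 [tuple P; Q; M1; M2]) = M1 * P ^+ n + M2 * Q ^+ m.
  by move=> /homU[hP hQ h1 h2]; have [-> -> -> ->] := hE _ _ _ _ hP hQ h1 h2.
exists U; split=> // [P Q M1 M2 UPQ|].
  by have := Ucurve _ UPQ; rewrite HE.
exists (tnth t 0), (tnth t 1), (tnth t i2), (tnth t ord_max).
rewrite -[t in U t]tuple4_eta in Ut.
split; first exact: Ut.
by have := HE _ _ _ _ Ut; rewrite tuple4_eta => <-.
Qed.
End Examples.

Theorem theorem3p6 (R : realType) (m n : nat) (hm : (2 <= m)%N)
    (hmn : (m <= n)%N) :
  (gcdn m n = 1%N -> forall r : nat, (1 <= r)%N ->
    let d := (r * m * n)%N in
    let N := (r ^ 2 * m * n)%N in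
    N%:Q = d%:Q ^+ 2 / (m * n)%N%:Q /\
    exists U : set (2.-tuple {mpoly (Cfield R)[3]}),
    [/\ zariski_open [tuple (r * m)%N; (r * n)%N] U,
        U !=set0,
        forall F G : {mpoly (Cfield R)[3]}, U [tuple F; G] ->
          irreducible_curve_with d N m n (F ^+ n + G ^+ m) &
        exists F G : {mpoly (Cfield R)[3]}, U [tuple F; G] /\
          real_with_real_singularities (F ^+ n + G ^+ m)])
  /\
  ((1 < gcdn m n)%N -> forall r : nat, (1 <= r)%N ->
    let d := (r * m * n + 1)%N in
    let N := (r ^ 2 * m * n)%N in
    N%:Q = (d%:Q - 1) ^+ 2 / (m * n)%N%:Q /\
    exists U : set (4.-tuple {mpoly (Cfield R)[3]}),
    [/\ zariski_open [tuple (r * m)%N; (r * n)%N; 1%N; 1%N] U,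
        U !=set0,
        forall F G L1 L2 : {mpoly (Cfield R)[3]}, U [tuple F; G; L1; L2] ->
          irreducible_curve_with d N m n (L1 * F ^+ n + L2 * G ^+ m) &
        exists F G L1 L2 : {mpoly (Cfield R)[3]}, U [tuple F; G; L1; L2] /\
          real_with_real_singularities (L1 * F ^+ n + L2 * G ^+ m)]).
Proof.
have n_gt1 : (1 < n)%N by apply: leq_trans hmn.
have mn0 : (m * n)%N%:Q != 0 by rewrite pnatr_eq0 -lt0n muln_gt0; apply/andP; split; apply: ltnW.
have count r : (r ^ 2 * m * n)%N%:Q = (r * m * n)%N%:Q ^+ 2 / (m * n)%N%:Q.
  apply/(canRL (mulfK mn0)); rewrite -!natrX -natrM; congr _%:R; lia.
split=> [/eqP cmn r r_gt0|_ r r_gt0] d N; split.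
- exact: count.
- exact: generic_coprime_pencil.
- by rewrite count /d PoszD intrD addrK.
- exact: generic_linear_pencil.
Qed.
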